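(* Let $V$ be a finite-dimensional real normed space, $m\ge 1$ an integer, $p\ge 1$ a real number, and let $\omega$ be a control satisfying condition $(H_{p})$ (defined in the context). Let $Y$ be a $G^m(V)$-valued path. Then $Y$ belongs to $C^{\omega,p}(G^{m}(V))$ if and only if there exists a sequence $(y(n))_n$ of smooth $V$-valued paths such that (i) $\sup_{n}\left\Vert S_{m}(y(n))\right\Vert _{\omega,p}<\infty$, and (ii) $S_{m}(y(n))$ converges pointwise on $[0,1]$ to $Y$. In particular, for such a sequence, $d_{\omega,q}(S_{m}(y(n)),Y)\to 0$ as $n\to\infty$ for every $q>p$.
   Context: $T^{(m)}(V)=\bigoplus_{n=0}^{m}V^{\otimes n}$ is the truncated tensor algebra with (truncated) product $\otimes$; $\mathcal{G}^{m}(V)$ is its Lie subalgebra generated by $V$ for the bracket $[a,b]=a\otimes b-b\otimes a$; $G^{m}(V)=\exp(\mathcal{G}^{m}(V))$ is the free nilpotent Lie group of step $m$ over $V$, with product $\otimes$ and neutral element $1$. The dilation is $\delta_{t}(1+v_{1}+\dots+v_{m})=1+tv_{1}+\dots+t^{m}v_{m}$, $v_i\in V^{\otimes i}$, $t\in\mathbb{R}$. $\|\cdot\|_{m}$ is a fixed symmetric subadditive homogeneous norm on $G^{m}(V)$, i.e. a function $G^m(V)\to[0,\infty)$ with $\|g\|_m=0$ iff $g=1$, $\|\delta_t g\|_m=|t|\,\|g\|_m$, $\|g\otimes h\|_m\le\|g\|_m+\|h\|_m$, $\|g^{-1}\|_m=\|g\|_m$ (for instance the Carnot–Caratheodory norm;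 all such norms are equivalent since $\dim V<\infty$). Set $d_{m}(g,h)=\|g^{-1}\otimes h\|_{m}$. A $G^m(V)$-valued path is a continuous map $[0,1]\to G^{m}(V)$ starting at $1$; for such a path $Y_{s,t}:=Y_{s}^{-1}\otimes Y_{t}$. For a smooth path $y:[0,1]\to V$, the signature is $S_{m}(y)_{s,t}=1+\sum_{k=1}^{m}\int_{s<u_{1}<\dots<u_{k}<t}dy_{u_{1}}\otimes\dots\otimes dy_{u_{k}}\in G^{m}(V)$, and $S_m(y)$ denotes the $G^m(V)$-valued path $t\mapsto S_m(y)_{0,t}$. A control is a continuous function $\omega:\{(s,t):0\le s\le t\le 1\}\to[0,\infty)$ with $\omega(t,t)=0$ for all $t$ and $\omega(s,t)+\omega(t,u)\le\omega(s,u)$ for $s<t<u$. It satisfies condition $(H_p)$ if it is not identically $0$ and there is a constant $C$ such that $\frac{\omega(r,u)}{(u-r)^{p}}\le C\frac{\omega(s,t)}{(t-s)^{p}}$ for all $r<s<t<u$ in $[0,1]$. $d_{\omega,p}(x,y)=\sup_{0\le s<t\le 1}\frac{d_{m}(x_{s,t},y_{s,t})}{\omega(s,t)^{1/p}}$, $\|x\|_{\omega,p}$ is $d_{\omega,p}$ between $x$ and the constant path $1$, and $C^{\omega,p}(G^{m}(V))$ is the set of $G^m(V)$-valued paths $x$ with $\|x\|_{\omega,p}<\infty$. *)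

(* Defs.v *)
From HB Require Import structures.
From mathcomp Require Import all_boot all_order all_algebra.
From mathcomp Require Import all_classical all_reals all_analysis.

Set Implicit Arguments.
Unset Strict Implicit.
Unset Printing Implicit Defensive.

Import Order.TTheory GRing.Theory Num.Theory.
Import numFieldNormedType.Exports.

Local Open Scope classical_set_scope.
Local Open Scope ring_scope.

#[short(type="finNormedModType")]
HB.structure Definition FinNormedModule (K : numFieldType) :=
  {V of NormedModule K V & Vector K V}.

(* Coordinates on the tensor algebra of a space of dimension d with basis
   (e_i): the word i_1...i_k of length k <= m stands for the basis vector
   e_(i_1) (x) ... (x) e_(i_k) of the k-th tensor power, the empty word for 1.
   This is an alias because functions into a ring already carry the pointwise
   product; the topology is the (finite-dimensional) product topology. *)
Definition tensor_alg (R : realType) (d m : nat) : Type := m.-bseq 'I_d -> R.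

HB.instance Definition _ (R : realType) (d m : nat) :=
  Choice.copy (tensor_alg R d m) (m.-bseq 'I_d -> R).
HB.instance Definition _ (R : realType) (d m : nat) :=
  GRing.Lmodule.copy (tensor_alg R d m) (m.-bseq 'I_d -> R).
HB.instance Definition _ (R : realType) (d m : nat) :=
  Topological.copy (tensor_alg R d m) {ptws m.-bseq 'I_d -> R}.

Section TensorAlg.
Variables (R : realType) (d m : nat).
Local Notation T := (tensor_alg R d m).
Implicit Types (a b c : T) (w : m.-bseq 'I_d) (s : seq 'I_d).

(* insub_bseq only casts here: subwords of w have size at most m. *)
Definition tmul a b : T := fun w =>
  \sum_(k < (size w).+1)
    a (insub_bseq m (take k w)) * b (insub_bseq m (drop k w)).

Definition tone : T := fun w => (size w == 0%N)%:R.

Definition wconv (f g : seq 'I_d -> R) s : R :=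
  \sum_(k < (size s).+1) f (take k s) * g (drop k s).

Definition wext a s : R := a (insub_bseq m s).

Fact insub_bseqE s : (size s <= m)%N -> insub_bseq m s = s :> seq 'I_d.
Proof. by move=> sm; rewrite /insub_bseq val_insubd sm. Qed.

Fact insub_bseqK w : insub_bseq m w = w.
Proof. by apply: val_inj; rewrite /= insub_bseqE // size_bseq. Qed.

Fact wconv_nil f g : wconv f g [::] = f [::] * g [::].
Proof. by rewrite /wconv big_ord1. Qed.

Fact wconv_cons f g i s : wconv f g (i :: s) =
  f [::] * g (i :: s) + wconv (fun r => f (i :: r)) g s.
Proof. by rewrite /wconv big_ord_recl. Qed.

Fact wconvDl f1 f2 g s :
  wconv (fun r => f1 r + f2 r) g s = wconv f1 g s + wconv f2 g s.
Proof. by rewrite /wconv -big_split; apply: eq_bigr => k _; rewrite mulrDl. Qed.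

Fact wconvDr f g1 g2 s :
  wconv f (fun r => g1 r + g2 r) s = wconv f g1 s + wconv f g2 s.
Proof. by rewrite /wconv -big_split; apply: eq_bigr => k _; rewrite mulrDr. Qed.

Fact wconvZl x f g s : wconv (fun r => x * f r) g s = x * wconv f g s.
Proof. by rewrite /wconv mulr_sumr; apply: eq_bigr => k _; rewrite mulrA. Qed.

Fact wconvZr x f g s : wconv f (fun r => x * g r) s = x * wconv f g s.
Proof. by rewrite /wconv mulr_sumr; apply: eq_bigr => k _; rewrite mulrCA. Qed.

Fact eq_wconv f1 f2 g1 g2 s :
    (forall r, (size r <= size s)%N -> f1 r = f2 r) ->
    (forall r, (size r <= size s)%N -> g1 r = g2 r) ->
  wconv f1 g1 s = wconv f2 g2 s.
Proof.
move=> f12 g12; apply: eq_bigr => k _; rewrite f12 ?g12 //.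
  by rewrite size_drop leq_subr.
by rewrite size_take_min geq_minr.
Qed.

Fact wconvA f g h s : wconv f (wconv g h) s = wconv (wconv f g) h s.
Proof.
elim: s f => [|i s IH] f; first by rewrite !wconv_nil mulrA.
rewrite !wconv_cons IH wconv_nil mulrDr mulrA -addrA; congr (_ + _).
rewrite -wconvZl -wconvDl; apply: eq_bigr => k _; congr (_ * _).
by rewrite wconv_cons.
Qed.

Fact wext_tmul a b s : (size s <= m)%N -> wext (tmul a b) s = wconv (wext a) (wext b) s.
Proof. by move=> sm; rewrite /wext /tmul insub_bseqE. Qed.

Fact tmulE a b w : tmul a b w = wconv (wext a) (wext b) w.
Proof. by []. Qed.

Fact tmulA : associative tmul.
Proof.
move=> a b c; apply/funext => w; rewrite !tmulE.
transitivity (wconv (wext a) (wconv (wext b) (wext c)) w).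
  apply: eq_wconv => // r rw; rewrite wext_tmul //.
  exact: leq_trans rw (size_bseq w).
rewrite wconvA; apply: eq_wconv => // r rw; rewrite wext_tmul //.
exact: leq_trans rw (size_bseq w).
Qed.

Fact wext_tone s : (size s <= m)%N -> wext tone s = (size s == 0%N)%:R.
Proof. by move=> sm; rewrite /wext /tone insub_bseqE. Qed.

Fact tmul1l : left_id tone tmul.
Proof.
move=> a; apply/funext => w; rewrite /tmul big_ord_recl big1 => [|k _].
  by rewrite take0 drop0 insub_bseqK [tone _]wext_tone // eqxx mul1r addr0.
rewrite [tone _]wext_tone ?size_take_min.
  rewrite /= /bump /= add1n (minn_idPl _) ?mul0r //.
by rewrite geq_min size_bseq orbT.
Qed.

Fact tmul1r : right_id tone tmul.
Proof.
move=> a; apply/funext => w; rewrite /tmul big_ord_recr big1 => [|k _] /=.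
  by rewrite take_size drop_size insub_bseqK [tone _]wext_tone // eqxx mulr1 add0r.
rewrite [tone _]wext_tone ?size_drop.
  by rewrite subn_eq0 leqNgt ltn_ord mulr0.
by rewrite (leq_trans (leq_subr _ _)) // size_bseq.
Qed.

Fact tmulDl : left_distributive tmul +%R.
Proof.
move=> a b c; apply/funext => w.
exact: (wconvDl (wext a) (wext b) (wext c) w).
Qed.

Fact tmulDr : right_distributive tmul +%R.
Proof.
move=> a b c; apply/funext => w.
exact: (wconvDr (wext a) (wext b) (wext c) w).
Qed.

Fact tone_neq0 : tone != 0.
Proof.
apply/eqP => /(congr1 (fun a : T => a [bseq])); rewrite /tone /= => /eqP.
by rewrite oner_eq0.
Qed.

HB.instance Definition _ :=
  GRing.Zmodule_isNzRing.Build T tmulA tmul1l tmul1r tmulDl tmulDr tone_neq0.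

Fact tscaleAl (x : R) a b : x *: (a * b) = (x *: a) * b.
Proof.
apply/funext => w.
exact: esym (wconvZl x (wext a) (wext b) w).
Qed.

HB.instance Definition _ := GRing.Lmodule_isLalgebra.Build R T tscaleAl.

Fact tscaleAr (x : R) a b : x *: (a * b) = a * (x *: b).
Proof.
apply/funext => w.
exact: esym (wconvZr x (wext a) (wext b) w).
Qed.

HB.instance Definition _ := GRing.Lalgebra_isAlgebra.Build R T tscaleAr.

Definition tscalar a : R := a [bseq].

Lemma tscalarM a b : tscalar (a * b) = tscalar a * tscalar b.
Proof.
rewrite /tscalar [LHS]tmulE wconv_nil.
by congr (a _ * b _); apply: val_inj; rewrite /= insub_bseqE.
Qed.

Lemma tscalar1 : tscalar 1 = 1. Proof. by []. Qed.

Lemma texpr_small a k w : tscalar a = 0 -> (size w < k)%N -> (a ^+ k) w = 0.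
Proof.
move=> a0; elim: k w => // k IH w wk; rewrite exprS [LHS]/(tmul _ _ w) /tmul.
rewrite big_ord_recl big1 => [|j _]; last first.
  rewrite IH ?mulr0 // insub_bseqE size_drop /= /bump /=; last first.
    by rewrite (leq_trans (leq_subr _ _)) // size_bseq.
  rewrite ltn_subLR ?(leq_trans _ (ltn_ord j)) //.
  by rewrite add1n addSn -ltnS ltnS (leq_trans wk) // ltnS leq_addl.
rewrite take0 (_ : insub_bseq m [::] = [bseq]) ?[a _]a0 ?mul0r ?addr0 //.
by apply: val_inj; rewrite /= insub_bseqE.
Qed.

Lemma texpr_nil a : tscalar a = 0 -> a ^+ m.+1 = 0.
Proof. by move=> a0; apply/funext => w; rewrite texpr_small // ltnS size_bseq. Qed.

Definition tunit : pred T := fun a => tscalar a != 0.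

Definition tinv a : T :=
  if tunit a then
    (tscalar a)^-1 *: \sum_(k < m.+1) (1 - (tscalar a)^-1 *: a) ^+ k
  else a.

Fact tgeom (n : T) : n ^+ m.+1 = 0 ->
  (\sum_(k < m.+1) n ^+ k) * (1 - n) = 1 /\
  (1 - n) * (\sum_(k < m.+1) n ^+ k) = 1.
Proof.
move=> n0; have e : (1 - n) * (\sum_(k < m.+1) n ^+ k) = 1.
  by rewrite -opprB mulNr -subrX1 n0 sub0r opprK.
split => //; rewrite -[RHS]e; apply: commrB; first exact: commr1.
by apply/commr_sym/commr_sum => k _; apply: commrX.
Qed.

Fact tunit_nil a : tunit a -> (1 - (tscalar a)^-1 *: a) ^+ m.+1 = 0.
Proof.
move=> ua; apply: texpr_nil.
transitivity (1 - (tscalar a)^-1 * tscalar a) => //.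
by rewrite mulVf ?subrr.
Qed.

Fact tmulV : {in tunit, left_inverse 1 tinv *%R}.
Proof.
move=> a ua; rewrite /tinv ifT // -scalerAl scalerAr.
by have [+ _] := tgeom (tunit_nil ua); rewrite subKr.
Qed.

Fact tmulVr : {in tunit, right_inverse 1 tinv *%R}.
Proof.
move=> a ua; rewrite /tinv ifT // -scalerAr scalerAl.
by have [_ +] := tgeom (tunit_nil ua); rewrite subKr.
Qed.

Fact tunitP a b : b * a = 1 /\ a * b = 1 -> tunit a.
Proof.
case=> + _ => /(congr1 tscalar); rewrite tscalarM tscalar1 /tunit => ba.
by apply/eqP => a0; move/eqP: ba; rewrite a0 mulr0 eq_sym oner_eq0.
Qed.

Fact tinv_out : {in [predC tunit], tinv =1 id}.
Proof. by move=> a /negbTE ua; rewrite /tinv ifF. Qed.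

HB.instance Definition _ :=
  GRing.NzRing_hasMulInverse.Build T tmulV tmulVr tunitP tinv_out.

Definition dilation (t : R) a : T := fun w => t ^+ size w * a w.

(* The full exponential series when tscalar a = 0, since then a ^+ m.+1 = 0. *)
Definition texp a : T := \sum_(k < m.+1) (k`!%:R)^-1 *: a ^+ k.

End TensorAlg.

Section FreeNilpotentGroup.
Variables (R : realType) (V : finNormedModType R) (m : nat).

Definition vcoord (i : 'I_(\dim {:V})) (v : V) : R := coord (vbasis {:V}) i v.

Local Notation T := (tensor_alg R (\dim {:V}) m).

Definition tensor_in (v : V) : T :=
  fun w => if val w is [:: i] then vcoord i v else 0.

Inductive free_lie : T -> Prop :=
| free_lie_gen v : free_lie (tensor_in v)
| free_lie_lin (c : R) a b : free_lie a -> free_lie b -> free_lie (c *: a + b)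
| free_lie_bracket a b : free_lie a -> free_lie b -> free_lie (a * b - b * a).

Definition free_group : set T := [set texp a | a in free_lie].

(* Only the restriction of N to free_group is constrained. *)
Record homogeneous_norm (N : T -> R) : Prop := HomogeneousNorm {
  hnorm_ge0 : forall g, free_group g -> 0 <= N g;
  hnorm_eq0 : forall g, free_group g -> (N g = 0 <-> g = 1);
  hnorm_dilation : forall t g, free_group g -> N (dilation t g) = `|t| * N g;
  hnorm_mul : forall g h, free_group g -> free_group h -> N (g * h) <= N g + N h;
  hnorm_inv : forall g, free_group g -> N g^-1 = N g
}.

(* Paths on [0, 1] are total functions on R of which only the values on [0, 1]
   matter. *)
Definition group_path (Y : R -> T) : Prop :=
  [/\ Y 0 = 1,
      (forall t, 0 <= t <= 1 -> free_group (Y t)) &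
      {within `[0, 1], continuous Y}].

Definition smooth_path (y : R -> V) : Prop :=
  exists2 g : R -> V,
    (forall n t, derivable (derive1n n g) t 1) &
    (forall t, 0 <= t <= 1 -> y t = g t).

(* For r = [:: i_k; ...; i_1], the iterated integral of
   dy^(i_1)_(u_1) ... dy^(i_k)_(u_k) over s < u_1 < ... < u_k < t. *)
Fixpoint iterated_int (y : R -> V) (s : R) (r : seq 'I_(\dim {:V})) (t : R) : R :=
  if r is i :: r' then
    \int[lebesgue_measure]_(u in `]s, t[)
      (iterated_int y s r' u * vcoord i (derive1 y u))
  else 1.

Definition signature (y : R -> V) (s t : R) : T :=
  fun w => iterated_int y s (rev w) t.

Definition sig_path (y : R -> V) : R -> T := signature y 0.

Definition incr (Y : R -> T) (s t : R) : T := (Y s)^-1 * Y t.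

Section Distances.
Variables (N : T -> R) (omega : R -> R -> R).

Definition dist_m (g h : T) : R := N (g^-1 * h).

Definition dist_omega (p : R) (X Y : R -> T) : \bar R :=
  ereal_sup [set z | exists s t, [/\ 0 <= s, s < t, t <= 1 &
    z = (dist_m (incr X s t) (incr Y s t) / omega s t `^ p^-1)%:E]].

Definition norm_omega (p : R) (X : R -> T) : \bar R :=
  dist_omega p X (fun=> 1).

Definition C_omega (p : R) : set (R -> T) :=
  [set X | group_path X /\ (norm_omega p X < +oo)%E].

Definition smooth_approx (p : R) (Y : R -> T) (y : nat -> R -> V) : Prop :=
  [/\ (forall n, smooth_path (y n)),
      (ereal_sup (range (fun n => norm_omega p (sig_path (y n)))) < +oo)%E &
      (forall t, 0 <= t <= 1 -> (fun n => sig_path (y n) t) @ \oo --> Y t)].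

End Distances.
End FreeNilpotentGroup.

Record control (R : realType) (omega : R -> R -> R) : Prop := Control {
  control_continuous :
    {within [set x : R * R | 0 <= x.1 /\ x.1 <= x.2 /\ x.2 <= 1],
      continuous (fun x => omega x.1 x.2)};
  control_ge0 : forall s t, 0 <= s -> s <= t -> t <= 1 -> 0 <= omega s t;
  control_diag : forall t, 0 <= t <= 1 -> omega t t = 0;
  control_superadd : forall s t u, 0 <= s -> s < t -> t < u -> u <= 1 ->
    omega s t + omega t u <= omega s u
}.

(* For a control, the condition forces omega s t > 0 whenever s < t, so the
   quotients in dist_omega never have a zero denominator. *)
Definition cond_H (R : realType) (p : R) (omega : R -> R -> R) : Prop :=
  (exists s t, [/\ 0 <= s, s <= t, t <= 1 & omega s t != 0]) /\
  exists C : R, forall r s t u, 0 <= r -> r < s -> s < t -> t < u -> u <= 1 ->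
    omega r u / (u - r) `^ p <= C * (omega s t / (t - s) `^ p).

(* Main.v *)
(* Let r be the Dynkin map, sending a word to its left-nested bracket, and D the
   degree derivation. The group exp(L) consists of the g with scalar part 1 and
   D g = g r(g). Hence it is closed; signatures of smooth paths lie in it, because
   Z = D S - S r(S) solves Z' = Z dy with Z(0) = 0; and the leading term of g - 1 is
   an explicit combination of brackets. Peeling off leading terms shows that a
   homogeneous norm N is continuous at 1, and compactness and dilations then show
   that N controls all coordinates. Approximating brackets by group commutators,
   every g is a product of boundedly many exp(v_j), v_j in V, with
   N(exp v_j) <= K N(g).

   If Y has finite (omega, p)-norm, the increments of Y over the uniform grid of
   mesh 1 / n are written as such products and followed by a smooth path which
   rests at the end of each factor; by (H_p) the bound at scale 1 / n is inherited
   at all smaller scales. Conversely the bound passes to pointwise limits by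
   continuity of N. For q > p, short increments are controlled by the uniform
   (omega, p)-bound, and increments over intervals with omega bounded below
   converge uniformly by comparison with a finite grid. *)
Require Import Defs.
From HB Require Import structures.
From mathcomp Require Import all_boot all_order all_algebra.
From mathcomp Require Import all_classical all_reals all_analysis.
From mathcomp Require Import ring lra.
Set Implicit Arguments.
Unset Strict Implicit.
Unset Printing Implicit Defensive.
Import Order.TTheory GRing.Theory Num.Theory.
Import numFieldNormedType.Exports.
Local Open Scope classical_set_scope.
Local Open Scope ring_scope.

(** * The truncated tensor algebra and the Dynkin map *)

(** Two obstacles shape the proof. The group exp(L) is defined by an existential over an inductive
    predicate, from which neither closedness nor membership of signatures can be read off; D g = g
    r(g) is polynomial in the coordinates, passes to limits and can be differentiated along a path.
    And N is known only through its axioms, none of which mentions the topology, so every comparison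
    with coordinates has to be extracted from dilations and subadditivity.

    With W = omega^(1/p), condition (H_p) says that W(s,t) / (t - s) is, up to a constant, at least
    W(r,u) / (u - r) for every larger interval [r,u]. The approximating path crosses a cell [r,u] of
    length 1 / n at speed of order n W(r,u), so its increment over [s,t] inside the cell is of order
    n (t - s) W(r,u), hence of order W(s,t). The bounded number of factors keeps the constant
    independent of n. *)

Section TensorAlgebra.
Variables (R : realType) (d m : nat).
Local Notation T := (tensor_alg R d m).
Implicit Types (a b c u z : T) (w : m.-bseq 'I_d) (s : seq 'I_d).

Lemma tens_ext a b : (forall w, a w = b w) -> a = b.
Proof. by move=> h; apply/funext. Qed.

Lemma tensDE a b w : (a + b) w = a w + b w. Proof. by []. Qed.
Lemma tensNE a w : (- a) w = - a w. Proof. by []. Qed.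
Lemma tensBE a b w : (a - b) w = a w - b w. Proof. by []. Qed.
Lemma tensZE (x : R) a w : (x *: a) w = x * a w. Proof. by []. Qed.
Lemma tens0E w : (0 : T) w = 0. Proof. by []. Qed.
Lemma tens1E w : (1 : T) w = (size w == 0%N)%:R. Proof. by []. Qed.

Lemma tens_sumE (I : Type) (r : seq I) (P : pred I) (F : I -> T) w :
  (\sum_(i <- r | P i) F i) w = \sum_(i <- r | P i) F i w.
Proof. exact: (big_morph (fun a => a w)). Qed.

Lemma tensME a b w : (a * b) w = \sum_(k < (size w).+1)
    a (insub_bseq m (take k w)) * b (insub_bseq m (drop k w)).
Proof. by []. Qed.

Lemma insub_take k w : insub_bseq m (take k w) = take k w :> seq 'I_d.
Proof.
by rewrite insub_bseqE // size_take_min geq_min size_bseq orbT.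
Qed.

Lemma insub_drop k w : insub_bseq m (drop k w) = drop k w :> seq 'I_d.
Proof. by rewrite insub_bseqE // size_drop (leq_trans (leq_subr _ _)) // size_bseq. Qed.

Lemma size_insub_take w (k : 'I_(size w).+1) : size (insub_bseq m (take k w)) = k.
Proof. by rewrite insub_take size_takel // -ltnS. Qed.

Lemma size_insub_drop w (k : 'I_(size w).+1) :
  size (insub_bseq m (drop k w)) = (size w - k)%N.
Proof. by rewrite insub_drop size_drop. Qed.

(** The k-th power of the augmentation ideal; [ord m.+1] contains only 0, so an identity modulo
    [ord m.+1] is an equality. *)
Definition ord (k : nat) : set T := [set a | forall w, (size w < k)%N -> a w = 0].

Definition hom (k : nat) : set T := [set a | forall w, size w != k -> a w = 0].

Lemma ord0 a : ord 0 a. Proof. by []. Qed.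

Lemma ordW k l a : (l <= k)%N -> ord k a -> ord l a.
Proof. by move=> lk ka w wl; apply: ka; apply: leq_trans wl lk. Qed.

Lemma ordD k a b : ord k a -> ord k b -> ord k (a + b).
Proof. by move=> ka kb w wk; rewrite tensDE ka ?kb ?addr0. Qed.

Lemma ordN k a : ord k a -> ord k (- a).
Proof. by move=> ka w wk; rewrite tensNE ka ?oppr0. Qed.

Lemma ordB k a b : ord k a -> ord k b -> ord k (a - b).
Proof. by move=> ka kb; apply: ordD => //; apply: ordN. Qed.

Lemma ordZ k (x : R) a : ord k a -> ord k (x *: a).
Proof. by move=> ka w wk; rewrite tensZE ka ?mulr0. Qed.

Lemma ord00 k : ord k 0. Proof. by []. Qed.

Lemma ord_sum k (I : Type) (r : seq I) (P : pred I) (F : I -> T) :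
  (forall i, P i -> ord k (F i)) -> ord k (\sum_(i <- r | P i) F i).
Proof. by move=> h; elim/big_ind: _ => //; exact: ordD. Qed.

Lemma ordM k l a b : ord k a -> ord l b -> ord (k + l) (a * b).
Proof.
move=> ka lb w wkl; rewrite tensME big1 // => i _.
have [ik|ki] := ltnP i k; first by rewrite ka ?mul0r // size_insub_take.
have iw : (i <= size w)%N by rewrite -ltnS.
by rewrite lb ?mulr0 // size_insub_drop ltn_subLR // (leq_trans wkl) // leq_add2r.
Qed.

Lemma ordX k n a : ord k a -> ord (k * n) (a ^+ n).
Proof.
move=> ka; elim: n => [|n IH]; first by rewrite muln0; exact: ord0.
by rewrite exprS mulnS; apply: ordM.
Qed.

Lemma ordX1 n a : ord 1 a -> ord n (a ^+ n).
Proof. by move=> a1; have := @ordX 1 n a a1; rewrite mul1n. Qed.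

Lemma ord_big k a : ord k a -> (m < k)%N -> a = 0.
Proof.
by move=> ka mk; apply: tens_ext => w; rewrite ka // (leq_ltn_trans (size_bseq w)).
Qed.

Lemma ord1P a : ord 1 a <-> tscalar a = 0.
Proof.
split=> [h|h w]; first by rewrite /tscalar h.
rewrite ltnS leqn0 size_eq0 => /eqP w0; rewrite -h /tscalar; congr (a _).
exact: val_inj.
Qed.

Lemma hom_ord k a : hom k a -> ord k a.
Proof. by move=> ka w wk; rewrite ka // neq_ltn wk. Qed.

Lemma homD k a b : hom k a -> hom k b -> hom k (a + b).
Proof. by move=> ka kb w wk; rewrite tensDE ka ?kb ?addr0. Qed.

Lemma homN k a : hom k a -> hom k (- a).
Proof. by move=> ka w wk; rewrite tensNE ka ?oppr0. Qed.

Lemma homM k l a b : hom k a -> hom l b -> hom (k + l) (a * b).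
Proof.
move=> ka lb w wkl; rewrite tensME big1 // => i _.
have [ik|ki] := eqVneq (i : nat) k; last by rewrite ka ?mul0r // size_insub_take.
rewrite lb ?mulr0 // size_insub_drop ik; apply: contra wkl => /eqP <-.
by rewrite subnKC // -ik -ltnS.
Qed.

(** Indexed by all sequences, with value 0 for words longer than m, so that concatenation in [baseM]
    needs no length condition. *)
Definition base s : T := fun w => (val w == s)%:R.

Lemma hom_base s : hom (size s) (base s).
Proof.
by move=> w ws; rewrite /base; case: eqP => // ws'; move: ws; rewrite -ws' eqxx.
Qed.

Lemma base_big s : (m < size s)%N -> base s = 0.
Proof. by apply: ord_big; apply: hom_ord; exact: hom_base. Qed.

Lemma base_nil : base [::] = 1.
Proof. by apply: tens_ext => w; rewrite tens1E size_eq0. Qed.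

Lemma baseM s t : base s * base t = base (s ++ t).
Proof.
apply: tens_ext => w; rewrite tensME /base /=.
have [ws|ws] := eqVneq (val w) (s ++ t); last first.
  rewrite big1 // => i _; rewrite insub_take insub_drop.
  case: eqP => [es|]; last by rewrite mul0r.
  case: eqP => [et|]; last by rewrite mulr0.
  by move: ws; rewrite -es -et cat_take_drop eqxx.
have sw : (size s < (size w).+1)%N by rewrite ltnS ws size_cat leq_addr.
have e1 : take (size s) w = s by rewrite ws take_size_cat.
have e2 : drop (size s) w = t by rewrite ws drop_size_cat.
rewrite (bigD1 (Ordinal sw)) //= insub_take insub_drop e1 e2.
rewrite !eqxx mulr1 big1 ?addr0 // => i /eqP ni.
rewrite insub_take; case: eqP; last by rewrite mul0r.
have iw : (i <= size w)%N by rewrite -ltnS.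
move=> /(congr1 size); rewrite size_takel // => is_.
by case: ni; apply: val_inj.
Qed.

Lemma base_sum a : a = \sum_w a w *: base (val w).
Proof.
apply: tens_ext => w; rewrite tens_sumE (bigD1 w) //= big1 ?addr0.
  by rewrite tensZE /base eqxx mulr1.
move=> v vw; rewrite tensZE /base; case: eqP => [e|]; last by rewrite mulr0.
by move/eqP: vw; case; apply: val_inj.
Qed.

(** The left-nested bracket peels off its last letter, hence the recursion on the reversed word. The
    value 0 on the empty word gives r(1) = 0. *)
Fixpoint brrev s : T :=
  match s with
  | [::] => 0
  | [:: i] => base [:: i]
  | i :: s' => brrev s' * base [:: i] - base [:: i] * brrev s'
  end.

Definition br s : T := brrev (rev s).

Lemma br1 i : br [:: i] = base [:: i]. Proof. by []. Qed.

Lemma br_rcons s i : s != [::] ->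
  br (rcons s i) = br s * base [:: i] - base [:: i] * br s.
Proof.
rewrite /br rev_rcons /= -size_eq0 -size_rev size_eq0.
by case: (rev s).
Qed.

Lemma hom_br s : hom (size s) (br s).
Proof.
elim/last_ind: s => [|s i IH] //; have [->|s0] := eqVneq s [::].
  by rewrite br1; exact: hom_base.
rewrite br_rcons // size_rcons; apply: homD.
  by rewrite -addn1; apply: homM IH (@hom_base [:: i]).
by apply: homN; rewrite -add1n; apply: homM (@hom_base [:: i]) IH.
Qed.

Definition dynkin_map a : T := \sum_w a w *: br (val w).
Local Notation r := dynkin_map.

Lemma dynkinD a b : r (a + b) = r a + r b.
Proof. by rewrite /r -big_split; apply: eq_bigr => w _; rewrite tensDE scalerDl. Qed.

Lemma dynkinZ (x : R) a : r (x *: a) = x *: r a.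
Proof. by rewrite /r scaler_sumr; apply: eq_bigr => w _; rewrite tensZE scalerA. Qed.

Lemma dynkin0 : r 0 = 0.
Proof. by have := dynkinZ 0 0; rewrite !scale0r. Qed.

Lemma dynkinN a : r (- a) = - r a.
Proof. by rewrite -scaleN1r dynkinZ scaleN1r. Qed.

Lemma dynkinB a b : r (a - b) = r a - r b.
Proof. by rewrite dynkinD dynkinN. Qed.

Lemma dynkin_sum (I : Type) (s : seq I) (P : pred I) (F : I -> T) :
  r (\sum_(i <- s | P i) F i) = \sum_(i <- s | P i) r (F i).
Proof. exact: (big_morph _ dynkinD dynkin0). Qed.

Lemma dynkin_base s : r (base s) = br s.
Proof.
have [sm|ms] := leqP (size s) m; last first.
  by rewrite base_big // dynkin0 (ord_big (hom_ord (@hom_br s))).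
rewrite /r (bigD1 (Bseq sm)) //= /base /= eqxx scale1r big1 ?addr0 // => w ws.
case: eqP => [e|]; last by rewrite scale0r.
by move/eqP: ws; case; apply: val_inj.
Qed.

Lemma dynkin1 : r 1 = 0.
Proof. by rewrite -base_nil dynkin_base. Qed.

Lemma ord_dynkin k a : ord k a -> ord k (r a).
Proof.
move=> ka; apply: ord_sum => w _; have [wk|kw] := ltnP (size w) k.
  by rewrite ka // scale0r.
by apply: ordZ; apply: ordW kw _; apply: hom_ord; exact: hom_br.
Qed.

Definition deg a : T := fun w => (size w)%:R * a w.

Lemma degD a b : deg (a + b) = deg a + deg b.
Proof. by apply: tens_ext => w; rewrite /deg !tensDE mulrDr. Qed.

Lemma degZ (x : R) a : deg (x *: a) = x *: deg a.
Proof. by apply: tens_ext => w; rewrite tensZE /deg tensZE mulrCA. Qed.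

Lemma deg0 : deg 0 = 0.
Proof. by have := degZ 0 0; rewrite !scale0r. Qed.

Lemma degN a : deg (- a) = - deg a.
Proof. by rewrite -scaleN1r degZ scaleN1r. Qed.

Lemma degB a b : deg (a - b) = deg a - deg b.
Proof. by rewrite degD degN. Qed.

Lemma deg_sum (I : Type) (s : seq I) (P : pred I) (F : I -> T) :
  deg (\sum_(i <- s | P i) F i) = \sum_(i <- s | P i) deg (F i).
Proof. exact: (big_morph _ degD deg0). Qed.

Lemma deg_hom k a : hom k a -> deg a = k%:R *: a.
Proof.
move=> ka; apply: tens_ext => w; rewrite tensZE /deg.
by have [->//|wk] := eqVneq (size w) k; rewrite ka // !mulr0.
Qed.

Lemma deg1 : deg 1 = 0.
Proof.
by rewrite (@deg_hom 0) ?scale0r // => w w0; rewrite tens1E (negbTE w0).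
Qed.

Lemma degM a b : deg (a * b) = deg a * b + a * deg b.
Proof.
apply: tens_ext => w; rewrite tensDE /deg !tensME mulr_sumr -big_split.
apply: eq_bigr => k _ /=.
rewrite size_insub_take size_insub_drop.
have kw : (k <= size w)%N by rewrite -ltnS.
have -> : (size w)%:R = k%:R + (size w - k)%:R :> R by rewrite -natrD subnKC.
by ring.
Qed.

Lemma ord_deg k a : ord k a -> ord k (deg a).
Proof. by move=> ka w wk; rewrite /deg ka // mulr0. Qed.

Lemma hom_in k a : ord k a -> exists2 z, hom k z & ord k.+1 (a - z).
Proof.
move=> ka; exists (fun w => (size w == k)%:R * a w).
  by move=> w wk; rewrite (negbTE wk) mul0r.
move=> w; rewrite ltnS leq_eqVlt tensBE => /orP[/eqP->|wk].
  by rewrite eqxx mul1r subrr.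
by rewrite ka // mulr0 subrr.
Qed.

End TensorAlgebra.

Arguments base {R d m} s _.
Arguments br {R d m} s.

(* [ring] does not apply to the noncommutative ring T; linear identities between
   fully expanded products are checked coefficient by coefficient. *)
Ltac tens_ring :=
  apply: tens_ext => ?; rewrite !(tensDE, tensNE, tensZE, tens0E); ring.

(** * The Dynkin equation for group-like elements *)

Section Dynkin.
Variables (R : realType) (d m : nat).
Local Notation T := (tensor_alg R d m).
Local Notation r := (@dynkin_map R d m).
Implicit Types (a b c u z : T) (w : m.-bseq 'I_d) (s : seq 'I_d).

(** Properties of Lie elements; the last one is the Dynkin-Specht-Wever identity. The commutator
    rule carries it through brackets. That rule fails at u = 1, where r(1) = 0 but r(a) = D a, hence
    the restriction to u without scalar part. *)
Definition dynkin_el a : Prop :=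
  [/\ ord 1 a, forall u, ord 1 u -> r (u * a) = r u * a - a * r u & r a = deg a].

Lemma dynkin_el_base i : dynkin_el (base [:: i]).
Proof.
have h1 := hom_ord (@hom_base R d m [:: i]).
split => //; last by rewrite dynkin_base br1 (deg_hom (@hom_base _ _ _ [:: i])) scale1r.
move=> u u1; rewrite {1}(base_sum u) mulr_suml dynkin_sum.
rewrite {2 3}/dynkin_map mulr_suml mulr_sumr -sumrB; apply: eq_bigr => w _.
have [w0|w0] := eqVneq (val w) [::]; first by rewrite u1 ?w0 // !scale0r !(mul0r, mulr0) dynkin0 subr0.
rewrite -!scalerAl -scalerAr -scalerBr dynkinZ baseM dynkin_base cats1.
by rewrite br_rcons.
Qed.

Lemma dynkin_el_lin (x : R) a b : dynkin_el a -> dynkin_el b -> dynkin_el (x *: a + b).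
Proof.
move=> [a1 ra da] [b1 rb db]; split; first by apply: ordD => //; exact: ordZ.
  move=> u u1; rewrite mulrDr -scalerAr dynkinD dynkinZ ra // rb //.
  by rewrite mulrDr mulrDl -scalerAr -scalerAl scalerBr opprD addrACA.
by rewrite dynkinD dynkinZ da db degD degZ.
Qed.

Lemma dynkin_el0 : dynkin_el 0.
Proof.
split=> //; last by rewrite dynkin0 deg0.
by move=> u _; rewrite !mulr0 mul0r dynkin0 subr0.
Qed.

(** The commutator rule is the Jacobi identity [[x, a], b] - [[x, b], a] = [x, [a, b]] for x = r(u);
    the last clause is the Leibniz rule, r(a b) - r(b a) = [D a, b] - [D b, a] = D [a, b]. *)
Lemma dynkin_el_bracket a b : dynkin_el a -> dynkin_el b -> dynkin_el (a * b - b * a).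
Proof.
move=> [a1 ra da] [b1 rb db]; split.
- by apply: ordB; apply: (@ordW _ _ _ 2) => //; apply: (@ordM _ _ _ 1 1).
- move=> u u1; have ua : ord 1 (u * a).
    by apply: (@ordW _ _ _ 2) => //; apply: (@ordM _ _ _ 1 1).
  have ub : ord 1 (u * b).
    by apply: (@ordW _ _ _ 2) => //; apply: (@ordM _ _ _ 1 1).
  rewrite [u * _]mulrBr [u * (a * b)]mulrA [u * (b * a)]mulrA dynkinB.
  rewrite (rb _ ua) (ra _ ub) ra // rb //.
  rewrite !(mulrBl, mulrBr) !mulrA.
  tens_ring.
- rewrite dynkinB ra // rb // da db degB !degM.
  by tens_ring.
Qed.


(* The group-like elements, as the polynomial equations g_0 = 1, D g = g r(g) with
   D the degree derivation and r the Dynkin map; they turn out to be exp(L). *)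
Definition dynkin_grp : set T := [set g | tscalar g = 1 /\ deg g = g * r g].

(** Pascal's rule for a two-index family that need not be a product of powers: it serves for F i j =
    a^i r(u a^j). *)
Lemma binom_shift (F : nat -> nat -> T) n :
  \sum_(i < n.+2) F i (n.+1 - i)%N *+ 'C(n.+1, i) =
  \sum_(i < n.+1) F i.+1 (n - i)%N *+ 'C(n, i) +
  \sum_(i < n.+1) F i (n - i).+1 *+ 'C(n, i).
Proof.
rewrite big_ord_recl /= subn0 bin0.
under eq_bigr do rewrite /bump /= add1n binS subSS mulrnDr.
rewrite big_split /= addrA addrC; congr (_ + _).
rewrite [RHS]big_ord_recl /= subn0 bin0 big_ord_recr /= bin_small // mulr0n addr0.
congr (_ + _); apply: eq_bigr => i _; rewrite /bump /= add1n subnSK //.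
Qed.

(** Cauchy product of two exponential series, regrouped by n = i + j. Both series stop at m, so the
    part of the square with m < i + j has to vanish. *)
Lemma exp_double_sum (F : nat -> nat -> T) :
  (forall i j, (m < i + j)%N -> F i j = 0) ->
  \sum_(i < m.+1) \sum_(j < m.+1) ((i`!%:R)^-1 * (j`!%:R)^-1) *: F i j =
  \sum_(n < m.+1) (n`!%:R)^-1 *: \sum_(i < n.+1) F i (n - i)%N *+ 'C(n, i).
Proof.
move=> F0.
pose G i j : T := ((i`!%:R)^-1 * (j`!%:R)^-1) *: F i j.
transitivity (\sum_(n < m.+1) \sum_(i < m.+1 | (i < n.+1)%N) G i (n - i)%N); last first.
  apply: eq_bigr => n _; rewrite scaler_sumr.
  rewrite -(big_ord_widen _ (fun i => G i (n - i)%N)) //.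
  apply: eq_bigr => i _; rewrite /G -[F _ _ *+ _]scaler_nat scalerA; congr (_ *: _).
  have in_ : (i <= n)%N by rewrite -ltnS.
  rewrite -[in RHS](bin_fact in_) !natrM.
  field.
  by rewrite !pnatr_eq0 -!lt0n !fact_gt0 bin_gt0.
rewrite [RHS](exchange_big_dep predT) //=; apply: eq_bigr => i _.
have im : (i <= m)%N by rewrite -ltnS.
rewrite -(big_mkord (fun n => i < n.+1)%N (fun n => G i (n - i)%N)).
rewrite -[RHS](big_nat_widenl i 0 m.+1 predT (fun n => G i (n - i)%N)) //.
transitivity (\sum_(0 + i <= n < m.+1) G i (n - i)%N); last by rewrite add0n.
rewrite big_addn big_mkord.
rewrite (big_ord_widen _ (fun j => G i (j + i - i)%N) (leq_subr i m.+1)) [RHS]big_mkcond.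
apply: eq_bigr => j _; rewrite addnK; case: ifPn => //.
by rewrite -leqNgt leq_subLR => h; rewrite F0 ?scaler0.
Qed.


Lemma exp_nilp a k : ord 1 a -> (m < k)%N -> a ^+ k = 0.
Proof. by move=> a1 mk; apply: (@ord_big _ _ _ k) => //; exact: ordX1. Qed.

Lemma texpM_scale (x y : R) a : ord 1 a -> texp (x *: a) * texp (y *: a) = texp ((x + y) *: a).
Proof.
move=> a1; rewrite /texp mulr_suml.
transitivity (\sum_(i < m.+1) \sum_(j < m.+1)
    ((i`!%:R)^-1 * (j`!%:R)^-1) *: ((x ^+ i * y ^+ j) *: a ^+ (i + j))).
  apply: eq_bigr => i _; rewrite mulr_sumr; apply: eq_bigr => j _.
  by rewrite !exprZn -!scalerAl -!scalerAr !scalerA exprD; congr (_ *: _); ring.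
rewrite (@exp_double_sum (fun i j => (x ^+ i * y ^+ j) *: a ^+ (i + j))); last first.
  by move=> i j ij; rewrite exp_nilp ?scaler0.
apply: eq_bigr => n _; congr (_ *: _).
rewrite exprZn [x + y]addrC exprDn scaler_suml; apply: eq_bigr => i _.
by rewrite subnKC -1?ltnS // scalerMnl mulrC.
Qed.

Lemma texp0 : texp 0 = 1 :> T.
Proof.
rewrite /texp big_ord_recl big1 ?addr0 => [|i _]; first by rewrite expr0 fact0 invr1 scale1r.
by rewrite /bump /= exprS mul0r scaler0.
Qed.

Lemma texpNr a : ord 1 a -> texp a * texp (- a) = 1.
Proof.
by move=> a1; have := texpM_scale 1 (-1) a1; rewrite scale1r scaleN1r subrr scale0r texp0.
Qed.

Lemma texpNl a : ord 1 a -> texp (- a) * texp a = 1.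
Proof. by move=> a1; have := texpNr (ordN a1); rewrite opprK. Qed.

(* sum_i C(n, i) L^i (R - L)^(n - i) = R^n for the commuting left and right
   multiplications L and R by a, and r (u a^j) = (R - L)^j r(u). *)
Lemma dynkin_pow a n u : dynkin_el a -> ord 1 u ->
  \sum_(i < n.+1) (a ^+ i * r (u * a ^+ (n - i)%N)) *+ 'C(n, i) = r u * a ^+ n.
Proof.
move=> [a1 ra _]; elim: n u => [|n IH] u u1.
  by rewrite big_ord1 !expr0 mul1r !mulr1.
rewrite (binom_shift (fun i j => a ^+ i * r (u * a ^+ j))).
under eq_bigr do rewrite exprS -mulrA -mulrnAr.
rewrite -mulr_sumr IH // addrC.
under eq_bigr do rewrite [a ^+ (_ - _).+1]exprS mulrA.
rewrite IH; last by apply: (@ordW _ _ _ 2) => //; apply: (@ordM _ _ _ 1 1).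
by rewrite ra // mulrBl -!mulrA subrK -exprS.
Qed.

(** With L and R the left and right multiplications by a, this is exp(L) exp(R - L) = exp(R), degree
    by degree. Under r, right multiplication by exp(a) thus becomes conjugation, which makes the
    Dynkin equation stable under products. *)
Lemma dynkin_texp a u : dynkin_el a -> ord 1 u -> texp a * r (u * texp a) = r u * texp a.
Proof.
move=> da u1; have [a1 _ _] := da; rewrite /texp mulr_suml.
transitivity (\sum_(i < m.+1) \sum_(j < m.+1)
    ((i`!%:R)^-1 * (j`!%:R)^-1) *: (a ^+ i * r (u * a ^+ j))).
  apply: eq_bigr => i _; rewrite [u * _]mulr_sumr dynkin_sum mulr_sumr.
  by apply: eq_bigr => j _; rewrite -scalerAr dynkinZ -scalerAl -scalerAr scalerA.
rewrite (@exp_double_sum (fun i j => a ^+ i * r (u * a ^+ j))); last first.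
  move=> i j ij; apply: (@ord_big _ _ _ (i + j)) => //.
  apply: ordM; first by exact: ordX1.
  apply: ord_dynkin; apply: (@ordW _ _ _ (1 + j)) => //.
  by apply: ordM => //; exact: ordX1.
rewrite mulr_sumr; apply: eq_bigr => n _.
by rewrite dynkin_pow // scalerAr.
Qed.

(** Degree by degree, D(a^n) = sum_i C(n, i) a^i r(a^(n - i)). In the induction step one half of
    Pascal's sum is a D(a^n), the other is D(a) a^n by [dynkin_pow] with u = a. *)
Lemma deg_texp a : dynkin_el a -> deg (texp a) = texp a * r (texp a).
Proof.
move=> da; have [a1 _ ra] := da; rewrite {2 3}/texp mulr_suml.
symmetry; transitivity (\sum_(i < m.+1) \sum_(j < m.+1)
    ((i`!%:R)^-1 * (j`!%:R)^-1) *: (a ^+ i * r (a ^+ j))).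
  apply: eq_bigr => i _; rewrite dynkin_sum mulr_sumr.
  by apply: eq_bigr => j _; rewrite dynkinZ -scalerAl -scalerAr scalerA.
rewrite (@exp_double_sum (fun i j => a ^+ i * r (a ^+ j))); last first.
  move=> i j ij; apply: (@ord_big _ _ _ (i + j)) => //.
  apply: ordM; first by exact: ordX1.
  by apply: ord_dynkin; exact: ordX1.
rewrite /texp deg_sum; apply: eq_bigr => n _; rewrite degZ; congr (_ *: _); symmetry.
elim: {n}(n : nat) => [|n IH].
  by rewrite big_ord1 expr0 mul1r dynkin1 deg1.
rewrite (binom_shift (fun i j => a ^+ i * r (a ^+ j))).
under eq_bigr do rewrite exprS -mulrA -mulrnAr.
rewrite -mulr_sumr -IH // addrC.
under eq_bigr do rewrite [a ^+ (_ - _).+1]exprS.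
by rewrite dynkin_pow // ra exprS degM addrC.
Qed.

Lemma tscalar_texp a : ord 1 a -> tscalar (texp a) = 1.
Proof.
move=> /ord1P a0; rewrite /texp /tscalar tens_sumE big_ord_recl big1 ?addr0 => [|i _].
  by rewrite tensZE expr0 fact0 invr1 mul1r.
rewrite tensZE exprS; have := tscalarM a (a ^+ i); rewrite /tscalar => ->.
by move: a0; rewrite /tscalar => ->; rewrite mul0r mulr0.
Qed.

Lemma texp_dynkin_grp a : dynkin_el a -> dynkin_grp (texp a).
Proof. by move=> da; split; [apply: tscalar_texp; case: da|exact: deg_texp]. Qed.

(** For g = 1 + u and e = exp(a), g e r(g e) = g e r(u e) + g e r(e) = g r(u) e + g D(e), and g r(u)
    = g r(g) = D g. *)
Lemma dynkin_grpM_texp g a : dynkin_grp g -> dynkin_el a -> dynkin_grp (g * texp a).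
Proof.
move=> [g1 dg] da; have [a1 _ _] := da.
split; first by rewrite tscalarM g1 tscalar_texp // mulr1.
have u1 : ord 1 (g - 1).
  by apply/ord1P; rewrite /tscalar tensBE; move: g1; rewrite /tscalar => ->; rewrite tens1E subrr.
rewrite degM dg deg_texp // -[in r (g * _)](subrK 1 g) mulrDl mul1r dynkinD.
rewrite mulrDr -!mulrA; congr (_ + _).
by rewrite dynkin_texp // dynkinB dynkin1 subr0.
Qed.

Lemma dynkin_elN a : dynkin_el a -> dynkin_el (- a).
Proof.
move=> [a1 ra da]; split; first exact: ordN.
  by move=> u u1; rewrite mulrN dynkinN ra // mulrN mulNr opprB opprK addrC.
by rewrite dynkinN da degN.
Qed.

(** By telescoping: each term of the difference has one factor z and n factors of order 1. *)
Lemma ord_powD k b z n : (0 < k)%N -> ord 1 b -> ord k z ->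
  ord (k + n) ((b + z) ^+ n.+1 - b ^+ n.+1).
Proof.
move=> k0 b1 kz; elim: n => [|n IH].
  by rewrite addn0 !expr1 addrC addKr.
have bz : ord 1 (b + z) by apply: ordD => //; apply: ordW kz.
rewrite exprS [b ^+ n.+2]exprS.
rewrite -(subrK ((b + z) * b ^+ n.+1) ((b + z) * (b + z) ^+ n.+1)) -mulrBr.
rewrite -addrA -mulrBl [b + z - b]addrC addKr; apply: ordD.
  by rewrite addnS -add1n; apply: ordM.
by apply: ordM => //; exact: ordX1.
Qed.

Lemma texpE2 a : ord 1 a ->
  texp a = 1 + a + \sum_(i < m) (i.+2`!%:R)^-1 *: a ^+ i.+2.
Proof.
(* The power m + 1 is 0; including it lets two terms be split off even for m = 0. *)
move=> a1; transitivity (\sum_(i < m.+2) (i`!%:R)^-1 *: a ^+ i).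
  by rewrite big_ord_recr /= exp_nilp // scaler0 addr0.
by rewrite !big_ord_recl /= expr0 expr1 fact0 invr1 !scale1r addrA.
Qed.

(** The linear terms differ by z; from the square on, powers differ by terms containing z and a
    further factor of order 1. *)
Lemma texpD k b z : (0 < k)%N -> ord 1 b -> ord k z ->
  ord k.+1 (texp (b + z) - texp b - z).
Proof.
move=> k0 b1 kz; have z1 : ord 1 z by apply: ordW kz.
have h : ord k.+1 (\sum_(i < m) (i.+2`!%:R)^-1 *: ((b + z) ^+ i.+2 - b ^+ i.+2)).
  apply: ord_sum => i _; apply: ordZ.
  apply: (@ordW _ _ _ (k + i.+1)); first by rewrite addnS ltnS leq_addr.
  exact: ord_powD.
rewrite !texpE2 //; last exact: ordD.
move: h; under eq_bigr do rewrite scalerBr.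
rewrite sumrB; set A := \sum_(_ < _) _; set B := \sum_(_ < _) _ => h.
by rewrite (_ : _ - _ - _ = A - B) //; tens_ring.
Qed.

(* Comparing the components of degree k in D g = g r(g) gives k z = r(z), so the
   leading term z of g is an explicit combination of brackets. *)
Lemma dynkin_grp_ordP k g : (0 < k)%N -> dynkin_grp g -> ord k (g - 1) ->
  exists z, [/\ hom k z, z = \sum_(w | size (val w) == k) (g w / k%:R) *: br (val w) &
    ord k.+1 (g - 1 - z)].
Proof.
move=> k0 [g1 dg] kg; have [z hz kz] := hom_in kg; exists z; split => //.
have kn0 : k%:R != 0 :> R by rewrite pnatr_eq0 -lt0n.
have zE w : size (val w) == k -> z w = g w.
  move=> /eqP wk; have := kz w; rewrite wk ltnSn => /(_ isT).
  rewrite !tensBE tens1E wk gtn_eqF // subr0 => /eqP; rewrite subr_eq0 => /eqP ->.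
  by [].
have kd : ord k.+1 (k%:R *: z - r z).
  have -> : k%:R *: z = deg (g - 1) - deg (g - 1 - z).
    by rewrite -(deg_hom hz) -degB opprB [z - _]addrC addrA subrr add0r.
  have -> : r z = r (g - 1) - r (g - 1 - z).
    by rewrite -dynkinB opprB [z - _]addrC addrA subrr add0r.
  rewrite [deg (g - 1)]degB deg1 subr0 dg [r (g - 1)]dynkinB dynkin1 subr0.
  (* As D g = g r(g), the difference D g - r(g) is (g - 1) r(g), of order k + 1 because r(g) = r(g -
     1) has order 1. *)
  have -> : g * r g - deg (g - 1 - z) - (r g - r (g - 1 - z)) =
    (g - 1) * r g - (deg (g - 1 - z) - r (g - 1 - z)).
    by rewrite mulrBl mul1r; tens_ring.
  apply: ordB; last by apply: ordB; [exact: ord_deg|exact: ord_dynkin].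
  rewrite -[k.+1]addn1; apply: ordM => //.
  have -> : r g = r (g - 1) by rewrite dynkinB dynkin1 subr0.
  by apply: ord_dynkin; apply: ordW kg.
have hrz : hom k (r z).
  move=> w wk; rewrite /r tens_sumE big1 // => v _.
  rewrite tensZE; have [e|/hz ->] := eqVneq (size v) k; last by rewrite mul0r.
  by rewrite hom_br ?mulr0 // e.
have ez : k%:R *: z = r z.
  apply: tens_ext => w; have [e|wk] := eqVneq (size w) k.
    by apply/eqP; rewrite -subr_eq0 -tensNE -tensDE; apply/eqP; apply: kd; rewrite e.
  by rewrite (hrz _ wk) tensZE hz // mulr0.
apply: (@scalerI _ _ k%:R) => //; rewrite ez scaler_sumr /r [RHS]big_mkcond.
apply: eq_bigr => w _; case: ifPn => [wk|/hz ->]; last by rewrite scale0r.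
by rewrite scalerA mulrCA mulfV // mulr1 zE.
Qed.

End Dynkin.

(** * The group exp(L): closure properties and dilations *)

Section FreeGroup.
Variables (R : realType) (V : finNormedModType R) (m : nat).
Local Notation d := (\dim {:V}).
Local Notation T := (tensor_alg R d m).
Local Notation L := (@free_lie R V m).
Local Notation G := (@free_group R V m).
Implicit Types (a b g h : T) (v : V) (s : seq 'I_d).

Lemma tensor_inE v : tensor_in v = \sum_i vcoord i v *: base [:: i] :> T.
Proof.
apply: tens_ext => w; rewrite tens_sumE /tensor_in /base.
under eq_bigr do rewrite tensZE.
case: (val w) => [|i [|j s]]; first by rewrite big1 // => i _; rewrite mulr0.
  rewrite (bigD1 i) //= eqxx mulr1 big1 ?addr0 // => j ji.
  by rewrite eqseq_cons eq_sym (negbTE ji) mulr0.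
by rewrite big1 // => k _; rewrite eqseq_cons andbF mulr0.
Qed.

Lemma tensor_in_base (i : 'I_d) : tensor_in (vbasis {:V})`_i = base [:: i] :> T.
Proof.
rewrite tensor_inE (bigD1 i) //= big1 => [|j ji].
  by rewrite addr0 /vcoord coord_free ?eqxx ?scale1r // (basis_free (vbasisP _)).
by rewrite /vcoord coord_free ?(basis_free (vbasisP _)) // eq_sym (negbTE ji) scale0r.
Qed.

Lemma tensor_inZ (x : R) v : tensor_in (x *: v) = x *: tensor_in v :> T.
Proof.
rewrite !tensor_inE scaler_sumr; apply: eq_bigr => i _.
by rewrite scalerA /vcoord linearZ.
Qed.

Lemma tensor_in0 : tensor_in (0 : V) = 0 :> T.
Proof. by have := tensor_inZ 0 0; rewrite !scale0r. Qed.

Lemma free_lie0 : L 0.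
Proof. by rewrite -tensor_in0; exact: free_lie_gen. Qed.

Lemma free_lieZ (x : R) a : L a -> L (x *: a).
Proof. by move=> La; rewrite -[x *: a]addr0; apply: free_lie_lin => //; exact: free_lie0. Qed.

Lemma free_lieN a : L a -> L (- a).
Proof. by move=> La; rewrite -scaleN1r; exact: free_lieZ. Qed.

Lemma free_lieD a b : L a -> L b -> L (a + b).
Proof. by move=> La Lb; rewrite -[a]scale1r; exact: free_lie_lin. Qed.

Lemma free_lie_sum (I : Type) (r : seq I) (P : pred I) (F : I -> T) :
  (forall i, P i -> L (F i)) -> L (\sum_(i <- r | P i) F i).
Proof. by move=> h; elim/big_ind: _ => //; [exact: free_lie0|exact: free_lieD]. Qed.

Lemma free_lie_br s : L (br s).
Proof.
elim/last_ind: s => [|s i IH]; first exact: free_lie0.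
have Li : L (base [:: i]) by rewrite -tensor_in_base; exact: free_lie_gen.
have [->|s0] := eqVneq s [::]; first by rewrite br1.
by rewrite br_rcons //; exact: free_lie_bracket.
Qed.

Lemma free_lie_dynkin_el a : L a -> dynkin_el a.
Proof.
elim=> [v|c {}a b _ da _ db|{}a b _ da _ db].
- rewrite tensor_inE; elim/big_ind: _ => [|x y dx dy|i _].
  + exact: dynkin_el0.
  + by rewrite -[x]scale1r; exact: dynkin_el_lin.
  + rewrite -[_ *: _]addr0; apply: dynkin_el_lin; last exact: dynkin_el0.
    exact: dynkin_el_base.
- exact: dynkin_el_lin.
- exact: dynkin_el_bracket.
Qed.

Lemma free_lie_ord a : L a -> ord 1 a.
Proof. by case/free_lie_dynkin_el. Qed.

(* Induction on k: if g exp(-b) = 1 + z + ... with z of degree k + 1, then z is in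
   L, and b + z works one degree further. *)
Lemma dynkin_grp_texp g : dynkin_grp g -> G g.
Proof.
move=> Gg.
suff [b Lb] : exists2 b, L b & ord m.+1 (g * texp (- b) - 1).
  move=> /ord_big/(_ (ltnSn m)) /eqP; rewrite subr_eq0 => /eqP gb.
  exists b => //; have b1 := free_lie_ord Lb.
  by rewrite -[g]mulr1 -(texpNl b1) mulrA gb mul1r.
elim: m.+1 => [|k [b Lb kb]]; first by exists 0; [exact: free_lie0|exact: ord0].
have b1 := free_lie_ord Lb; have bG := free_lie_dynkin_el Lb.
have hG := dynkin_grpM_texp Gg (dynkin_elN bG).
have [->|k0] := posnP k.
  exists b => //; apply/ord1P; rewrite /tscalar tensBE.
  by case: hG; rewrite /tscalar => -> _; rewrite tens1E subrr.
have [z [hz zE kz]] := dynkin_grp_ordP k0 hG kb.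
have Lz : L z.
  rewrite zE; apply: free_lie_sum => w _; apply: free_lieZ; exact: free_lie_br.
exists (b + z); first exact: free_lieD.
have bz1 : ord 1 (b + z) by exact: free_lie_ord (free_lieD Lb Lz).
have -> : g * texp (- (b + z)) - 1 = (g - texp (b + z)) * texp (- (b + z)).
  by rewrite mulrBl texpNr.
rewrite -[k.+1]addn0; apply: ordM => //.
(* g = (1 + z + ...) exp(b) agrees with exp(b) + z, and hence with exp(b + z), up to terms of order
   k + 1. *)
have -> : g - texp (b + z) = (g * texp (- b) - 1 - z) * texp b + z * (texp b - 1)
    - (texp (b + z) - texp b - z).
  rewrite !mulrBl mul1r -mulrA texpNl // mulr1 mulrBr mulr1; tens_ring.
apply: ordB; last by apply: texpD => //; exact: hom_ord.
apply: ordD; first by rewrite -[k.+1]addn0; apply: ordM.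
rewrite -[k.+1]addn1; apply: ordM; first exact: hom_ord.
apply/ord1P; rewrite /tscalar tensBE.
by have := tscalar_texp b1; rewrite /tscalar => ->; rewrite tens1E subrr.
Qed.

Lemma free_groupP g : G g <-> dynkin_grp g.
Proof.
split; last exact: dynkin_grp_texp.
by case=> a La <-; apply: texp_dynkin_grp; exact: free_lie_dynkin_el.
Qed.

Lemma free_group_scalar g : G g -> tscalar g = 1.
Proof. by case/free_groupP. Qed.

Lemma free_group_ord1 g : G g -> ord 1 (g - 1).
Proof.
move=> /free_group_scalar g1; apply/ord1P.
by move: g1; rewrite /tscalar tensBE => ->; rewrite tens1E subrr.
Qed.

Lemma free_group1 : G 1.
Proof. by exists 0; [exact: free_lie0|exact: texp0]. Qed.

(** The two factors enter differently, g through its equation and h as an exponential, as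
    [dynkin_grpM_texp] wants them. *)
Lemma free_groupM g h : G g -> G h -> G (g * h).
Proof.
move=> /free_groupP Gg [a La <-]; apply/free_groupP/dynkin_grpM_texp => //.
exact: free_lie_dynkin_el.
Qed.

Lemma free_group_prod (I : Type) (r : seq I) (P : pred I) (F : I -> T) :
  (forall i, P i -> G (F i)) -> G (\prod_(i <- r | P i) F i).
Proof. by move=> h; elim/big_ind: _ => //; [exact: free_group1|exact: free_groupM]. Qed.

Lemma texpV a : ord 1 a -> (texp a)^-1 = texp (- a) :> T.
Proof.
move=> a1; have u : texp a \is a GRing.unit.
  by apply/unitrP; exists (texp (- a)); rewrite texpNl ?texpNr.
by rewrite -[RHS]mul1r -(mulVr u) -mulrA texpNr ?mulr1.
Qed.

Lemma free_group_unit g : G g -> g \is a GRing.unit.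
Proof.
move=> [a La <-]; have a1 := free_lie_ord La.
by apply/unitrP; exists (texp (- a)); rewrite texpNl ?texpNr.
Qed.

Lemma free_groupV g : G g -> G g^-1.
Proof.
move=> [a La <-]; rewrite (texpV (free_lie_ord La)).
by exists (- a) => //; exact: free_lieN.
Qed.

Lemma dilationM t a b : dilation t (a * b) = dilation t a * dilation t b.
Proof.
apply: tens_ext => w; rewrite tensME /dilation tensME mulr_sumr.
apply: eq_bigr => k _; rewrite size_insub_take size_insub_drop.
have kw : (k <= size w)%N by rewrite -ltnS.
by rewrite mulrACA -exprD subnKC.
Qed.

Lemma dilationD t a b : dilation t (a + b) = dilation t a + dilation t b.
Proof. by apply: tens_ext => w; rewrite /dilation !tensDE mulrDr. Qed.

Lemma dilationZ t (x : R) a : dilation t (x *: a) = x *: dilation t a.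
Proof. by apply: tens_ext => w; rewrite tensZE /dilation tensZE mulrCA. Qed.

Lemma dilation0 t : dilation t (0 : T) = 0.
Proof. by have := dilationZ t 0 0; rewrite !scale0r. Qed.

Lemma dilation1 t : dilation t (1 : T) = 1.
Proof.
apply: tens_ext => w; rewrite /dilation tens1E.
by case: (size w) => [|n]; rewrite ?expr0 ?mul1r ?mulr0.
Qed.

Lemma dilationB t a b : dilation t (a - b) = dilation t a - dilation t b.
Proof. by rewrite -scaleN1r dilationD dilationZ scaleN1r. Qed.

Lemma dilation_hom k t a : hom k a -> dilation t a = t ^+ k *: a.
Proof.
move=> ka; apply: tens_ext => w; rewrite tensZE /dilation.
by have [->//|wk] := eqVneq (size w) k; rewrite ka // !mulr0.
Qed.

Lemma dilation_tensor_in t v : dilation t (tensor_in v) = tensor_in (t *: v) :> T.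
Proof.
rewrite (@dilation_hom 1) ?expr1 ?tensor_inZ // => w w1.
by case: w w1 => -[|i [|j s]] ws.
Qed.

Lemma dilationX t a n : dilation t (a ^+ n) = dilation t a ^+ n.
Proof. by elim: n => [|n IH]; rewrite ?expr0 ?dilation1 // !exprS dilationM IH. Qed.

Lemma dilation_texp t a : dilation t (texp a) = texp (dilation t a).
Proof.
rewrite /texp (big_morph _ (dilationD t) (dilation0 t)); apply: eq_bigr => i _.
by rewrite dilationZ dilationX.
Qed.

Lemma free_lie_dilation t a : L a -> L (dilation t a).
Proof.
elim=> [v|c {}a b _ da _ db|{}a b _ da _ db].
- by rewrite dilation_tensor_in; exact: free_lie_gen.
- by rewrite dilationD dilationZ; exact: free_lie_lin.
- by rewrite dilationB !dilationM; exact: free_lie_bracket.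
Qed.

Lemma free_group_dilation t g : G g -> G (dilation t g).
Proof.
move=> [a La <-]; rewrite dilation_texp; exists (dilation t a) => //.
exact: free_lie_dilation.
Qed.

Lemma dilation_dilation (x y : R) a : dilation x (dilation y a) = dilation (x * y) a.
Proof. by apply: tens_ext => w; rewrite /dilation mulrA exprMn. Qed.

Lemma dilation1l a : dilation 1 a = a.
Proof. by apply: tens_ext => w; rewrite /dilation expr1n mul1r. Qed.

Lemma free_group_exp v : G (texp (tensor_in v)).
Proof. by exists (tensor_in v) => //; exact: free_lie_gen. Qed.


End FreeGroup.

(** * Homogeneous norms on the free nilpotent group *)

Section Topology.
Variables (R : realType) (d m : nat).
Local Notation T := (tensor_alg R d m).
Implicit Types (a b c : T) (w : m.-bseq 'I_d).

Section Filter.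
Variables (I : Type) (F : set_system I).
Hypothesis FF : Filter F.
Implicit Types f g : I -> T.

Lemma cvg_tensP f a : f @ F --> a <-> forall w, f x w @[x --> F] --> a w.
Proof. exact: (@pointwise_cvgP (discrete_topology (m.-bseq 'I_d)) R (f @ F) a). Qed.

Lemma cvg_tensD f g a b : f @ F --> a -> g @ F --> b -> f x + g x @[x --> F] --> a + b.
Proof.
move=> /cvg_tensP fa /cvg_tensP gb; apply/cvg_tensP => w.
exact: cvgD (fa w) (gb w).
Qed.

Lemma cvg_tensN f a : f @ F --> a -> - f x @[x --> F] --> - a.
Proof. by move=> /cvg_tensP fa; apply/cvg_tensP => w; exact: cvgN (fa w). Qed.

Lemma cvg_tensB f g a b : f @ F --> a -> g @ F --> b -> f x - g x @[x --> F] --> a - b.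
Proof. by move=> fa gb; apply: cvg_tensD => //; exact: cvg_tensN. Qed.

Lemma cvg_tensZ (c : I -> R) f (x : R) a : c @ F --> x -> f @ F --> a ->
  c x *: f x @[x --> F] --> x *: a.
Proof.
move=> cx /cvg_tensP fa; apply/cvg_tensP => w.
exact: cvgM cx (fa w).
Qed.

Lemma cvg_tens_cst a : (fun _ : I => a) @ F --> a.
Proof. exact: cvg_cst. Qed.

Lemma cvg_sumR (J : Type) (r : seq J) (P : pred J) (u : J -> I -> R) (l : J -> R) :
  (forall j, P j -> u j @ F --> l j) ->
  \sum_(j <- r | P j) u j x @[x --> F] --> \sum_(j <- r | P j) l j.
Proof.
by move=> ul; apply: cvg_big => //; exact: add_continuous.
Qed.

Lemma cvg_tensM f g a b : f @ F --> a -> g @ F --> b -> f x * g x @[x --> F] --> a * b.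
Proof.
move=> /cvg_tensP fa /cvg_tensP gb; apply/cvg_tensP => w.
under eq_fun do rewrite tensME; rewrite tensME; apply: cvg_sumR => k _.
by apply: cvgM.
Qed.

Lemma cvg_tens_sum (J : Type) (r : seq J) (P : pred J) (u : J -> I -> T) (l : J -> T) :
  (forall j, P j -> u j @ F --> l j) ->
  \sum_(j <- r | P j) u j x @[x --> F] --> \sum_(j <- r | P j) l j.
Proof.
move=> ul; apply/cvg_tensP => w; under eq_fun do rewrite tens_sumE; rewrite tens_sumE.
by apply: cvg_sumR => j Pj; move: (ul j Pj) => /cvg_tensP.
Qed.

Lemma cvg_tens_prod (J : Type) (r : seq J) (P : pred J) (u : J -> I -> T) (l : J -> T) :
  (forall j, P j -> u j @ F --> l j) ->
  \prod_(j <- r | P j) u j x @[x --> F] --> \prod_(j <- r | P j) l j.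
Proof.
move=> ul; elim: r => [|j r IH].
  under eq_fun do rewrite big_nil; rewrite big_nil; exact: cvg_tens_cst.
under eq_fun do rewrite big_cons; rewrite big_cons; case: ifPn => // Pj.
by apply: cvg_tensM => //; exact: ul.
Qed.

Lemma cvg_tensX f a n : f @ F --> a -> f x ^+ n @[x --> F] --> a ^+ n.
Proof.
move=> fa; elim: n => [|n IH].
  by under eq_fun do rewrite expr0; rewrite expr0; exact: cvg_tens_cst.
by under eq_fun do rewrite exprS; rewrite exprS; exact: cvg_tensM.
Qed.

Lemma cvg_texp f a : f @ F --> a -> texp (f x) @[x --> F] --> texp a.
Proof.
move=> fa; apply: cvg_tens_sum => k _.
by apply: cvg_tensZ; [exact: cvg_cst|exact: cvg_tensX].
Qed.

Lemma tinvE a : tscalar a = 1 -> a^-1 = \sum_(k < m.+1) (1 - a) ^+ k.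
Proof.
move=> a1; rewrite (_ : a^-1 = tinv a) // /tinv /tunit a1 oner_neq0.
by rewrite invr1 !scale1r.
Qed.

(** With scalar part 1 the inverse is the finite Neumann sum of [tinvE], a polynomial. *)
Lemma cvg_tensV f a : (forall x, tscalar (f x) = 1) -> tscalar a = 1 ->
  f @ F --> a -> (f x)^-1 @[x --> F] --> a^-1.
Proof.
move=> f1 a1 fa; under eq_fun do rewrite tinvE //; rewrite tinvE //.
apply: cvg_tens_sum => k _; apply: cvg_tensX.
by apply: cvg_tensB => //; exact: cvg_tens_cst.
Qed.

Lemma cvg_dynkin f a : f @ F --> a -> dynkin_map (f x) @[x --> F] --> dynkin_map a.
Proof.
move=> /cvg_tensP fa; apply: cvg_tens_sum => w _.
by apply: cvg_tensZ => //; exact: cvg_tens_cst.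
Qed.

Lemma cvg_deg f a : f @ F --> a -> deg (f x) @[x --> F] --> deg a.
Proof.
move=> /cvg_tensP fa; apply/cvg_tensP => w.
by apply: cvgM => //; exact: cvg_cst.
Qed.

End Filter.

Lemma closed_dynkin_grp : closed (@dynkin_grp R d m).
Proof.
have cz (p : T -> R) : (forall a, p @ nbhs a --> p a) -> closed (p @^-1` [set 0]).
  by move=> cp; apply: (continuous_closedP _).1 => //; exact: closed_eq.
have -> : @dynkin_grp R d m =
    ((fun a : T => tscalar a - 1) @^-1` [set 0]) `&`
    \bigcap_(w in setT) ((fun a : T => (deg a - a * dynkin_map a) w) @^-1` [set 0]).
  apply/seteqP; split => [g [g1 dg]|g [/= /eqP]].
    by split => [|w _] /=; rewrite ?g1 ?dg subrr.
  rewrite subr_eq0 => /eqP g1 dg; split => //; apply: tens_ext => w.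
  by apply/eqP; rewrite -subr_eq0; apply/eqP; exact: dg.
apply: closedI.
  apply: cz => a; apply: cvgB; last exact: cvg_cst.
  have /cvg_tensP : id @ nbhs a --> a by exact: cvg_id.
  exact.
apply: closed_bigI => w _; apply: cz => a.
have H : deg x - x * dynkin_map x @[x --> nbhs a] --> deg a - a * dynkin_map a.
  apply: cvg_tensB; first by apply: cvg_deg; exact: cvg_id.
  by apply: cvg_tensM; [exact: cvg_id|apply: cvg_dynkin; exact: cvg_id].
by move/cvg_tensP : H; exact.
Qed.

End Topology.

(** * Continuity of N and its comparison with coordinates *)

Section NormContinuity.
Variables (R : realType) (V : finNormedModType R) (m : nat).
Local Notation d := (\dim {:V}).
Local Notation T := (tensor_alg R d m).
Local Notation G := (@free_group R V m).
Variable N : T -> R.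
Hypothesis hN : homogeneous_norm N.
Implicit Types (a b g h : T) (v : V) (s : seq 'I_d).

Lemma hnorm1 : N 1 = 0.
Proof. exact/(hnorm_eq0 hN (@free_group1 R V m)). Qed.

Lemma hnorm_prod (J : Type) (r : seq J) (P : pred J) (F : J -> T) :
  (forall j, P j -> G (F j)) ->
  N (\prod_(j <- r | P j) F j) <= \sum_(j <- r | P j) N (F j).
Proof.
move=> GF; elim: r => [|j r IH]; first by rewrite !big_nil hnorm1.
rewrite !big_cons; case: ifPn => // Pj.
apply: (le_trans (hnorm_mul hN (GF _ Pj) (free_group_prod _ GF))).
by rewrite lerD2l.
Qed.

Lemma texp_br_group (c : R) s : G (texp (c *: br s)).
Proof. by exists (c *: br s) => //; apply: free_lieZ; exact: free_lie_br. Qed.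

(** [br s] is homogeneous of degree [size s], so scaling it by t^(size s) is dilating by t; a
    negative coefficient gives the inverse element, which has the same norm. *)
Lemma hnorm_texp_br (c t : R) s : 0 <= t -> `|c| = t ^+ size s ->
  N (texp (c *: br s)) = t * N (texp (br s)).
Proof.
move=> t0 ct; have Gs : G (texp (br s)) by rewrite -[br s]scale1r; exact: texp_br_group.
have e : N (texp (t ^+ size s *: br s)) = t * N (texp (br s)).
  by rewrite -(dilation_hom t (@hom_br R d m s)) -dilation_texp (hnorm_dilation hN) // ger0_norm.
rewrite -e -ct; have [c0|c0] := leP 0 c; first by rewrite ger0_norm.
rewrite ltr0_norm // scaleNr -texpV ?(hnorm_inv hN) //; first exact: texp_br_group.
by apply: free_lie_ord; apply: free_lieZ; exact: free_lie_br.
Qed.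

Lemma hnorm_texp_br_cvg0 (I : Type) (F : set_system I) {FF : Filter F} (c : I -> R) s :
  s != [::] -> c @ F --> 0 -> N (texp (c x *: br s)) @[x --> F] --> 0.
Proof.
move=> s0 c0; apply/cvgr0Pnorm_lt => e e0.
pose K := N (texp (br s)).
have K0 : 0 <= K.
  by apply: (hnorm_ge0 hN); rewrite -[br s]scale1r; exact: texp_br_group.
have K1 : 0 < K + 1 by rewrite ltr_wpDl.
(* K vanishes when [br s] is 0, hence the divisor K + 1. *)
pose eta := e / (K + 1); have eta0 : 0 < eta by rewrite divr_gt0.
have n0 : (0 < size s)%N by rewrite lt0n size_eq0.
near=> x.
have cx : `|c x| < eta ^+ size s.
  by near: x; move/cvgr0Pnorm_lt : c0; apply; rewrite exprn_gt0.
pose t := `|c x| `^ (size s)%:R^-1.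
have t0 : 0 <= t by exact: powR_ge0.
have tc : `|c x| = t ^+ size s.
  by rewrite /t -powR_mulrn ?powR_ge0 // -powRrM mulVf ?powRr1 // pnatr_eq0 -lt0n.
rewrite (hnorm_texp_br t0 tc) ger0_norm ?mulr_ge0 //.
have te : t < eta by move: cx; rewrite tc ltr_pXn2r // ?nnegrE // ltW.
apply: (@le_lt_trans _ _ (t * (K + 1))).
  by rewrite ler_wpM2l // lerDl.
by rewrite -ltr_pdivlMr.
Unshelve. all: by end_near. Qed.

(** Leading terms add up, since cross terms and products with a remainder have order above k. *)
Lemma prod_ord (J : Type) (r : seq J) (P : pred J) (e b : J -> T) k : (0 < k)%N ->
  (forall j, P j -> ord k (b j)) -> (forall j, P j -> ord k.+1 (e j - 1 - b j)) ->
  ord k.+1 (\prod_(j <- r | P j) e j - 1 - \sum_(j <- r | P j) b j).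
Proof.
move=> k0 kb ke.
suff : ord k.+1 (\prod_(j <- r | P j) e j - 1 - \sum_(j <- r | P j) b j) /\
  ord k (\sum_(j <- r | P j) b j) by case.
elim: r => [|j r [IH1 IH2]]; first by rewrite !big_nil subrr subr0; split; exact: ord00.
rewrite !big_cons; case: ifPn => // Pj.
set p := \prod_(_ <- r | _) _ in IH1 *; set s := \sum_(_ <- r | _) _ in IH1 IH2 *.
split; last by apply: ordD => //; exact: kb.
have -> : e j * p - 1 - (b j + s) = (e j - 1 - b j) * p + b j * (p - 1) + (p - 1 - s).
  by rewrite !mulrBl !mulrBr mul1r mulr1; tens_ring.
have p1 : ord 1 (p - 1).
  rewrite -(subrK s (p - 1)); apply: ordD; first exact: ordW IH1.
  exact: ordW IH2.
apply: ordD => //; apply: ordD; first by rewrite -[k.+1]addn0; apply: ordM => //; exact: ke.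
by rewrite -[k.+1]addn1; apply: ordM => //; exact: kb.
Qed.

Lemma texp_ord k (z : T) : (0 < k)%N -> ord k z -> ord k.+1 (texp z - 1 - z).
Proof.
move=> k0 kz; have := texpD k0 (@ord00 R d m 1) kz.
by rewrite add0r texp0.
Qed.

(* Downward induction on the order of f - 1: the leading term of f x is
   sum_w c_w(x) br(w), and dividing by prod_w exp(c_w(x) br(w)), whose norm is at
   most sum_w |c_w(x)|^(1/k) N(exp(br(w))), raises the order. *)
Lemma hnorm_cvg0 (I : Type) (F : set_system I) {FF : Filter F} (f : I -> T) :
  (forall x, G (f x)) -> f @ F --> (1 : T) -> N (f x) @[x --> F] --> 0.
Proof.
suff H j : forall f : I -> T, (forall x, G (f x)) -> (forall x, ord (m.+1 - j) (f x - 1)) ->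
    f @ F --> (1 : T) -> N (f x) @[x --> F] --> 0.
  by move=> Gf; apply: (H m.+1) => // x; rewrite subnn; exact: ord0.
elim: j => [|j IH] {}f Gf fk f1.
  under eq_fun => x.
    have -> : f x = 1 by apply/eqP; rewrite -subr_eq0; apply/eqP; apply: ord_big (fk x) _; rewrite subn0.
    rewrite hnorm1; over.
  exact: cvg_cst.
(* If m <= j, the order that the induction hypothesis asks for is at most 1, which every group
   element satisfies. *)
have [jm|mj] := leqP m j.
  apply: IH => // x; apply: (@ordW _ _ _ 1); last exact: free_group_ord1.
  by rewrite leq_subLR addn1 ltnS.
have k0 : (0 < m - j)%N by rewrite subn_gt0.
move: fk; rewrite subSS; set k := (m - j)%N in k0 * => fk.
pose c w x := f x w / k%:R.
pose h x : T := \prod_(w | size (val w) == k) texp (c w x *: br (val w)).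
have Gh x : G (h x) by apply: free_group_prod => w _; exact: texp_br_group.
have c0 w : size (val w) == k -> c w x @[x --> F] --> 0.
  move=> wk; rewrite -(mul0r k%:R^-1); apply: cvgM; last exact: cvg_cst.
  move/cvg_tensP : f1 => /(_ w); rewrite tens1E.
  by rewrite (_ : size w == 0%N = false) // (eqP wk) gtn_eqF.
have h1 : h @ F --> (1 : T).
  have -> : (1 : T) = \prod_(w : m.-bseq 'I_d | size (val w) == k) 1 by rewrite big1.
  apply: cvg_tens_prod => w wk; rewrite -(@texp0 R d m); apply: cvg_texp.
  rewrite -(scale0r (br (val w) : T)); apply: cvg_tensZ; first exact: c0.
  exact: cvg_tens_cst.
(* By [dynkin_grp_ordP] and [prod_ord], f x - 1 and h x - 1 have the same leading term z. *)
have hfk x : ord k.+1 ((h x)^-1 * f x - 1).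
  have -> : (h x)^-1 * f x - 1 = (h x)^-1 * (f x - h x).
    by rewrite mulrBr mulVr //; exact: free_group_unit.
  rewrite -[k.+1]add0n; apply: ordM => //.
  have [z [hz zE kz]] := dynkin_grp_ordP k0 ((free_groupP _).1 (Gf x)) (fk x).
  have -> : f x - h x = (f x - 1 - z) - (h x - 1 - z) by tens_ring.
  apply: ordB => //; rewrite zE; apply: prod_ord => // w wk.
    by apply: ordZ; rewrite -(eqP wk); apply: hom_ord; exact: hom_br.
  apply: texp_ord => //.
  by apply: ordZ; rewrite -(eqP wk); apply: hom_ord; exact: hom_br.
have hf0 : N ((h x)^-1 * f x) @[x --> F] --> 0.
  apply: IH => [x|x|].
  - by apply: free_groupM => //; exact: free_groupV.
  - by move: (hfk x); rewrite /k subSn // ltnW.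
  - rewrite -[1]mulr1 -{1}[1]invr1; apply: cvg_tensM => //.
    by apply: cvg_tensV => // x; exact: (free_group_scalar (Gh x)).
have hh0 : \sum_(w : m.-bseq 'I_d | size (val w) == k) N (texp (c w x *: br (val w))) @[x --> F] --> 0.
  rewrite [X in _ --> X](_ : _ = \sum_(w : m.-bseq 'I_d | size (val w) == k) 0); last by rewrite big1.
  apply: cvg_sumR => w wk; apply: hnorm_texp_br_cvg0; last exact: c0.
  by rewrite -size_eq0 (eqP wk) -lt0n.
have fh x : 0 <= N (f x) <=
    \sum_(w : m.-bseq 'I_d | size (val w) == k) N (texp (c w x *: br (val w)))
    + N ((h x)^-1 * f x).
  rewrite (hnorm_ge0 hN) //=.
  have e : f x = h x * ((h x)^-1 * f x) by rewrite mulrA mulrV ?mul1r //; exact: free_group_unit.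
  rewrite {1}e; apply: (le_trans (hnorm_mul hN _ _)) => //.
    by apply: free_groupM => //; exact: free_groupV.
  by rewrite lerD2r; apply: hnorm_prod => w _; exact: texp_br_group.
apply: (squeeze_cvgr (nearW _ fh)); first exact: cvg_cst.
by have := cvgD hh0 hf0; rewrite addr0; exact.
Qed.

(** Otherwise a sequence in the group tends to 1 while N stays at least e, against [hnorm_cvg0]. *)
Lemma hnorm_small (e : R) : 0 < e -> exists2 del : R, 0 < del &
  forall g, G g -> (forall w, `|g w - (1 : T) w| <= del) -> N g < e.
Proof.
move=> e0; apply: contrapT => H.
have H' (n : nat) : exists g, [/\ G g, forall w, `|g w - (1 : T) w| <= n.+1%:R^-1 & e <= N g].
  apply: contrapT => Hn; apply: H; exists n.+1%:R^-1; first by rewrite invr_gt0.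
  move=> g Gg gw; rewrite ltNge; apply/negP => eg; apply: Hn.
  by exists g.
have [f Hf] := choice H'.
have f1 : f @ \oo --> (1 : T).
  apply/cvg_tensP => w; apply/cvgrPdist_le => x x0; near=> n.
  rewrite distrC; have [_ /(_ w) fw _] := Hf n; apply: (le_trans fw).
  near: n; have := @cvg_harmonic R => /cvgr0Pnorm_le /(_ _ x0).
  by apply: filterS => n /=; rewrite ger0_norm // invr_ge0.
have Gf n : G (f n) by case: (Hf n).
have /cvgr0Pnorm_lt Nf0 : N (f n) @[n --> \oo] --> 0 by exact: hnorm_cvg0.
have [n _ Nf] := Nf0 _ e0.
have [_ _] := Hf n; have := Nf n (leqnn n).
by rewrite /= ger0_norm ?(hnorm_ge0 hN) // ltNge => /negbTE ->.
Unshelve. all: by end_near. Qed.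

Lemma free_group_nil g : G g -> g [bseq] = 1.
Proof. exact: free_group_scalar. Qed.

Lemma hnorm_dist g h : G g -> G h -> `|N g - N h| <= N (g^-1 * h).
Proof.
move=> Gg Gh; have gu := free_group_unit Gg; have hu := free_group_unit Gh.
have Ggh : G (g^-1 * h) by apply: free_groupM => //; exact: free_groupV.
have h1 : N g <= N h + N (g^-1 * h).
  have {1}-> : g = h * (g^-1 * h)^-1 by rewrite invrM ?unitrV // invrK mulrA mulrV // mul1r.
  rewrite -(hnorm_inv hN Ggh); apply: (hnorm_mul hN) => //.
  exact: free_groupV.
have h2 : N h <= N g + N (g^-1 * h).
  have {1}-> : h = g * (g^-1 * h) by rewrite mulrA mulrV // mul1r.
  exact: (hnorm_mul hN).
by rewrite ler_norml; apply/andP; split; lra.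
Qed.

Lemma hnorm_continuous (A : set T) : A `<=` G -> {within A, continuous N}.
Proof.
move=> AG; apply/subspace_continuousP => x Ax; apply/cvgrPdist_lt => e e0.
(* Left translation moves the question to 1. Off A the value is set to 1 because [hnorm_cvg0] wants
   group elements everywhere. *)
pose f y : T := if y \in A then x^-1 * y else 1.
have Gx := AG _ Ax.
have Gf y : G (f y).
  rewrite /f; case: ifPn => [/set_mem Ay|_]; last exact: free_group1.
  by apply: free_groupM; [exact: free_groupV|exact: AG].
have f1 : f @ within A (nbhs x) --> (1 : T).
  apply: (@cvg_trans _ ((fun y => x^-1 * y) @ within A (nbhs x))).
    apply: near_eq_cvg; near=> y; rewrite /f ifT // inE.
    by near: y; exact: withinT.
  apply: (cvg_within_filter (f := fun y : T => x^-1 * y)).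
  rewrite -(mulVr (free_group_unit Gx)); apply: cvg_tensM; last exact: cvg_id.
  exact: cvg_tens_cst.
have /cvgr0Pnorm_lt fe : N (f y) @[y --> within A (nbhs x)] --> 0 by exact: hnorm_cvg0.
near=> y.
have Ay : A y by near: y; exact: withinT.
apply: (le_lt_trans (hnorm_dist Gx (AG _ Ay))).
apply: le_lt_trans (ler_norm _) _.
have : `|N (f y)| < e by near: y; exact: fe.
by rewrite /f ifT // inE.
Unshelve. all: by end_near. Qed.

(* N is bounded below on this compact set, which every g <> 1 of the group meets
   after a suitable dilation. *)
Definition gauge_shell : set T := [set g | [/\ G g, forall w, `|g w| <= 1 &
  1 <= \sum_(w : m.-bseq 'I_d | val w != [::]) `|g w|]].

Lemma compact_gauge_shell : compact gauge_shell.
Proof.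
have cb : compact [set g : T | forall w, g w \in `[-1, 1]].
  apply: (@tychonoff (m.-bseq 'I_d) (fun _ => R) (fun _ => [set` `[-1, 1]])) => w.
  exact: segment_compact.
apply: (subclosed_compact _ cb); last first.
  by move=> g [_ gw _] w /=; rewrite in_itv /= -ler_norml.
have -> : gauge_shell = @dynkin_grp R d m `&` ([set g : T | forall w, g w \in `[-1, 1]] `&`
    ((fun g : T => \sum_(w | val w != [::]) `|g w|) @^-1` [set x | 1 <= x])).
  apply/seteqP; split=> [g [/free_groupP Gg gw g1]|g [/free_groupP Gg [gw g1]]].
    by split=> //; split=> // w /=; rewrite in_itv /= -ler_norml.
  by split=> // w; move: (gw w); rewrite /= in_itv /= -ler_norml.
apply: closedI; first exact: closed_dynkin_grp.
have ev (a : T) w : b w @[b --> nbhs a] --> a w.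
  by have /cvg_tensP : id @ nbhs a --> a by exact: cvg_id; exact.
apply: closedI.
  have -> : [set g : T | forall w, g w \in `[-1, 1]] =
      \bigcap_(w in setT) ((fun g : T => g w) @^-1` [set` `[-1, 1]]).
    by apply/seteqP; split=> [g H w _|g H w] //; exact: H.
  apply: closed_bigI => w _.
  by apply: (continuous_closedP _).1 => [a|]; [exact: ev|exact: interval_closed].
apply: (continuous_closedP _).1 => [a|]; last exact: closed_ge.
by apply: (cvg_sumR (nbhs_filter a)) => w _; apply: cvg_norm; exact: ev.
Qed.

(** If some coordinate exceeds t^(size w), dilating g by 1 / s, with s = max_v |g_v|^(1 / size v) >
    t, lands in [gauge_shell], so N g is at least s times a positive lower bound of N there. *)
Lemma hnorm_gauge : exists2 c : R, 0 < c &
  forall g (t : R), G g -> 0 < t -> N g <= c * t ->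
  forall w : m.-bseq 'I_d, val w != [::] -> `|g w| <= t ^+ size w.
Proof.
have [c c0 cP] : exists2 c : R, 0 < c & forall g, gauge_shell g -> c <= N g.
  (* The shell is empty when V = 0, for instance; any constant then works. *)
  have [Ke|/set0P Kn] := eqVneq gauge_shell set0.
    by exists 1 => // g; rewrite Ke.
  have KG : gauge_shell `<=` G by move=> g [].
  have [g gK gmin] := compact_EVT_min Kn compact_gauge_shell (hnorm_continuous KG).
  move/set_mem : gK => [Gg _ g1]; exists (N g); last by move=> h hK; apply: gmin; rewrite inE.
  rewrite lt_neqAle (hnorm_ge0 hN) // andbT eq_sym; apply/eqP => /(hnorm_eq0 hN Gg) gE.
  move: g1; rewrite gE big1 ?ler10 // => w w0.
  by rewrite tens1E size_eq0 (negbTE w0) normr0.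
exists (c / 2); first by rewrite divr_gt0.
move=> g t Gg t0 Ngt w w0; rewrite leNgt; apply/negP => gw.
have sz (v : m.-bseq 'I_d) : val v != [::] -> (size (val v))%:R != 0 :> R.
  by rewrite pnatr_eq0 size_eq0.
pose s (v : m.-bseq 'I_d) : R := if val v == [::] then 0 else `|g v| `^ (size v)%:R^-1.
have s0 (v : m.-bseq 'I_d) : 0 <= s v by rewrite /s; case: ifP => // _; exact: powR_ge0.
have sE (v : m.-bseq 'I_d) : val v != [::] -> `|g v| = s v ^+ size v.
  move=> v0; rewrite /s (negbTE v0) -powR_mulrn ?powR_ge0 // -powRrM mulVf ?powRr1 //.
  exact: sz.
have [v _ vmax] := @Order.TotalTheory.arg_maxP _ _ _ w xpredT s isT.
have tv : t < s v.
  apply: lt_le_trans (vmax w isT).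
  move: gw; rewrite sE // ltr_pXn2r ?nnegrE //; first by rewrite lt0n size_eq0.
  exact: ltW.
have sv0 : 0 < s v by exact: lt_trans tv.
have v0 : val v != [::] by apply/eqP => ve; move: sv0; rewrite /s ve eqxx ltxx.
have Ks : gauge_shell (dilation (s v)^-1 g).
  split; first exact: free_group_dilation.
    move=> u; rewrite /dilation normrM normrX ger0_norm ?invr_ge0 //.
    have [u0|u0] := eqVneq (val u) [::].
      have -> : u = [bseq] by exact: val_inj.
      by rewrite free_group_nil // normr1 mulr1 expr0.
    rewrite sE // -exprMn exprn_ile1 ?mulr_ge0 ?invr_ge0 // mulrC ler_pdivrMr // mul1r.
    exact: vmax.
  rewrite (bigD1 v) //=; apply: (@le_trans _ _ `|dilation (s v)^-1 g v|); last first.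
    by rewrite lerDl sumr_ge0.
  rewrite /dilation normrM normrX ger0_norm ?invr_ge0 // sE //.
  by rewrite -exprMn mulVf ?expr1n // gt_eqF.
have := cP _ Ks; rewrite (hnorm_dilation hN) // ger0_norm ?invr_ge0 //.
rewrite mulrC ler_pdivlMr // => cs.
have : c * s v <= c / 2 * t by exact: le_trans Ngt.
have : c * t < c * s v by rewrite ltr_pM2l.
have : 0 < c * t by rewrite mulr_gt0.
lra.
Qed.

Lemma hnorm_bounded (B : R) : exists2 B' : R, 0 < B' &
  forall g, G g -> N g <= B -> forall w, `|g w| <= B'.
Proof.
have [c c0 cP] := hnorm_gauge.
pose t := Num.max 1 (B / c); have t1 : 1 <= t by rewrite le_max lexx.
exists (t ^+ m); first by rewrite exprn_gt0 // (lt_le_trans ltr01).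
move=> g Gg NgB w; have [w0|w0] := eqVneq (val w) [::].
  have -> : w = [bseq] by exact: val_inj.
  by rewrite free_group_nil // normr1 exprn_ege1.
apply: (@le_trans _ _ (t ^+ size w)).
  apply: cP => //; first exact: lt_le_trans t1.
  by apply: (le_trans NgB); rewrite mulrC -ler_pdivrMr // le_max lexx orbT.
by rewrite ler_weXn2l // size_bseq.
Qed.

Lemma hnorm_coord_small (e : R) : 0 < e -> exists2 del : R, 0 < del &
  forall g, G g -> N g <= del -> forall w, `|g w - (1 : T) w| <= e.
Proof.
have [c c0 cP] := hnorm_gauge.
move=> e0; pose t := Num.min 1 e; have t0 : 0 < t by rewrite lt_min ltr01.
exists (c * t) => [|g Gg Ng w]; first exact: mulr_gt0.
have [w0|w0] := eqVneq (val w) [::].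
  have -> : w = [bseq] by exact: val_inj.
  by rewrite (free_group_nil Gg) tens1E /= subrr normr0 ltW.
rewrite tens1E size_eq0 (negbTE w0) subr0.
apply: (le_trans (cP _ _ Gg t0 Ng _ w0)).
apply: (@le_trans _ _ t); last by rewrite ge_min lexx orbT.
have t1 : t <= 1 by rewrite ge_min lexx.
have : (0 < size w)%N by rewrite lt0n size_eq0.
by case: (size w) => // n _; rewrite exprS ler_piMr ?exprn_ile1 ?(ltW t0).
Qed.

Lemma hnorm_cvg1 (I : Type) (F : set_system I) {FF : Filter F} (f : I -> T) :
  (forall x, G (f x)) -> N (f x) @[x --> F] --> 0 -> f @ F --> (1 : T).
Proof.
move=> Gf Nf; apply/cvg_tensP => w; apply/cvgrPdist_le => e e0.
have [del del0 H] := hnorm_coord_small e0.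
near=> x; rewrite distrC; apply: H => //; apply: le_trans (ler_norm _) _; near: x.
by move/cvgr0Pnorm_le : Nf; apply.
Unshelve. all: by end_near. Qed.

Lemma tensM_bound (a b : T) (x y : R) : 0 <= x -> (forall w, `|a w| <= x) ->
  (forall w, `|b w| <= y) -> forall w, `|(a * b) w| <= m.+1%:R * (x * y).
Proof.
move=> x0 ax bY w; rewrite tensME; apply: le_trans (ler_norm_sum _ _ _) _.
have y0 : 0 <= y by exact: le_trans (bY w).
apply: (@le_trans _ _ (\sum_(k < (size w).+1) x * y)).
  by apply: ler_sum => k _; rewrite normrM ler_pM.
rewrite sumr_const card_ord -[x * y *+ _]mulr_natl ler_wpM2r ?mulr_ge0 //.
by rewrite ler_nat ltnS size_bseq.
Qed.

(** N need not be invariant under conjugation, but conjugators of bounded norm have bounded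
    coordinates, so g^-1 (u - 1) g is small with u - 1, uniformly in g. *)
Lemma hnorm_conj_small (B e : R) : 0 < e -> exists2 del : R, 0 < del &
  forall g u, G g -> G u -> N g <= B -> N u <= del -> N (g^-1 * u * g) < e.
Proof.
move=> e0; have [del1 del10 H1] := hnorm_small e0.
have [B' B'0 HB] := hnorm_bounded B.
pose c : R := m.+1%:R * (m.+1%:R * B' * B'); have c0 : 0 < c by rewrite !mulr_gt0.
have [del del0 H2] : exists2 del : R, 0 < del & forall g, G g -> N g <= del ->
    forall w, `|g w - (1 : T) w| <= del1 / c.
  by apply: hnorm_coord_small; rewrite divr_gt0.
exists del => // g u Gg Gu gB ud; apply: H1.
  by apply: free_groupM => //; apply: free_groupM => //; exact: free_groupV.
move=> w; rewrite -tensBE.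
have -> : g^-1 * u * g - 1 = g^-1 * (u - 1) * g.
  by rewrite mulrBr mulr1 mulrBl mulVr //; exact: free_group_unit.
have gV w' : `|g^-1 w'| <= B'.
  by apply: HB; [exact: free_groupV|rewrite (hnorm_inv hN)].
have gw w' : `|g w'| <= B' by exact: HB.
have u1 w' : `|(u - 1) w'| <= del1 / c by rewrite tensBE; exact: H2.
have d0 : 0 <= del1 / c by rewrite divr_ge0 // ltW.
apply: (le_trans (tensM_bound _ (tensM_bound (ltW B'0) gV u1) gw w)).
  by rewrite mulr_ge0 // mulr_ge0 // ltW.
rewrite (_ : m.+1%:R * (m.+1%:R * (B' * (del1 / c)) * B') = c * (del1 / c)).
  by rewrite mulrCA mulfV ?mulr1 // gt_eqF.
by rewrite /c; set z := del1 / _; ring.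
Qed.

End NormContinuity.

(** * Factorization into boundedly many exponentials of vectors *)

Section Chow.
Variables (R : realType) (V : finNormedModType R) (m : nat).
Local Notation d := (\dim {:V}).
Local Notation T := (tensor_alg R d m).
Local Notation G := (@free_group R V m).
Variable N : T -> R.
Hypothesis hN : homogeneous_norm N.
Implicit Types (a b g h : T) (v : V) (s : seq 'I_d) (vs : seq V).

Definition expv v : T := texp (tensor_in v).

Definition pexp vs : T := \prod_(v <- vs) expv v.

Lemma expv_group v : G (expv v).
Proof. exact: free_group_exp. Qed.

Lemma tensor_in_ord v : ord 1 (tensor_in v : T).
Proof. by apply: free_lie_ord; exact: free_lie_gen. Qed.

Lemma expvD (x y : R) v : expv (x *: v) * expv (y *: v) = expv ((x + y) *: v).
Proof. by rewrite /expv !tensor_inZ texpM_scale //; exact: tensor_in_ord. Qed.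

Lemma expv0 : expv 0 = 1.
Proof. by rewrite /expv tensor_in0 texp0. Qed.

Lemma expvN v : expv (- v) = (expv v)^-1.
Proof.
rewrite /expv texpV; last exact: tensor_in_ord.
by rewrite -scaleN1r tensor_inZ scaleN1r.
Qed.

Lemma dilation_expv (t : R) v : dilation t (expv v) = expv (t *: v).
Proof. by rewrite /expv dilation_texp dilation_tensor_in. Qed.

Lemma hnorm_expvZ (t : R) v : N (expv (t *: v)) = `|t| * N (expv v).
Proof. by rewrite -dilation_expv (hnorm_dilation hN) //; exact: expv_group. Qed.

Lemma pexp_group vs : G (pexp vs).
Proof. by apply: free_group_prod => v _; exact: expv_group. Qed.

(** The number of factors is exactly n, not at most n, so that all cells of the time grid can later
    be subdivided alike. *)
Definition reach (n : nat) (K : R) : set T :=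
  [set g | exists vs, [/\ size vs = n, {in vs, forall v, N (expv v) <= K} & pexp vs = g]].

Lemma reach_group n K g : reach n K g -> G g.
Proof. by move=> [vs [_ _ <-]]; exact: pexp_group. Qed.

Lemma reachW n K L g : K <= L -> reach n K g -> reach n L g.
Proof.
by move=> KL [vs [s1 s2 s3]]; exists vs; split=> // v /s2 /le_trans; apply.
Qed.

Lemma reachM n l K L g h : reach n K g -> reach l L h ->
  reach (n + l) (Num.max K L) (g * h).
Proof.
move=> [vs [s1 s2 s3]] [ws [t1 t2 t3]]; exists (vs ++ ws); split.
- by rewrite size_cat s1 t1.
- by move=> v; rewrite mem_cat le_max => /orP[/s2|/t2] ->; rewrite ?orbT.
- by rewrite /pexp big_cat; congr (_ * _).
Qed.

Lemma reachV n K g : reach n K g -> reach n K g^-1.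
Proof.
move=> [vs [s1 s2 <-]]; exists (rev (map -%R vs)); split.
- by rewrite size_rev size_map.
- move=> v; rewrite mem_rev => /mapP[u /s2 uK ->].
  by rewrite expvN (hnorm_inv hN) //; exact: expv_group.
- elim: vs {s1 s2} => [|v vs IH]; first by rewrite /pexp !big_nil invr1.
  rewrite /= rev_cons /pexp big_rcons /= big_cons invrM; last 2 first.
    + exact: free_group_unit (expv_group v).
    + exact: free_group_unit (pexp_group vs).
  by rewrite expvN; congr (_ * _).
Qed.

Lemma reach1 K : reach 0 K 1.
Proof. by exists [::]; split => //; rewrite /pexp big_nil. Qed.

Lemma hnorm_reach n K g : 0 <= K -> reach n K g -> N g <= n%:R * K.
Proof.
move=> K0 [vs [<- s2 <-]]; apply: le_trans (hnorm_prod hN _ _) _.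
  by move=> v _; exact: expv_group.
rewrite -sum1_size natr_sum mulr_suml big_seq [leRHS]big_seq.
by apply: ler_sum => v vvs; rewrite mul1r; exact: s2.
Qed.

(* The group commutator of 1 + a + ... and 1 + b + ... is 1 + [a, b] + ... *)
Lemma commutator_ord k l g h a b : (0 < k)%N -> (0 < l)%N -> G g -> G h ->
  ord k a -> ord l b -> ord k.+1 (g - 1 - a) -> ord l.+1 (h - 1 - b) ->
  ord (k + l).+1 (g * h * (g^-1 * h^-1) - 1 - (a * b - b * a)).
Proof.
move=> k0 l0 Gg Gh ka lb ga hb.
have GV : G (g^-1 * h^-1) by apply: free_groupM; exact: free_groupV.
have inv : h * g * (g^-1 * h^-1) = 1.
  by rewrite mulrA -(mulrA h) mulrV ?mulr1 ?mulrV //; exact: free_group_unit.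
have -> : g * h * (g^-1 * h^-1) - 1 - (a * b - b * a) =
    ((g - 1) * (h - 1) - (h - 1) * (g - 1) - (a * b - b * a)) * (g^-1 * h^-1)
    + (a * b - b * a) * (g^-1 * h^-1 - 1).
  have -> : (g - 1) * (h - 1) - (h - 1) * (g - 1) = g * h - h * g.
    by rewrite !(mulrBl, mulrBr) !mul1r !mulr1; tens_ring.
  by rewrite -[in LHS]inv mulrBr mulr1 !mulrBl; tens_ring.
have kg : ord k (g - 1) by rewrite -(subrK a (g - 1)); apply: ordD => //; exact: ordW ga.
have lh : ord l (h - 1) by rewrite -(subrK b (h - 1)); apply: ordD => //; exact: ordW hb.
apply: ordD; last first.
  rewrite -[(k + l).+1]addn1; apply: ordM; last exact: free_group_ord1.
  by apply: ordB; [apply: ordM|rewrite addnC; apply: ordM].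
rewrite -[(k + l).+1]addn0; apply: ordM => //.
have -> : (g - 1) * (h - 1) - (h - 1) * (g - 1) - (a * b - b * a) =
  ((g - 1 - a) * (h - 1) + a * (h - 1 - b)) - ((h - 1 - b) * (g - 1) + b * (g - 1 - a)).
  by rewrite !(mulrBl, mulrBr) !mul1r !mulr1; tens_ring.
apply: ordB; apply: ordD.
- by rewrite -addSn; apply: ordM.
- by rewrite -addnS; apply: ordM.
- by rewrite addnC -addSn; apply: ordM.
- by rewrite addnC -addnS; apply: ordM.
Qed.

(** Induction on the last letter: the commutator of an approximation of exp(c br s) with exp(e_i)
    has leading term c [br s, e_i]. The coefficient c enters only at the first letter, so n and K
    depend on s and B alone. *)
Lemma reach_br s (B : R) : s != [::] -> 0 <= B -> exists n K, 0 <= K /\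
  forall c : R, `|c| <= B -> exists2 g, reach n K g &
    ord (size s).+1 (g - 1 - c *: br s).
Proof.
move=> s0 B0; elim/last_ind: s s0 => // s i IH _.
pose e : V := (vbasis {:V})`_i.
have N0 v : 0 <= N (expv v) by apply: (hnorm_ge0 hN); exact: expv_group.
have he : ord 2 (expv e - 1 - base [:: i]).
  rewrite -tensor_in_base; apply: texp_ord => //; exact: tensor_in_ord.
have re (K : R) : N (expv e) <= K -> reach 1 K (expv e).
  move=> eK; exists [:: e]; split => //; last by rewrite /pexp big_seq1.
  by move=> v; rewrite inE => /eqP ->.
have [->|s0] := eqVneq s [::].
  exists 1%N, (B * N (expv e)); split; first by rewrite mulr_ge0.
  move=> c cB; exists (expv (c *: e)).
    exists [:: c *: e]; split => //; last by rewrite /pexp big_seq1.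
    by move=> v; rewrite inE => /eqP ->; rewrite hnorm_expvZ ler_wpM2r.
  rewrite /= br1 -tensor_in_base -tensor_inZ; apply: texp_ord => //.
  exact: tensor_in_ord.
have [n [K [K0 H]]] := IH s0.
pose L := Num.max K (N (expv e)).
exists (n + 1 + (n + 1))%N, L; split; first by rewrite le_max K0.
move=> c /H [g gr gc]; exists (g * expv e * (g^-1 * (expv e)^-1)).
  have r1 : reach n L g by apply: reachW gr; rewrite le_max lexx.
  have r2 : reach 1 L (expv e) by apply: re; rewrite le_max lexx orbT.
  rewrite -[L]maxxx; apply: reachM; rewrite -[L]maxxx; apply: reachM => //; exact: reachV.
rewrite size_rcons br_rcons // scalerBr scalerAl scalerAr -[(size s).+1]addn1.
apply: commutator_ord => //.
- by rewrite lt0n size_eq0.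
- exact: reach_group gr.
- exact: expv_group.
- by apply: ordZ; apply: hom_ord; exact: hom_br.
- exact: hom_ord (@hom_base R d m [:: i]).
Qed.

Lemma reach_brs k (B : R) (r : seq (m.-bseq 'I_d)) : (0 < k)%N -> 0 <= B ->
  exists n K, 0 <= K /\ forall c : m.-bseq 'I_d -> R, (forall w, `|c w| <= B) ->
    exists2 g, reach n K g &
      ord k.+1 (g - 1 - \sum_(w <- r | size (val w) == k) c w *: br (val w)).
Proof.
move=> k0 B0; elim: r => [|w r [n [K [K0 IH]]]].
  exists 0%N, 0; split => // c _; exists 1; first exact: reach1.
  by rewrite big_nil !subrr.
have [wk|wk] := eqVneq (size (val w)) k; last first.
  exists n, K; split => // c /IH [g gr gc]; exists g => //.
  by rewrite big_cons (negbTE wk).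
have w0 : val w != [::] by rewrite -size_eq0 wk -lt0n.
have [n' [K' [K'0 H]]] := reach_br w0 B0.
exists (n' + n)%N, (Num.max K' K); split; first by rewrite le_max K0 orbT.
move=> c cB; have [h hr hc] := H _ (cB w); have [g gr gc] := IH _ cB.
exists (h * g); first exact: reachM.
rewrite big_cons wk eqxx.
set z := \sum_(_ <- _ | _) _ in gc *.
have kz : ord k z.
  by apply: ord_sum => v /eqP vk; apply: ordZ; rewrite -{1}vk; apply: hom_ord; exact: hom_br.
rewrite wk in hc.
have -> : h * g - 1 - (c w *: br (val w) + z) = (h - 1 - c w *: br (val w)) * g +
    c w *: br (val w) * (g - 1) + (g - 1 - z).
  by rewrite !mulrBl !mulrBr mul1r mulr1; tens_ring.
apply: ordD => //; apply: ordD; first by rewrite -[k.+1]addn0; apply: ordM.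
rewrite -[k.+1]addn1; apply: ordM; last exact: free_group_ord1 (reach_group gr).
by apply: ordZ; rewrite -{1}wk; apply: hom_ord; exact: hom_br.
Qed.

(** The error h^-1 g has bounded norm, hence bounded coordinates by [hnorm_bounded]; its leading
    coefficients are then bounded, and one n' and K' from [reach_brs] correct them for all g. *)
Lemma chow_ord k : exists n K, 0 <= K /\ forall g, G g -> N g <= 1 ->
  exists2 h, reach n K h & ord k.+1 (h^-1 * g - 1).
Proof.
elim: k => [|k [n [K [K0 IH]]]].
  exists 0%N, 0; split => // g Gg _; exists 1; first exact: reach1.
  by rewrite invr1 mul1r; exact: free_group_ord1.
have [B B0 HB] := hnorm_bounded hN (n%:R * K + 1).
have BK : 0 <= B / k.+1%:R by rewrite divr_ge0 // ltW.
have [n' [K' [K'0 H]]] := @reach_brs k.+1 _ (index_enum _) isT BK.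
exists (n + n')%N, (Num.max K K'); split; first by rewrite le_max K0.
move=> g Gg Ng; have [h hr hk] := IH g Gg Ng.
have Gh := reach_group hr.
have Ghg : G (h^-1 * g) by apply: free_groupM => //; exact: free_groupV.
have Nhg : N (h^-1 * g) <= n%:R * K + 1.
  apply: (le_trans (hnorm_mul hN _ Gg)); first exact: free_groupV.
  by apply: lerD => //; rewrite (hnorm_inv hN) //; exact: hnorm_reach.
have [z [hz zE kz]] := dynkin_grp_ordP (ltn0Sn k) ((free_groupP _).1 Ghg) hk.
have cB w : `|(h^-1 * g) w / k.+1%:R| <= B / k.+1%:R.
  by rewrite normrM normfV normr_nat ler_wpM2r ?invr_ge0 // HB.
have [u ur uc] := H _ cB; exists (h * u); first exact: reachM.
have Gu := reach_group ur.
rewrite invrM; [|exact: free_group_unit|exact: free_group_unit].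
have -> : u^-1 * h^-1 * g - 1 = u^-1 * ((h^-1 * g - 1 - z) - (u - 1 - z)).
  have -> : h^-1 * g - 1 - z - (u - 1 - z) = h^-1 * g - u by tens_ring.
  by rewrite mulrBr mulVr ?mulrA //; exact: free_group_unit.
rewrite -[k.+2]add0n; apply: ordM => //; apply: ordB => //.
by rewrite zE.
Qed.

(** At k = m the approximation of [chow_ord] is exact; dilations carry it from the unit ball to the
    whole group. *)
Lemma chow : exists n K, 0 <= K /\ forall g, G g ->
  exists vs, [/\ size vs = n, {in vs, forall v, N (expv v) <= K * N g} & pexp vs = g].
Proof.
have [n [K [K0 H]]] := chow_ord m; exists n, K; split => // g Gg.
(* Norm 0 cannot be normalised by a dilation; g is then 1, a product of n trivial factors. *)
have [g0|g0] := eqVneq (N g) 0.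
  have -> : g = 1 by exact/(hnorm_eq0 hN).
  exists (nseq n 0); split; first by rewrite size_nseq.
    by move=> v /nseqP [-> _]; rewrite expv0 (hnorm1 hN) mulr0.
  by rewrite /pexp big1_seq // => v /andP[_ /nseqP [-> _]]; rewrite expv0.
have N0 : 0 < N g by rewrite lt_neqAle eq_sym g0 (hnorm_ge0 hN).
pose t := N g; have t0 : t != 0 by [].
have Gd : G (dilation t^-1 g) by exact: free_group_dilation.
have Nd : N (dilation t^-1 g) <= 1.
  by rewrite (hnorm_dilation hN) // -/t ger0_norm ?mulVf // invr_ge0 ltW.
have [h [vs [s1 s2 s3]] hg] := H _ Gd Nd.
have hE : h = dilation t^-1 g.
  have Gh : G h by rewrite -s3; exact: pexp_group.
  move: hg => /ord_big /(_ (ltnSn m)) /eqP; rewrite subr_eq0 => /eqP e.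
  rewrite -[LHS]mulr1 -e mulrA mulrV ?mul1r //; exact: free_group_unit.
exists (map (fun v => t *: v) vs); split; first by rewrite size_map.
  move=> _ /mapP[v vvs ->]; rewrite hnorm_expvZ gtr0_norm // mulrC.
  by apply: ler_wpM2r; [exact: ltW|exact: s2].
have -> : g = dilation t h by rewrite hE dilation_dilation mulfV // dilation1l.
rewrite -s3 /pexp big_map (big_morph _ (dilationM t) (dilation1 V m t)).
by apply: eq_bigr => v _; rewrite dilation_expv.
Qed.

End Chow.

(** * Signatures of smooth paths *)

Section CoordContinuous.
Variables (R : realType) (V : finNormedModType R).
Implicit Types (v : V).

Lemma vcoord_sum v : v = \sum_i vcoord i v *: (vbasis {:V})`_i.
Proof. exact: coord_vbasis (memvf v). Qed.

Lemma vcoordB i v u : vcoord i (v - u) = vcoord i v - vcoord i u.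
Proof. by rewrite /vcoord linearB. Qed.

(** Equivalence of norms: F is linear, continuous and injective, so |F x| has a positive lower bound
    c on the unit sphere, and homogeneity gives K = 1 / c. *)
Lemma vcoord_bounded i : exists2 K : R, 0 < K & forall v, `|vcoord i v| <= K * `|v|.
Proof.
pose F (x : 'rV[R]_(\dim {:V})) : V := \sum_i x 0 i *: (vbasis {:V})`_i.
have Fc : continuous F.
  apply: continuous_big => [|j _]; first exact: add_continuous.
  move=> x; have xj : (fun y : 'rV[R]_(\dim {:V}) => y 0 j) @ x --> x 0 j by exact: coord_continuous.
  exact: (@cvgZr_tmp _ _ _ (nbhs x) (nbhs_filter x) _ _ _ xj).
have FZ (t : R) x : F (t *: x) = t *: F x.
  by rewrite /F scaler_sumr; apply: eq_bigr => j _; rewrite mxE scalerA.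
have F0 x : F x = 0 -> x = 0.
  move=> Fx; apply/rowP => j; rewrite mxE.
  have := coord_sum_free (x 0) j (basis_free (vbasisP {:V})).
  by rewrite -/(F x) Fx linear0.
pose S := [set x : 'rV[R]_(\dim {:V}) | `|x| = 1].
have [c c0 cP] : exists2 c : R, 0 < c & forall x, S x -> c <= `|F x|.
  have [Se|/set0P Sn] := eqVneq S set0; first by exists 1 => // x; rewrite Se.
  have cS : compact S.
    apply: bounded_closed_compact.
      by exists 1; split => // M M1 x /= ->; exact: ltW.
    rewrite (_ : S = (fun x => `|x|) @^-1` [set 1]) //.
    by apply: (continuous_closedP _).1 => [x|]; [exact: norm_continuous|exact: closed_eq].
  have cF : {within S, continuous (fun x => `|F x|)}.
    apply: continuous_subspaceT => x.
    exact: (cvg_comp F Num.norm (Fc x) (@norm_continuous _ _ (F x))).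
  have [x /set_mem Sx xmin] := compact_EVT_min Sn cS cF.
  exists `|F x|; last by move=> y Sy; apply: xmin; rewrite inE.
  rewrite normr_gt0; apply/eqP => /F0 x0; move: Sx; rewrite /S /= x0 normr0 => /eqP.
  by rewrite eq_sym oner_eq0.
exists c^-1; first by rewrite invr_gt0.
move=> v; pose x : 'rV[R]_(\dim {:V}) := \row_j vcoord j v.
have Fx : F x = v by rewrite [RHS]vcoord_sum; apply: eq_bigr => j _; rewrite mxE.
apply: (@le_trans _ _ `|x|).
  rewrite (_ : `|x| = mx_norm x) // mx_normrE.
  pose ij : 'I_1 * 'I_(\dim {:V}) := (0, i).
  have -> : `|vcoord i v| = `|x ij.1 ij.2| by rewrite /= mxE.
  exact: (le_bigmax _ (fun ij => `|x ij.1 ij.2|) ij).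
have [->|x0] := eqVneq x 0; first by rewrite normr0 mulr_ge0 // invr_ge0 ltW.
rewrite mulrC ler_pdivlMr // mulrC -Fx.
have nx : 0 < `|x| by rewrite normr_gt0.
have Sx : S (`|x|^-1 *: x) by rewrite /S /= normrZ normfV normr_id mulVf ?gt_eqF.
have := cP _ Sx; rewrite FZ normrZ normfV normr_id.
by rewrite [_ * `|F x|]mulrC ler_pdivlMr // mulrC.
Qed.

Lemma vcoord_continuous i : continuous (@vcoord R V i).
Proof.
have [K K0 H] := vcoord_bounded i.
move=> v; apply/cvgrPdist_lt => e e0; near=> u.
rewrite -vcoordB; apply: (le_lt_trans (H _)).
rewrite mulrC -ltr_pdivlMr //; near: u; apply: cvgr_dist_lt => //.
by rewrite divr_gt0.
Unshelve. all: by end_near. Qed.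

End CoordContinuous.

(** * Primitives on [0, 1] *)

Section Primitive.
Variable R : realType.
Implicit Types (F f : R -> R).

(** Differentiability is asked for only inside: a smooth path agrees with a smooth function on
    [0, 1] only, which leaves its derivative at the end points undetermined. *)
Definition primitive01 F f : Prop :=
  {within `[0, 1], continuous F} /\
  forall t : R, t \in `]0, 1[ -> is_derive t (1 : R) F (f t).

Lemma eq_primitive01 F f1 f2 : {in `]0, 1[, f1 =1 f2} -> primitive01 F f1 -> primitive01 F f2.
Proof. by move=> e [c D]; split=> // t t01; rewrite -e //; exact: D. Qed.

Lemma primitive01_cst (c : R) : primitive01 (fun=> c) (fun=> 0).
Proof.
split; first by apply: continuous_subspaceT => x; exact: cvg_cst.
by move=> t _; exact: is_derive_cst.
Qed.

Lemma primitive01D F G f g : primitive01 F f -> primitive01 G g ->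
  primitive01 (fun t => F t + G t) (fun t => f t + g t).
Proof.
move=> [cF dF] [cG dG]; split; first by move=> t; apply: cvgD; [exact: cF|exact: cG].
by move=> t t01; apply: is_deriveD; [exact: dF|exact: dG].
Qed.

Lemma primitive01M F G f g : primitive01 F f -> primitive01 G g ->
  primitive01 (fun t => F t * G t) (fun t => f t * G t + F t * g t).
Proof.
move=> [cF dF] [cG dG]; split; first by move=> t; apply: cvgM; [exact: cF|exact: cG].
move=> t t01; have Ft := dF t t01; have Gt := dG t t01.
apply: (is_derive_eq (is_deriveM Ft Gt)).
by rewrite addrC /= mulrC; congr (_ + _).
Qed.

Lemma primitive01_sum (I : Type) (r : seq I) (P : pred I) (F f : I -> R -> R) :
  (forall i, P i -> primitive01 (F i) (f i)) ->
  primitive01 (fun t => \sum_(i <- r | P i) F i t) (fun t => \sum_(i <- r | P i) f i t).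
Proof.
move=> H; elim: r => [|i r IH].
  under eq_fun do rewrite big_nil; under [X in primitive01 _ X]eq_fun do rewrite big_nil.
  exact: primitive01_cst.
under eq_fun do rewrite big_cons; under [X in primitive01 _ X]eq_fun do rewrite big_cons.
by case: (boolP (P i)) => // Pi; apply: primitive01D => //; exact: H.
Qed.

Lemma primitive01_0 F : primitive01 F (fun=> 0) -> forall t, 0 <= t <= 1 -> F t = F 0.
Proof.
move=> [cF dF] t /andP[t0 t1]; have [->//|tn0] := eqVneq t 0.
have tgt0 : 0 < t by rewrite lt_neqAle eq_sym tn0.
have dF0 (x : R) : x \in `]0, t[ -> is_derive x (1 : R) F 0.
  by move=> /[!in_itv]/= /andP[x0 xt]; apply: dF; rewrite in_itv /= x0 (lt_le_trans xt).
have cF0 : {within `[0, t], continuous F}.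
  apply: continuous_subspaceW cF => x /=; rewrite !in_itv /= => /andP[-> xt].
  exact: le_trans xt t1.
have [x _] := MVT tgt0 dF0 cF0.
by rewrite mul0r => /eqP; rewrite subr_eq0 => /eqP.
Qed.

Lemma primitive01_integral f : {within `[0, 1], continuous f} ->
  primitive01 (fun t => \int[lebesgue_measure]_(u in `]0, t[) f u) f.
Proof.
move=> cf.
have fi : lebesgue_measure.-integrable `[0 : R, 1] (EFin \o f).
  by apply: continuous_compact_integrable => //; exact: segment_compact.
(* Iterated integrals run over open intervals, the fundamental theorem over closed ones; the end
   points are null sets. *)
have intE t : 0 <= t <= 1 -> \int[lebesgue_measure]_(u in `]0, t[) f u =
    \int[lebesgue_measure]_(u in `[0, t]) f u.
  move=> /andP[t0 t1].
  have ft (a b : bool) : lebesgue_measure.-integrable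
      [set` Interval (BSide a (0 : R)) (BSide b t)] (EFin \o f).
    apply: (integrableS _ _ _ fi) => //.
    move=> x /=; rewrite !in_itv /= => /andP[xa xb].
    apply/andP; split; first by move: xa; case: (a) => //= /ltW.
    by apply: le_trans t1; move: xb; case: (b) => //= /ltW.
  by rewrite Rintegral_itv_bndo_bndc ?Rintegral_itv_obnd_cbnd.
split.
  have := parameterized_integral_continuous ler01 fi.
  apply: subspace_eq_continuous => t /=; rewrite inE /= in_itv /= => t01.
  by rewrite /from_subspace /parameterized_integral intE.
move=> t /[!in_itv]/= /andP[t0 t1].
have [D E] : derivable (fun x : R => \int[lebesgue_measure]_(u in `[0, x]) f u) t 1 /\
    derive1 (fun x : R => \int[lebesgue_measure]_(u in `[0, x]) f u) t = f t.
  apply: (@continuous_FTC1_closed _ f 0 t 1) => //.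
  have [cf' _ _] := (continuous_within_itvP f ltr01).1 cf.
  by apply: cf'; rewrite in_itv /= t0.
apply: (@near_eq_is_derive _ _ _ (fun x : R => \int[lebesgue_measure]_(u in `[0, x]) f u)).
- have : t \in `]0, 1[ by rewrite in_itv /= t0.
  move=> /near_in_itvoo; apply: filterS => x /[!in_itv]/= /andP[x0 x1].
  by rewrite intE // !ltW.
- apply: (DeriveDef D); rewrite -derive1E; exact: E.
Qed.

End Primitive.

(** * Linear equations X' = X y in the tensor algebra *)

Section TensorPrimitive.
Variables (R : realType) (d m : nat).
Local Notation T := (tensor_alg R d m).
Implicit Types (X Y : R -> T).

Definition tprimitive X (X' : R -> T) : Prop :=
  forall w, primitive01 (fun t => X t w) (fun t => X' t w).

Lemma eq_tprimitive X X1 X2 : {in `]0, 1[, X1 =1 X2} -> tprimitive X X1 -> tprimitive X X2.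
Proof. by move=> e H w; apply: eq_primitive01 (H w) => t t01; rewrite e. Qed.

Lemma tprimitive_cst (a : T) : tprimitive (fun=> a) (fun=> 0).
Proof. by move=> w; exact: primitive01_cst. Qed.

Lemma tprimitiveD X Y (X' Y' : R -> T) : tprimitive X X' -> tprimitive Y Y' ->
  tprimitive (fun t => X t + Y t) (fun t => X' t + Y' t).
Proof. by move=> HX HY w; exact: primitive01D. Qed.

Lemma tprimitiveM X Y (X' Y' : R -> T) : tprimitive X X' -> tprimitive Y Y' ->
  tprimitive (fun t => X t * Y t) (fun t => X' t * Y t + X t * Y' t).
Proof.
move=> HX HY w; under eq_fun do rewrite tensME.
under [X in primitive01 _ X]eq_fun do rewrite tensDE !tensME -big_split.
by apply: primitive01_sum => k _; exact: primitive01M.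
Qed.

Lemma tprimitive_sum (I : Type) (r : seq I) (P : pred I) (X X' : I -> R -> T) :
  (forall i, P i -> tprimitive (X i) (X' i)) ->
  tprimitive (fun t => \sum_(i <- r | P i) X i t) (fun t => \sum_(i <- r | P i) X' i t).
Proof.
move=> H w; under eq_fun do rewrite tens_sumE.
under [X in primitive01 _ X]eq_fun do rewrite tens_sumE.
by apply: primitive01_sum => i Pi; exact: H.
Qed.

Lemma tprimitiveZ (f f' : R -> R) (a : T) : primitive01 f f' ->
  tprimitive (fun t => f t *: a) (fun t => f' t *: a).
Proof.
move=> ff' w; have := primitive01M ff' (primitive01_cst (a w)).
by apply: eq_primitive01 => t _; rewrite mulr0 addr0.
Qed.

Lemma tprimitiveN X (X' : R -> T) : tprimitive X X' -> tprimitive (fun t => - X t) (fun t => - X' t).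
Proof.
move=> H w; have := primitive01M (primitive01_cst (-1)) (H w).
have -> : (fun t => -1 * X t w) = (fun t => (- X t) w) by apply/funext => t; rewrite mulN1r.
by apply: eq_primitive01 => t _; rewrite mul0r add0r mulN1r.
Qed.

Lemma tprimitive_dynkin X (X' : R -> T) : tprimitive X X' ->
  tprimitive (fun t => dynkin_map (X t)) (fun t => dynkin_map (X' t)).
Proof. by move=> H; apply: tprimitive_sum => w _; apply: tprimitiveZ; exact: H. Qed.

Lemma tprimitive_deg X (X' : R -> T) : tprimitive X X' ->
  tprimitive (fun t => deg (X t)) (fun t => deg (X' t)).
Proof.
move=> H w; have := primitive01M (primitive01_cst (size w)%:R) (H w).
by apply: eq_primitive01 => t _; rewrite mul0r add0r.
Qed.

(** Only the splitting before the last letter meets degree 1; this makes an equation X' = X y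
    triangular in the length of words. *)
Lemma tensM_hom1 (a b : T) (s : seq 'I_d) (i : 'I_d) (w : m.-bseq 'I_d) :
  hom 1 b -> val w = rcons s i ->
  (a * b) w = a (insub_bseq m s) * b (insub_bseq m [:: i]).
Proof.
move=> hb ws; have e1 : take (size s) w = s.
  by rewrite [bseqval w]ws -cats1 take_size_cat.
have e2 : drop (size s) w = [:: i].
  by rewrite [bseqval w]ws -cats1 drop_size_cat.
have sz : size w = (size s).+1 by rewrite [size w](_ : _ = size (val w)) // ws size_rcons.
have sw : (size s < (size w).+1)%N by rewrite sz ltnW.
rewrite tensME (bigD1 (Ordinal sw)) //= e1 e2 big1 ?addr0 // => k /eqP ks.
rewrite hb ?mulr0 // size_insub_drop; apply/eqP => k1; apply: ks; apply: val_inj => /=.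
have kw : (k <= size w)%N by rewrite -ltnS.
by apply: succn_inj; rewrite -[RHS]sz -[RHS](subnKC kw) k1 addn1.
Qed.

Lemma dynkin_el_hom1 (b : T) : hom 1 b -> dynkin_el b.
Proof.
move=> hb; rewrite (base_sum b); elim/big_ind: _ => [|x y dx dy|w _].
- exact: dynkin_el0.
- by rewrite -[x]scale1r; exact: dynkin_el_lin.
- have [w1|w1] := eqVneq (size w) 1%N; last by rewrite hb // scale0r; exact: dynkin_el0.
  rewrite -[_ *: _]addr0; apply: dynkin_el_lin; last exact: dynkin_el0.
  by case: w w1 => -[|i [|]] // ? _; exact: dynkin_el_base.
Qed.

(** Induction on the length of w: the derivative of Z_w involves Z only at w without its last
    letter, where Z is already 0, so Z_w is constant. *)
Lemma tprimitive_unique0 Z y : (forall t, hom 1 (y t)) -> Z 0 = 0 ->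
  tprimitive Z (fun t => Z t * y t) -> forall t, 0 <= t <= 1 -> Z t = 0.
Proof.
move=> hy Z0 ZZ t t01; apply: tens_ext => w.
have [n] := ubnP (size w); elim: n w t t01 => // n IH w t t01 wn.
have ZZw : primitive01 (fun t => Z t w) (fun=> 0).
  apply: eq_primitive01 (ZZ w) => u /[!in_itv]/= /andP[u0 u1].
  case/lastP ws : (val w) => [|s i].
    have sw : (size w < 1)%N by rewrite [size w](_ : _ = size (val w)) // ws.
    exact: (@ordM _ _ _ 0 1 _ _ (@ord0 _ _ _ _) (hom_ord (hy u)) w sw).
  rewrite (tensM_hom1 _ (hy u) ws) IH ?mul0r ?(ltW u0) ?(ltW u1) //.
  have sz : size w = (size s).+1 by rewrite [size w](_ : _ = size (val w)) // ws size_rcons.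
  by rewrite (leq_ltn_trans (size_insub_bseq _ _)) // -ltnS -sz.
by rewrite (primitive01_0 ZZw t01) Z0.
Qed.

Lemma tprimitive_unique X Y y : (forall t, hom 1 (y t)) -> X 0 = Y 0 ->
  tprimitive X (fun t => X t * y t) -> tprimitive Y (fun t => Y t * y t) ->
  forall t, 0 <= t <= 1 -> X t = Y t.
Proof.
move=> hy XY0 HX HY t t01; apply/eqP; rewrite -subr_eq0; apply/eqP.
apply: (@tprimitive_unique0 (fun t => X t - Y t) y) => //; first by rewrite XY0 subrr.
have := tprimitiveD HX (tprimitiveN HY).
by apply: eq_tprimitive => u _; rewrite mulrBl.
Qed.

(* With r the Dynkin map and D the degree derivation, Z = D X - X r(X) again
   solves Z' = Z y. *)
Lemma tprimitive_dynkin_grp X y : (forall t, hom 1 (y t)) -> X 0 = 1 ->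
  tprimitive X (fun t => X t * y t) -> forall t, 0 <= t <= 1 -> dynkin_grp (X t).
Proof.
move=> hy X0 HX t t01.
have X1 u : 0 <= u <= 1 -> ord 1 (X u - 1).
  move=> u01; apply/ord1P; rewrite /tscalar tensBE.
  have Xb : primitive01 (fun t => X t [bseq]) (fun=> 0).
    apply: eq_primitive01 (HX [bseq]) => v _.
    by apply: (@ordM _ _ _ 0 1) => //; apply: hom_ord.
  by rewrite (primitive01_0 Xb u01) X0 subrr.
split.
  by move/ord1P: (X1 t t01); rewrite /tscalar tensBE => /eqP; rewrite subr_eq0 => /eqP ->.
apply/eqP; rewrite -subr_eq0; apply/eqP.
apply: (@tprimitive_unique0 (fun t => deg (X t) - X t * dynkin_map (X t)) y) => //.
  by rewrite X0 deg1 dynkin1 mulr0 subrr.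
have := tprimitiveD (tprimitive_deg HX) (tprimitiveN (tprimitiveM HX (tprimitive_dynkin HX))).
apply: eq_tprimitive => u /[!in_itv]/= /andP[u0 u1].
have [_ ry dy] := dynkin_el_hom1 (hy u).
(* The commutator rule applies to X - 1, which has no scalar part; the remaining 1 contributes r(y)
   = D y = y. *)
have -> : dynkin_map (X u * y u) = dynkin_map (X u) * y u - y u * dynkin_map (X u) + y u.
  rewrite -{1}(subrK 1 (X u)) mulrDl mul1r dynkinD dy (deg_hom (hy u)) scale1r.
  rewrite ry; last by apply: X1; rewrite !ltW.
  by rewrite dynkinB dynkin1 subr0.
rewrite degM (deg_hom (hy u)) scale1r !(mulrBl, mulrBr, mulrDr) !mulrA.
tens_ring.
Qed.

End TensorPrimitive.

(** * Signatures as solutions of S' = S dy *)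

Section Signature.
Variables (R : realType) (V : finNormedModType R) (m : nat).
Local Notation d := (\dim {:V}).
Local Notation T := (tensor_alg R d m).
Local Notation G := (@free_group R V m).
Implicit Types (y : R -> V) (v : V) (s : seq 'I_d).

Lemma eq_primitive01l (F1 F2 f : R -> R) : (forall t, 0 <= t <= 1 -> F1 t = F2 t) ->
  primitive01 F1 f -> primitive01 F2 f.
Proof.
move=> e [cF dF]; split.
  apply: subspace_eq_continuous cF => t /=; rewrite inE /= in_itv /= => t01.
  by rewrite /from_subspace e.
move=> t t01; apply: (@near_eq_is_derive _ _ _ F1) (dF t t01).
move: (t01) => /near_in_itvoo; apply: filterS => x /[!in_itv]/= /andP[x0 x1].
by rewrite e // !ltW.
Qed.

Lemma eq_derive1_01 y (g : R -> V) : (forall t, 0 <= t <= 1 -> y t = g t) ->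
  forall t, t \in `]0, 1[ -> derive1 y t = derive1 g t.
Proof.
move=> e t t01; rewrite !derive1E; apply: near_eq_derive.
move: (t01) => /near_in_itvoo; apply: filterS => x /[!in_itv]/= /andP[x0 x1].
by rewrite e // !ltW.
Qed.

(** Replacing the derivative of y by that of its smooth extension g makes the integrand continuous
    up to the end points and changes nothing inside ]0, 1[. *)
Lemma iterated_int_primitive y : smooth_path y -> forall s,
  primitive01 (iterated_int y 0 s)
    (fun t => if s is i :: s' then iterated_int y 0 s' t * vcoord i (derive1 y t) else 0).
Proof.
move=> [g dg yg]; elim=> [|i s IH]; first exact: primitive01_cst.
have cg : continuous (fun t => vcoord i (derive1 g t)).
  move=> t; apply: (@continuous_comp _ _ _ (derive1 g)); last exact: vcoord_continuous.
  apply/differentiable_continuous/derivable1_diffP.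
  by have := dg 1%N t; rewrite derive1n1.
have e t : t \in `]0, 1[ -> iterated_int y 0 s t * vcoord i (derive1 g t) =
    iterated_int y 0 s t * vcoord i (derive1 y t).
  by move=> t01; rewrite (eq_derive1_01 yg).
apply: (eq_primitive01 (f1 := fun t => iterated_int y 0 s t * vcoord i (derive1 g t))).
  exact: e.
apply: (eq_primitive01l (F1 := fun t => \int[lebesgue_measure]_(u in `]0, t[)
    (iterated_int y 0 s u * vcoord i (derive1 g u)))).
  move=> t /andP[t0 t1] /=; apply: eq_Rintegral => u /[!inE]/= /[!in_itv]/= /andP[u0 ut].
  by apply: e; rewrite in_itv /= u0 (lt_le_trans ut).
have cgw : {within `[0 : R, 1], continuous (fun t => vcoord i (derive1 g t))}.
  exact: continuous_subspaceT.
by apply: primitive01_integral => t; apply: cvgM; [case: IH => + _; exact|exact: cgw].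
Qed.

Lemma hom_tensor_in v : hom 1 (tensor_in v : T).
Proof. by move=> w; case: w => -[|i [|]]. Qed.

Lemma sig_path0 y : sig_path y 0 = 1 :> T.
Proof.
apply: tens_ext => w; rewrite /sig_path /signature tens1E size_eq0.
rewrite -size_eq0 -size_rev size_eq0; case: (rev w) => [//|i s] /=.
by rewrite set_itv_ge ?Rintegral_set0 // bnd_simp ltxx.
Qed.

(** The last letter of w, the head of [rev w], carries the outermost integral; differentiating
    removes it, just as [tensM_hom1] does on the right-hand side. *)
Lemma sig_path_primitive y : smooth_path y ->
  tprimitive (sig_path y : R -> T) (fun t => sig_path y t * tensor_in (derive1 y t)).
Proof.
move=> sy w; case/lastP ws : (val w) => [|s i].
  have e : primitive01 (fun t => sig_path y t w) (fun=> 0).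
    have := iterated_int_primitive sy [::].
    by apply: eq_primitive01l => t _; rewrite /sig_path /signature [bseqval w]ws.
  apply: eq_primitive01 e => t _; symmetry.
  have sw : (size w < 1)%N by rewrite [size w](_ : _ = size (val w)) // ws.
  exact: (@ordM _ _ _ 0 1 _ _ (@ord0 _ _ _ _) (hom_ord (@hom_tensor_in _)) w sw).
have sz : size w = (size s).+1 by rewrite [size w](_ : _ = size (val w)) // ws size_rcons.
have sm : (size s < m)%N by rewrite -sz size_bseq.
have := iterated_int_primitive sy (i :: rev s).
have e : (fun t => sig_path y t w) = iterated_int y 0 (i :: rev s).
  by apply/funext => t; rewrite /sig_path /signature [bseqval w]ws rev_rcons.
rewrite e; apply: eq_primitive01 => t _.
rewrite (tensM_hom1 _ (@hom_tensor_in _) ws) /sig_path /signature.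
rewrite insub_bseqE; last exact: ltnW.
by rewrite /tensor_in /= insub_bseqE // (leq_ltn_trans _ sm).
Qed.

Lemma sig_path_group y : smooth_path y -> forall t, 0 <= t <= 1 -> G (sig_path y t).
Proof.
move=> sy t t01; apply/free_groupP.
apply: (tprimitive_dynkin_grp (y := fun t => tensor_in (derive1 y t))) t01.
- by move=> u; exact: hom_tensor_in.
- exact: sig_path0.
- exact: sig_path_primitive.
Qed.

Lemma sig_path_unique y (Z : R -> T) : smooth_path y -> Z 0 = 1 ->
  tprimitive Z (fun t => Z t * tensor_in (derive1 y t)) ->
  forall t, 0 <= t <= 1 -> sig_path y t = Z t.
Proof.
move=> sy Z0 HZ; apply: (tprimitive_unique (y := fun t => tensor_in (derive1 y t))) => //.
- by move=> u; exact: hom_tensor_in.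
- by rewrite sig_path0 Z0.
- exact: sig_path_primitive.
Qed.

End Signature.

(** * Derivatives of products of exponentials *)

Section ExpProduct.
Variables (R : realType) (d m : nat).
Local Notation T := (tensor_alg R d m).

Lemma primitive01X (f f' : R -> R) n : primitive01 f f' ->
  primitive01 (fun t => f t ^+ n) (fun t => n%:R * f t ^+ n.-1 * f' t).
Proof.
move=> H; elim: n => [|n IH].
  have := primitive01_cst (1 : R).
  by apply: eq_primitive01 => t _; rewrite !mul0r.
have := primitive01M H IH.
have -> : (fun t => f t * f t ^+ n) = (fun t => f t ^+ n.+1).
  by apply/funext => t; rewrite exprS.
apply: eq_primitive01 => t _ /=; rewrite -natr1.
by case: n {IH} => [|n]; rewrite ?exprS /=; ring.
Qed.

Lemma tprimitive_texp (f f' : R -> R) (b : T) : ord 1 b -> primitive01 f f' ->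
  tprimitive (fun t => texp (f t *: b)) (fun t => texp (f t *: b) * (f' t *: b)).
Proof.
move=> b1 ff'.
pose c (k : 'I_m.+1) t := (k`!%:R)^-1 * f t ^+ k.
have cp k : primitive01 (c k) (fun t => (k`!%:R)^-1 * (k%:R * f t ^+ k.-1 * f' t)).
  have := primitive01M (primitive01_cst (k`!%:R)^-1) (primitive01X k ff').
  by apply: eq_primitive01 => t _; rewrite mul0r add0r.
have := tprimitive_sum (index_enum 'I_m.+1) (P := xpredT)
  (fun (k : 'I_m.+1) _ => tprimitiveZ (b ^+ k : T) (cp k)).
have -> : (fun t => \sum_k c k t *: (b ^+ k : T)) = (fun t => texp (f t *: b)).
  by apply/funext => t; apply: eq_bigr => k _; rewrite exprZn scalerA.
apply: eq_tprimitive => t _; rewrite /texp.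
rewrite [LHS]big_ord_recl /= mul0r mul0r mulr0 scale0r add0r.
(* After the index shift the sums differ by the top term, which contains b^(m + 1) = 0. *)
rewrite mulr_suml big_ord_recr /= exprZn -!scalerAl -!scalerAr.
rewrite -exprSr (exp_nilp b1) // !scaler0 addr0.
apply: eq_bigr => k _; rewrite /bump /= add1n exprZn -!scalerAl -!scalerAr -exprSr !scalerA.
congr (_ *: _); rewrite factS natrM.
have k0 : k.+1%:R != 0 :> R by rewrite pnatr_eq0.
rewrite [LHS](_ : _ = k.+1%:R * f t ^+ k / (k.+1%:R * k`!%:R) * f' t) //.
by rewrite invfM mulrACA mulfV // mul1r [f t ^+ k * _]mulrC.
Qed.

(** While factor j moves, every later factor is still exp(0) = 1, so the derivative of factor j can
    be carried past them to the right end. *)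
Lemma tprimitive_texp_prod (M : nat) (f f' : nat -> R -> R) (b : nat -> T) :
  (forall j, ord 1 (b j)) -> (forall j, primitive01 (f j) (f' j)) ->
  (forall j l t, (j < l)%N -> t \in `]0, 1[ -> f' j t = 0 \/ f l t = 0) ->
  tprimitive (fun t => \prod_(j < M) texp (f j t *: b j))
    (fun t => \prod_(j < M) texp (f j t *: b j) * \sum_(j < M) f' j t *: b j).
Proof.
move=> b1 ff' H; elim: M => [|M IH].
  have -> : (fun t => \prod_(j < 0) texp (f j t *: b j)) = (fun=> 1 : T).
    by apply/funext => t; rewrite big_ord0.
  by apply: eq_tprimitive (tprimitive_cst 1) => t _; rewrite !big_ord0 mulr0.
have -> : (fun t => \prod_(j < M.+1) texp (f j t *: b j)) =
    (fun t => \prod_(j < M) texp (f j t *: b j) * texp (f M t *: b M)).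
  by apply/funext => t; rewrite big_ord_recr.
have := tprimitiveM IH (tprimitive_texp (b1 M) (ff' M)).
apply: eq_tprimitive => t t01; rewrite !big_ord_recr /= mulrDr !mulrA; congr (_ + _).
rewrite -!mulrA; congr (_ * _); rewrite mulr_suml mulr_sumr; apply: eq_bigr => j _.
have [->|->] := H j M t (ltn_ord j) t01; first by rewrite scale0r mulr0 mul0r.
by rewrite scale0r texp0 mulr1 mul1r.
Qed.

End ExpProduct.

(** * Smooth paths through prescribed products of exponentials *)

Section NDifferentiable.
Variables (R : realType).

(** The recursion takes the first derivative first, so that sums, products and inverses go by
    induction on n over all functions. *)
Fixpoint ndiff (V : normedModType R) n (f : R -> V) : Prop :=
  if n is n'.+1 then (forall t, derivable f t 1) /\ ndiff n' (derive1 f) else True.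

Variable V : normedModType R.
Implicit Types (f g : R -> V).

Lemma ndiffS n f df : (forall t : R, is_derive t (1 : R) f (df t)) -> ndiff n df -> ndiff n.+1 f.
Proof.
move=> fdf ndf; split; first by move=> t; case: (fdf t).
rewrite (_ : derive1 f = df) //; apply/funext => t.
by rewrite derive1E; case: (fdf t).
Qed.

Lemma ndiff_derive n f t : ndiff n.+1 f -> is_derive t (1 : R) f (derive1 f t).
Proof. by move=> [df _]; rewrite derive1E; apply: derivableP. Qed.

Lemma ndiffW n f : ndiff n.+1 f -> ndiff n f.
Proof. by elim: n f => // n IH f [df /IH]. Qed.

Lemma ndiff_derivable f : (forall n, ndiff n f) ->
  forall n t, derivable (derive1n n f) t 1.
Proof.
move=> sf n; have {sf} := sf n.+1; elim: n f => [|n IH] f [df nf] t.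
  exact: df.
by rewrite derive1Sn; apply: IH.
Qed.

Lemma ndiff_cst n (v : V) : ndiff n (fun=> v).
Proof.
elim: n v => [//|n IH] v; apply: (@ndiffS n _ (fun=> 0)); exact: IH.
Qed.

Lemma ndiffD n f g : ndiff n f -> ndiff n g -> ndiff n (fun t => f t + g t).
Proof.
elim: n f g => [//|n IH] f g nf ng.
apply: (@ndiffS n _ (fun t => derive1 f t + derive1 g t)).
  by move=> t; exact: (is_deriveD (ndiff_derive t nf) (ndiff_derive t ng)).
by apply: IH; [case: nf|case: ng].
Qed.

Lemma ndiff_sum (I : Type) (r : seq I) (P : pred I) n (F : I -> R -> V) :
  (forall i, ndiff n (F i)) -> ndiff n (fun t => \sum_(i <- r | P i) F i t).
Proof.
move=> H; elim: r => [|i r IH].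
  rewrite (_ : (fun t => _) = (fun=> 0)); first exact: ndiff_cst.
  by apply/funext => t; rewrite big_nil.
have [Pi|Pi] := boolP (P i); last first.
  rewrite (_ : (fun t => _) = (fun t => \sum_(i <- r | P i) F i t)) //.
  by apply/funext => t; rewrite big_cons (negbTE Pi).
rewrite (_ : (fun t => _) = (fun t => F i t + \sum_(i <- r | P i) F i t)).
  exact: ndiffD.
by apply/funext => t; rewrite big_cons Pi.
Qed.

End NDifferentiable.

Section ScaleVector.
Variables (R : realType) (V : normedModType R).
Implicit Types (a : R -> R).

Lemma is_derive_scalel a (v : V) (t da : R) :
  is_derive t (1 : R) a da -> is_derive t (1 : R) (fun t => a t *: v) (da *: v).
Proof.
move=> [ad adE].
have H : h^-1 *: (a (h *: 1 + t) *: v - a t *: v) @[h --> 0^'] --> da *: v.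
  have e : (fun h => h^-1 *: (a (h *: 1 + t) *: v - a t *: v)) =
      (fun h => (h^-1 *: (a (h *: 1 + t) - a t)) *: v).
    by apply/funext => h; rewrite -scalerBl scalerA.
  rewrite e; apply: cvgZr_tmp; rewrite -adE; exact: ad.
by apply: DeriveDef; [apply/cvg_ex; exists (da *: v)|exact: cvg_lim H].
Qed.

Lemma ndiff_scalel n a (v : V) : ndiff n a -> ndiff n (fun t => a t *: v).
Proof.
elim: n a => [//|n IH] a na; apply: (@ndiffS R V n _ (fun t => derive1 a t *: v)).
  by move=> t; exact: (is_derive_scalel v (ndiff_derive t na)).
by apply: IH; case: na.
Qed.

End ScaleVector.

(** * A smooth step function *)

Section SmoothStep.
Variable R : realType.
Implicit Types (f g : R -> R) (t x : R).

Lemma ndiffM n f g : ndiff n f -> ndiff n g -> ndiff n (fun t => f t * g t).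
Proof.
elim: n f g => [//|n IH] f g nf ng.
apply: (@ndiffS R R n _ (fun t => f t * derive1 g t + g t * derive1 f t)).
  by move=> t; exact: (is_deriveM (ndiff_derive t nf) (ndiff_derive t ng)).
apply: ndiffD; apply: IH; [exact: ndiffW|by case: ng|exact: ndiffW|by case: nf].
Qed.

Lemma ndiffV n f : (forall t, f t != 0) -> ndiff n f -> ndiff n (fun t => (f t)^-1).
Proof.
move=> f0; elim: n f f0 => [//|n IH] f f0 nf.
apply: (@ndiffS R R n _ (fun t => (-1) * ((f t)^-1 * (f t)^-1 * derive1 f t))).
  move=> t; have [ft fE] := ndiff_derive t nf.
  apply: DeriveDef; first exact: derivableV.
  rewrite deriveV // fE mulN1r expr2 invfM; exact: mulNr.
apply: ndiffM; first exact: ndiff_cst.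
apply: ndiffM; last by case: nf.
by apply: ndiffM; apply: IH => //; exact: ndiffW.
Qed.

Lemma is_derive_affine (a b t : R) : is_derive t (1 : R) (fun t => a * t + b) a.
Proof.
apply: (is_derive_eq (is_deriveD (is_deriveZ a (is_derive_id t 1)) (is_derive_cst b t 1))).
by rewrite addr0; exact: mulr1.
Qed.

Lemma ndiff_affine n f (a b : R) : ndiff n f -> ndiff n (fun t => f (a * t + b)).
Proof.
elim: n f => [//|n IH] f nf.
apply: (@ndiffS R R n _ (fun t => a * derive1 f (a * t + b))).
  move=> t; have H := is_derive_affine a b t.
  have := @is_derive1_comp R f (fun t => a * t + b) t _ _ (ndiff_derive _ nf) H.
  by rewrite mulrC.
by apply: ndiffM; [exact: ndiff_cst|apply: IH; case: nf].
Qed.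

(** [flat 0] is the classical exp(-1 / x); the factors x^(-k) make the linear span of the family
    stable under differentiation. *)
Definition flat (k : nat) x : R := if 0 < x then x^-1 ^+ k * expR (- x^-1) else 0.

(** With y = 1 / x this is y^k <= k! exp(y), read off the exponential series. *)
Lemma flat_bound k : exists2 K : R, 0 <= K & forall x, `|flat k x| <= K.
Proof.
exists (k`!%:R) => // x; rewrite /flat; case: ifPn => [x0|_]; last by rewrite normr0.
have y0 : 0 <= x^-1 by rewrite invr_ge0 ltW.
rewrite ger0_norm ?mulr_ge0 ?exprn_ge0 ?expR_ge0 // expRN ler_pdivrMr ?expR_gt0 //.
case: k => [|k]; first by rewrite expr0 fact0 mul1r -expR0 ler_expR.
rewrite mulrC -ler_pdivrMr ?ltr0n ?fact_gt0 //.
by apply: le_trans (expR_ge1Dxn k y0); rewrite lerDr.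
Qed.

Lemma flatS k x : x != 0 -> flat k.+1 x = x^-1 * flat k x.
Proof. by move=> x0; rewrite /flat; case: ifP => _; rewrite ?mulr0 // exprS mulrA. Qed.

Lemma is_derive_flat k x : is_derive x (1 : R) (flat k) (flat k.+2 x - k%:R * flat k.+1 x).
Proof.
have [x0|x0|x0] := ltgtP x 0.
- rewrite {2 3}/flat ltNge ltW //= mulr0 subr0.
  have D0 : is_derive x (1 : R) (fun=> 0 : R) 0 by exact: is_derive_cst.
  apply: near_eq_is_derive D0; near=> z.
  by rewrite /flat ifF //; apply/negbTE; rewrite -leNgt ltW //; near: z; exact: lt_nbhsl.
- have xn0 : x != 0 by rewrite gt_eqF.
  have Dinv : is_derive x (1 : R) (fun z : R => z^-1) (- (x^-1 * x^-1)).
    apply: DeriveDef; first exact: derivableV.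
    by rewrite deriveV // derive_id expr2 invfM; exact: mulr1.
  have Dexp : is_derive x (1 : R) (fun z : R => expR (- z^-1)) (expR (- x^-1) * (x^-1 * x^-1)).
    have := @is_derive1_comp R expR (fun z => - z^-1) x _ _ (is_derive_expR _) (is_deriveN Dinv).
    by rewrite opprK.
  have D : is_derive x (1 : R) (fun z => z^-1 ^+ k * expR (- z^-1))
      (flat k.+2 x - k%:R * flat k.+1 x).
    have Dk := is_deriveX k Dinv; rewrite exprfctE in Dk.
    apply: (is_derive_eq (is_deriveM Dk Dexp)); rewrite /flat x0 /GRing.scale /=.
    by case: (k) => [|l]; rewrite ?exprS /=; ring.
  apply: near_eq_is_derive D; near=> z.
  by rewrite /flat ifT //; near: z; exact: lt_nbhsr.
- rewrite x0.
  have -> : flat k.+2 0 - k%:R * flat k.+1 0 = 0 by rewrite /flat ltxx mulr0 subrr.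
  (* The difference quotient at 0 is flat k h / h = h flat (k + 2) h, whose second factor is
     bounded. *)
  have [K K0 HK] := flat_bound k.+2.
  have H : h^-1 *: (flat k (h *: (1 : R) + 0) - flat k 0) @[h --> 0^'] --> 0.
    apply/cvgr0Pnorm_le => e e0; near=> h.
    have h0 : h != 0 by near: h; exact: nbhs_dnbhs_neq.
    rewrite {2}/flat ltxx subr0 addr0 (_ : h *: (1 : R) = h) ?[_ *: (1 : R)]mulr1 //.
    have -> : h^-1 *: flat k h = h * flat k.+2 h.
      by rewrite !flatS // [RHS]mulrA mulfV // mul1r.
    rewrite normrM; apply: (@le_trans _ _ (`|h| * (K + 1))).
      by rewrite ler_wpM2l // (le_trans (HK h)) // lerDl.
    rewrite -ler_pdivlMr ?ltr_wpDl //.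
    near: h; apply: dnbhs0_le; rewrite divr_gt0 // ltr_wpDl //.
  by apply: DeriveDef; [apply/cvg_ex; exists 0|exact: cvg_lim H].
Unshelve. all: by end_near. Qed.

Lemma ndiff_flat n k : ndiff n (flat k).
Proof.
elim: n k => [//|n IH] k; apply: (@ndiffS R R n _ (fun x => flat k.+2 x + (- k%:R) * flat k.+1 x)).
  by move=> x; rewrite mulNr; exact: is_derive_flat.
by apply: ndiffD => //; apply: ndiffM => //; exact: ndiff_cst.
Qed.

Lemma flat_gt0 x : 0 < x -> 0 < flat 0 x.
Proof. by move=> x0; rewrite /flat x0 expr0 mul1r expR_gt0. Qed.

Lemma flat_ge0 x : 0 <= flat 0 x.
Proof. by rewrite /flat; case: ifP => // _; rewrite expr0 mul1r expR_ge0. Qed.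

Lemma flat_le0 x : x <= 0 -> flat 0 x = 0.
Proof. by move=> x0; rewrite /flat ltNge x0. Qed.

(** A smooth transition, 0 up to 0 and 1 from 1 on; its derivatives vanish outside ]0, 1[, so
    rescaled copies can follow one another without loss of smoothness. *)
Definition smooth_step x : R := flat 0 x * (flat 0 x + flat 0 (1 - x))^-1.

Lemma smooth_step_den x : 0 < flat 0 x + flat 0 (1 - x).
Proof.
have [x0|x0] := ltP 0 x; first by rewrite ltr_pwDl ?flat_gt0 ?flat_ge0.
rewrite ltr_wpDl ?flat_ge0 // flat_gt0 // subr_gt0; exact: le_lt_trans ltr01.
Qed.

Lemma ndiff_smooth_step n : ndiff n smooth_step.
Proof.
apply: ndiffM; first exact: ndiff_flat.
apply: ndiffV => [t|]; first by rewrite gt_eqF ?smooth_step_den.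
apply: ndiffD; first exact: ndiff_flat.
rewrite (_ : (fun t => flat 0 (1 - t)) = (fun t => flat 0 ((-1) * t + 1))).
  exact/ndiff_affine/ndiff_flat.
by apply/funext => t; rewrite mulN1r addrC.
Qed.

Lemma smooth_step_le0 x : x <= 0 -> smooth_step x = 0.
Proof. by move=> x0; rewrite /smooth_step flat_le0 // mul0r. Qed.

Lemma smooth_step_ge1 x : 1 <= x -> smooth_step x = 1.
Proof.
move=> x1; rewrite /smooth_step [flat 0 (1 - x)]flat_le0 ?subr_le0 // addr0 mulfV //.
by rewrite gt_eqF ?flat_gt0 // (lt_le_trans ltr01).
Qed.

Lemma derive_smooth_step_gt1 x : 1 < x -> derive1 smooth_step x = 0.
Proof.
move=> x1; rewrite derive1E.
have D : is_derive x (1 : R) (fun=> 1 : R) 0 by exact: is_derive_cst.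
have [] // : is_derive x (1 : R) smooth_step 0.
apply: near_eq_is_derive D; near=> z.
by rewrite smooth_step_ge1 // ltW //; near: z; exact: lt_nbhsr.
Unshelve. all: by end_near. Qed.

Lemma smooth_step_lipschitz : exists2 L : R, 0 <= L &
  forall a b, 0 <= a -> a <= b -> b <= 1 -> `|smooth_step b - smooth_step a| <= L * (b - a).
Proof.
have D t : is_derive t (1 : R) smooth_step (derive1 smooth_step t).
  exact: (ndiff_derive t (ndiff_smooth_step 1)).
have cD : continuous (fun t => `|derive1 smooth_step t|).
  have [_ [dD _]] := ndiff_smooth_step 2.
  move=> t; apply: cvg_norm.
  exact/differentiable_continuous/derivable1_diffP/dD.
have [c _ cmax] := EVT_max (@ler01 R) (continuous_subspaceT cD).
exists `|derive1 smooth_step c| => // a b a0 ab b1.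
have cs : {within `[a, b], continuous smooth_step}.
  apply: continuous_subspaceT => t.
  by apply/differentiable_continuous/derivable1_diffP; case: (D t).
have [t /[!in_itv]/= /andP[ta tb] ->] := MVT_segment ab (fun x _ => D x) cs.
rewrite normrM [`|b - a|]ger0_norm; last by rewrite subr_ge0.
apply: ler_wpM2r; first by rewrite subr_ge0.
by apply: cmax; rewrite in_itv /= (le_trans a0 ta) (le_trans tb).
Qed.

End SmoothStep.

(** * The staircase path and its signature *)

Section Stairs.
Variables (R : realType) (V : finNormedModType R) (m : nat).
Local Notation d := (\dim {:V}).
Local Notation T := (tensor_alg R d m).
Local Notation G := (@free_group R V m).
Variable N : T -> R.
Hypothesis hN : homogeneous_norm N.
Variables (M : nat) (v : nat -> V).
Hypothesis M0 : (0 < M)%N.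

Let step (j : nat) (t : R) : R := smooth_step (M%:R * t - j%:R).

(* A smooth path running through v 0, ..., v (M - 1) in turn, one on each of
   the intervals [j / M, (j + 1) / M], coming to rest in between. *)
Definition stairs (t : R) : V := \sum_(j < M) step j t *: v j.

Definition stairs_exp (t : R) : T := \prod_(j < M) expv (step j t *: v j).

Lemma tensor_inD (u w : V) : tensor_in (u + w) = tensor_in u + tensor_in w :> T.
Proof.
rewrite !tensor_inE -big_split; apply: eq_bigr => i _.
by rewrite /vcoord linearD scalerDl.
Qed.

Lemma ndiff_step n j : ndiff n (step j).
Proof. exact: ndiff_affine (ndiff_smooth_step R n). Qed.

Lemma derive_step j t : derive1 (step j) t = M%:R * derive1 (@smooth_step R) (M%:R * t - j%:R).
Proof.
have H := is_derive_affine (M%:R : R) (- j%:R) t.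
have := @is_derive1_comp R _ _ t _ _ (ndiff_derive _ (ndiff_smooth_step R 1)) H.
by move=> [_ e]; rewrite derive1E [LHS]e mulrC.
Qed.

Lemma smooth_stairs : smooth_path stairs.
Proof.
exists stairs => // n t; apply: ndiff_derivable => k.
apply: ndiff_sum => j; exact/ndiff_scalel/ndiff_step.
Qed.

Lemma derive_stairs t : derive1 stairs t = \sum_(j < M) derive1 (step j) t *: v j.
Proof.
have D : is_derive t (1 : R) (\sum_(j < M) (fun t => step j t *: v j))
    (\sum_(j < M) derive1 (step j) t *: v j).
  apply: is_derive_sum => j; apply: is_derive_scalel.
  exact: ndiff_derive (ndiff_step 1 j).
have e : stairs = \sum_(j < M) (fun t => step j t *: v j).
  by apply/funext => u; rewrite fct_sumE.
by rewrite derive1E e; case: D.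
Qed.

Lemma primitive01_derive (f : R -> R) : (forall t, derivable f t 1) ->
  primitive01 f (derive1 f).
Proof.
move=> df; split.
  by apply: continuous_subspaceT => t; apply/differentiable_continuous/derivable1_diffP.
by move=> t _; rewrite derive1E; exact: derivableP.
Qed.

Lemma stairs_exp_primitive :
  tprimitive stairs_exp (fun t => stairs_exp t * tensor_in (derive1 stairs t)).
Proof.
have sE : stairs_exp = fun t => \prod_(j < M) texp (step j t *: (tensor_in (v j) : T)).
  by apply/funext => t; apply: eq_bigr => j _; rewrite /expv tensor_inZ.
have H := @tprimitive_texp_prod R d m M step (fun j t => derive1 (step j) t)
  (fun j => tensor_in (v j)).
rewrite sE; apply: (eq_tprimitive _ (H _ _ _)).
- move=> t _; congr (_ * _); rewrite derive_stairs.
  elim/big_rec2: _ => [|j x y _ ->]; first by rewrite tensor_in0.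
  by rewrite tensor_inD tensor_inZ.
- by move=> j; exact: tensor_in_ord.
- by move=> j; apply: primitive01_derive; case: (ndiff_step 1 j).
(* If M t <= j + 1, factor l has not started since j + 1 <= l; otherwise factor j has finished. *)
move=> j l t jl _; have [h|h] := leP (M%:R * t - j%:R) 1.
  right; apply: smooth_step_le0; rewrite subr_le0; move: h; rewrite lerBlDr => /le_trans; apply.
  by rewrite nat1r ler_nat.
by left; rewrite derive_step derive_smooth_step_gt1 // mulr0.
Qed.

Lemma step_le (j : nat) (t : R) : M%:R * t <= j%:R -> step j t = 0.
Proof. by move=> h; apply: smooth_step_le0; rewrite subr_le0. Qed.

Lemma step_ge (j : nat) (t : R) : j.+1%:R <= M%:R * t -> step j t = 1.
Proof. by move=> h; apply: smooth_step_ge1; rewrite lerBrDl natr1. Qed.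

Definition stairs_node (i : nat) : T := \prod_(j < i) expv (v j).

(** On cell i the earlier factors are complete and the later ones still trivial. *)
Lemma stairs_exp_cell i t : (i < M)%N -> i%:R <= M%:R * t -> M%:R * t <= i.+1%:R ->
  stairs_exp t = stairs_node i * expv (step i t *: v i).
Proof.
move=> iM it ti; rewrite /stairs_exp.
rewrite -(big_mkord xpredT (fun j => expv (step j t *: v j))).
rewrite (big_cat_nat _ (n := i)) ?(ltnW iM) //= (big_ltn iM); congr (_ * _).
  rewrite /stairs_node -(big_mkord xpredT (fun j => expv (v j))).
  apply: eq_big_nat => j /andP[_ ji]; rewrite step_ge ?scale1r //.
  by apply: le_trans it; rewrite ler_nat.
rewrite -[RHS]mulr1; congr (_ * _); apply: big1_seq => j.
rewrite mem_index_iota => /andP[_ /andP[ij _]].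
rewrite step_le ?scale0r ?expv0 //; apply: (le_trans ti).
by rewrite ler_nat.
Qed.

Lemma stairs_exp_node i : (i <= M)%N -> stairs_exp (i%:R / M%:R) = stairs_node i.
Proof.
have Mn0 : M%:R != 0 :> R by rewrite pnatr_eq0 -lt0n.
rewrite leq_eqVlt => /predU1P[->|iM]; last first.
  have Mi : M%:R * (i%:R / M%:R) = i%:R :> R by rewrite mulrCA mulfV // mulr1.
  rewrite (stairs_exp_cell iM); [|by rewrite Mi|by rewrite Mi ler_nat].
  by rewrite step_le ?Mi // scale0r expv0 mulr1.
rewrite divff //; apply: eq_bigr => j _.
by rewrite step_ge ?scale1r // mulr1 ler_nat.
Qed.

Lemma stairs_exp0 : stairs_exp 0 = 1.
Proof. by have := stairs_exp_node (leq0n M); rewrite mul0r /stairs_node big_ord0. Qed.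

Lemma sig_path_stairs t : 0 <= t <= 1 -> sig_path stairs t = stairs_exp t.
Proof.
apply: sig_path_unique; [exact: smooth_stairs|exact: stairs_exp0|].
exact: stairs_exp_primitive.
Qed.

Lemma stairs_exp_group t : G (stairs_exp t).
Proof. by apply: free_group_prod => j _; exact: expv_group. Qed.

Lemma incr_norm_triangle (X : R -> T) (s u t : R) : G (X s) -> G (X u) -> G (X t) ->
  N (incr X s t) <= N (incr X s u) + N (incr X u t).
Proof.
move=> Gs Gu Gt; have -> : incr X s t = incr X s u * incr X u t.
  by rewrite /incr mulrA mulrK //; exact: free_group_unit.
by apply: (hnorm_mul hN); apply: free_groupM => //; exact: free_groupV.
Qed.

Lemma incr_norm_diag (X : R -> T) (s : R) : G (X s) -> N (incr X s s) = 0.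
Proof. by move=> Gs; rewrite /incr mulVr ?(hnorm1 hN) //; exact: free_group_unit. Qed.

(** The common left factor [stairs_node i] cancels and the remaining exponentials of multiples of v
    i combine, leaving the increment of the step function times the norm of exp(v i). *)
Lemma incr_stairs_cell (L : R) i (s t : R) :
  (forall a b, 0 <= a -> a <= b -> b <= 1 -> `|smooth_step b - smooth_step a| <= L * (b - a)) ->
  (i < M)%N -> i%:R <= M%:R * s -> s <= t -> M%:R * t <= i.+1%:R ->
  N (incr stairs_exp s t) <= L * M%:R * (t - s) * N (expv (v i)).
Proof.
move=> HL iM is_ st ti.
have Ms : M%:R * s <= M%:R * t by rewrite ler_wpM2l.
rewrite /incr (stairs_exp_cell iM is_ (le_trans Ms ti)) (stairs_exp_cell iM (le_trans is_ Ms) ti).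
have nu : stairs_node i \is a GRing.unit.
  by apply: free_group_unit; apply: free_group_prod => j _; exact: expv_group.
rewrite invrM ?(free_group_unit (expv_group _ _)) // -mulrA mulKr // -expvN.
rewrite -scaleNr expvD hnorm_expvZ // ler_wpM2r //.
  by apply: (hnorm_ge0 hN); exact: expv_group.
rewrite addrC; apply: le_trans (HL _ _ _ _ _) _.
- by rewrite subr_ge0.
- by rewrite lerD2r.
- by rewrite lerBlDr nat1r.
- rewrite (_ : L * M%:R * (t - s) = L * (M%:R * t - i%:R - (M%:R * s - i%:R))) //.
  ring.
Qed.

(** Induction on b, cutting off the last cell: a Lipschitz bound in time is additive over adjacent
    intervals, so the number of cells does not enter the constant. *)
Lemma incr_stairs (L K : R) (a b : nat) :
  0 <= L -> 0 <= K ->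
  (forall a b, 0 <= a -> a <= b -> b <= 1 -> `|smooth_step b - smooth_step a| <= L * (b - a)) ->
  (b <= M)%N -> (forall i, (a <= i < b)%N -> N (expv (v i)) <= K) ->
  forall s t : R, a%:R <= M%:R * s -> s <= t -> M%:R * t <= b%:R ->
  N (incr stairs_exp s t) <= L * M%:R * K * (t - s).
Proof.
move=> L0 K0 HL; have Mp : 0 < M%:R :> R by rewrite ltr0n.
have GS := stairs_exp_group.
elim: b => [|b IH] bM HK s t as_ st tb.
  have ts : t <= s.
    rewrite -(ler_pM2l Mp); apply: (le_trans tb); apply: le_trans as_.
    exact: ler0n.
  have -> : s = t by apply/eqP; rewrite eq_le st.
  by rewrite incr_norm_diag // subrr mulr0.
have IHb : forall s t : R, a%:R <= M%:R * s -> s <= t -> M%:R * t <= b%:R ->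
    N (incr stairs_exp s t) <= L * M%:R * K * (t - s).
  apply: IH => [|i /andP[ai ib]]; first exact: ltnW.
  by apply: HK; rewrite ai ltnW.
have [tb'|tb'] := leP (M%:R * t) b%:R; first exact: IHb.
have [ab|ba] := leqP a b; last first.
  have ts : t <= s.
    rewrite -(ler_pM2l Mp); apply: (le_trans tb); apply: le_trans as_.
    by rewrite ler_nat.
  have -> : s = t by apply/eqP; rewrite eq_le st.
  by rewrite incr_norm_diag // subrr mulr0.
have cell s' : b%:R <= M%:R * s' -> s' <= t -> N (incr stairs_exp s' t) <= L * M%:R * K * (t - s').
  move=> bs' s't; apply: (le_trans (incr_stairs_cell HL bM bs' s't tb)).
  rewrite mulrAC ler_wpM2r ?subr_ge0 // ler_wpM2l ?mulr_ge0 //.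
  by apply: HK; rewrite ab ltnSn.
have [sb|sb] := leP b%:R (M%:R * s); first exact: cell.
pose c : R := b%:R / M%:R.
have Mc : M%:R * c = b%:R by rewrite /c mulrCA mulfV ?mulr1 // gt_eqF.
have sc : s <= c by rewrite -(ler_pM2l Mp) Mc ltW.
have ct : c <= t by rewrite -(ler_pM2l Mp) Mc ltW.
apply: (le_trans (incr_norm_triangle _ _ _ (u := c))) => //.
rewrite (_ : t - s = (c - s) + (t - c)); last by ring.
rewrite mulrDr; apply: lerD; first by apply: IHb => //; rewrite Mc.
by apply: cell => //; rewrite Mc.
Qed.

End Stairs.

(** * Controls *)

Section Control.
Variables (R : realType) (p : R) (omega : R -> R -> R).
Hypotheses (hp : 1 <= p) (homega : control omega) (hH : cond_H p omega).

Let p0 : 0 < p. Proof. exact: lt_le_trans hp. Qed.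

Lemma control_mono r s t u : 0 <= r -> r <= s -> s <= t -> t <= u -> u <= 1 ->
  omega s t <= omega r u.
Proof.
move=> r0 rs st tu u1.
have ge a b : 0 <= a -> a <= b -> b <= 1 -> 0 <= omega a b by exact: (control_ge0 homega).
have s0 := le_trans r0 rs; have t0 := le_trans s0 st.
have t1 := le_trans tu u1; have s1 := le_trans st t1.
apply: (@le_trans _ _ (omega s u)).
  have [<-|sn] := eqVneq s t; first by rewrite (control_diag homega) ?s0 // ge // (le_trans st).
  have [<-//|tn] := eqVneq t u.
  have := @control_superadd _ _ homega s t u s0; rewrite !lt_neqAle sn st tn tu => /(_ isT isT u1).
  have := ge t u t0 tu u1; lra.
have [<-|sn] := eqVneq s u; first by rewrite (control_diag homega) ?s0 // ge.
have [<-//|rn] := eqVneq r s.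
have su := le_trans st tu.
have := @control_superadd _ _ homega r s u r0; rewrite !lt_neqAle rn rs sn su => /(_ isT isT u1).
have := ge r s r0 rs s1; lra.
Qed.

Definition control_root s t : R := omega s t `^ p^-1.
Local Notation W := control_root.

Lemma control_root_ge0 s t : 0 <= W s t.
Proof. exact: powR_ge0. Qed.

Lemma control_root_mono r s t u : 0 <= r -> r <= s -> s <= t -> t <= u -> u <= 1 ->
  W s t <= W r u.
Proof.
move=> r0 rs st tu u1; have s0 := le_trans r0 rs; have t1 := le_trans tu u1.
apply: ge0_ler_powR; rewrite ?nnegrE ?invr_ge0 ?(ltW p0) ?(control_ge0 homega) //.
- exact: le_trans rs (le_trans st tu).
- exact: control_mono.
Qed.

Lemma powR_divK x y : 0 <= x -> 0 < y -> (x / y `^ p) `^ p^-1 = x `^ p^-1 / y.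
Proof.
move=> x0 y0; rewrite powRM ?invr_ge0 ?powR_ge0 //; congr (_ * _).
by rewrite -powRN -powRrM mulNr mulfV ?gt_eqF // powRN powRr1 // ltW.
Qed.

(* Condition (H_p) for r <= s < t <= u follows from the strict one by shrinking
   [s, t] by (t - s) / 4 on both sides; no limit is needed. *)
Lemma control_rootH : exists2 C : R, 0 < C & forall r s t u,
  0 <= r -> r <= s -> s < t -> t <= u -> u <= 1 -> (t - s) * W r u <= C * (u - r) * W s t.
Proof.
have [_ [C0 HC]] := hH.
pose C1 := Num.max 1 C0; have C10 : 0 < C1 by rewrite lt_max ltr01.
(* The p-th root of the constant in (H_p), made positive by the maximum with 1, times 2 for the
   halved interval. *)
exists (C1 `^ p^-1 * 2); first by rewrite mulr_gt0 // powR_gt0.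
move=> r s t u r0 rs st tu u1.
pose e := (t - s) / 4; have e0 : 0 < e by rewrite divr_gt0 // subr_gt0.
pose s' := s + e; pose t' := t - e.
have rs' : r < s' by rewrite (le_lt_trans rs) // ltrDl.
have tu' : t' < u by rewrite (lt_le_trans _ tu) // ltrBlDr ltrDl.
have st' : t' - s' = (t - s) / 2 by rewrite /t' /s' /e; field.
have ts0 : 0 < (t - s) / 2 by rewrite divr_gt0 // subr_gt0.
have s't' : s' < t' by rewrite -subr_gt0 st'.
have s0 : 0 <= s by exact: le_trans rs.
have t1 : t <= 1 by exact: le_trans u1.
have ur : 0 < u - r by rewrite subr_gt0 (le_lt_trans rs) // (lt_le_trans st).
have w0 : 0 <= omega s t by rewrite (control_ge0 homega) // ltW.
have H : omega r u / (u - r) `^ p <= C1 * (omega s t / ((t - s) / 2) `^ p).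
  apply: (le_trans (HC _ _ _ _ r0 rs' s't' tu' u1)); rewrite st'.
  have h1 : 0 <= omega s' t' / ((t - s) / 2) `^ p.
    rewrite divr_ge0 ?powR_ge0 // (control_ge0 homega) //.
    - by rewrite (le_trans s0) // lerDl ltW.
    - exact: ltW.
    - by rewrite (le_trans (ltW tu')).
  apply: (@le_trans _ _ (C1 * (omega s' t' / ((t - s) / 2) `^ p))).
    by rewrite ler_wpM2r // le_max lexx orbT.
  rewrite ler_wpM2l ?(ltW C10) // ler_wpM2r ?invr_ge0 ?powR_ge0 //.
  apply: control_mono => //.
  - by rewrite lerDl ltW.
  - exact: ltW.
  - by rewrite lerBlDr lerDl ltW.
have u0 : 0 <= omega r u.
  by rewrite (control_ge0 homega) // -subr_ge0 ltW.
have {H} : (omega r u / (u - r) `^ p) `^ p^-1 <=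
    (C1 * (omega s t / ((t - s) / 2) `^ p)) `^ p^-1.
  apply: ge0_ler_powR => //; rewrite ?nnegrE ?invr_ge0 ?(ltW p0) //.
    by rewrite divr_ge0 // powR_ge0.
  by rewrite mulr_ge0 ?(ltW C10) // divr_ge0 // powR_ge0.
rewrite [X in _ <= X]powRM ?(ltW C10) ?divr_ge0 ?powR_ge0 // !powR_divK //.
rewrite -/(W r u) -/(W s t) ler_pdivrMr // => H.
have ts : 0 < t - s by rewrite subr_gt0.
rewrite mulrC -ler_pdivlMr //; apply: (le_trans H).
rewrite le_eqVlt; apply/orP; left; apply/eqP.
by field; rewrite gt_eqF.
Qed.

(** W(0, 1) is positive since omega is monotone and not identically 0; [control_rootH] with r = 0
    and u = 1 passes this on to [s, t]. *)
Lemma control_root_gt0 s t : 0 <= s -> s < t -> t <= 1 -> 0 < W s t.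
Proof.
move=> s0 st t1; have [[a [b [a0 ab b1 w0]]] _] := hH.
have [C C0 HC] := control_rootH.
have W01 : 0 < W 0 1.
  have ab0 : 0 < W a b.
    rewrite powR_gt0 // lt_neqAle eq_sym w0 (control_ge0 homega) //.
  by apply: (lt_le_trans ab0); exact: control_root_mono.
have := HC 0 s t 1 (lexx 0) s0 st t1 (lexx 1); rewrite subr0 mulr1 => H.
rewrite -(pmulr_rgt0 _ C0); apply: lt_le_trans H.
by rewrite mulr_gt0 // subr_gt0.
Qed.

(** omega is continuous and vanishes on the diagonal; each diagonal point has its own radius, which
    compactness of [0, 1] makes uniform. *)
Lemma control_small (e : R) : 0 < e -> exists2 del : R, 0 < del &
  forall s t, 0 <= s -> s <= t -> t <= 1 -> t - s < del -> omega s t < e.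
Proof.
move=> e0.
have /compact_near_coveringP cov := @segment_compact R 0 1.
have H : \forall del \near 0^'+, `[0 : R, 1] `<=`
    [set s : R | forall t, 0 <= s -> s <= t -> t <= 1 -> t - s < del -> omega s t < e].
  apply: (cov R (0^'+) (fun del s => forall t, 0 <= s -> s <= t -> t <= 1 -> t - s < del -> omega s t < e)).
  move=> x /=; rewrite in_itv /= => /andP[x0 x1].
  have /subspace_continuousP H0 := control_continuous homega.
  have := H0 (x, x) (conj x0 (conj (lexx x) x1)); move=> /cvgrPdist_lt /(_ e e0).
  move=> /nbhs_ballP[eta /= eta0 near_xx].
  exists (ball x (eta / 2), [set del | del < eta / 2]).
    split; first by apply: nbhsx_ballx; rewrite divr_gt0.
    by apply: nbhs_right_lt; rewrite divr_gt0.
  move=> [s del] /= [xs del2] t s0 st t1 ts.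
  have := near_xx (s, t) _ (conj s0 (conj st t1)).
  rewrite /from_subspace /= (control_diag homega) ?x0 //= sub0r normrN => H.
  apply: le_lt_trans (ler_norm _) (H _); split => /=.
    by apply: le_ball xs; rewrite ler_pdivrMr // mulr_natr mulr2n lerDl ltW.
  move: xs; rewrite /ball /= !ltr_norml => /andP[h1 h2]; apply/andP; split; lra.
near (0 : R)^'+ => del; exists del => // s t s0 st t1 ts.
have Hdel : `[0 : R, 1] `<=`
    [set s : R | forall t, 0 <= s -> s <= t -> t <= 1 -> t - s < del -> omega s t < e].
  by near: del.
by apply: (Hdel s) => //=; rewrite in_itv /= s0 (le_trans st).
Unshelve. all: by end_near. Qed.

Lemma control_root_small (e : R) : 0 < e -> exists2 del : R, 0 < del &
  forall s t, 0 <= s -> s <= t -> t <= 1 -> t - s < del -> W s t < e.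
Proof.
move=> e0; have [del del0 H] := @control_small (e `^ p) (powR_gt0 _ e0).
exists del => // s t s0 st t1 ts; have w := H s t s0 st t1 ts.
have -> : e = (e `^ p) `^ p^-1 by rewrite -powRrM mulfV ?gt_eqF // powRr1 // ltW.
apply: gt0_ltr_powR; rewrite ?invr_gt0 // nnegrE ?powR_ge0 //.
by rewrite (control_ge0 homega).
Qed.

End Control.

(** * Convergence and approximation *)

Section Convergence.
Variables (R : realType) (V : finNormedModType R) (m : nat).
Local Notation d := (\dim {:V}).
Local Notation T := (tensor_alg R d m).
Local Notation G := (@free_group R V m).
Variable N : T -> R.
Hypothesis hN : homogeneous_norm N.
Variables (p : R) (omega : R -> R -> R).
Hypotheses (hp : 1 <= p) (homega : control omega) (hH : cond_H p omega).
Local Notation W := (control_root p omega).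

Let Gpath (X : R -> T) := forall t : R, 0 <= t <= 1 -> G (X t).

Lemma incr_group (X : R -> T) s t : Gpath X -> 0 <= s <= 1 -> 0 <= t <= 1 -> G (incr X s t).
Proof. by move=> GX s01 t01; apply: free_groupM; [exact/free_groupV/GX|exact: GX]. Qed.

Lemma dist_m_group g h : G g -> G h -> G (g^-1 * h).
Proof. by move=> Gg Gh; apply: free_groupM => //; exact: free_groupV. Qed.

(** W is positive, so quotients can be multiplied out; the distance to the constant path is N of the
    inverse increment, which is N of the increment. *)
Lemma norm_omega_leP (X : R -> T) (A : R) : Gpath X ->
  (norm_omega N omega p X <= A%:E)%E <->
  forall s t, 0 <= s -> s < t -> t <= 1 -> N (incr X s t) <= A * W s t.
Proof.
move=> GX.
have E s t : 0 <= s -> s < t -> t <= 1 ->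
    dist_m N (incr X s t) (incr (fun=> 1) s t) = N (incr X s t).
  move=> s0 st t1; rewrite /dist_m {2}/incr invr1 !mulr1 (hnorm_inv hN) //.
  by apply: incr_group => //; apply/andP; split=> //; [exact: le_trans (ltW st) t1|exact: le_trans s0 (ltW st)].
split=> [H s t s0 st t1|H].
  rewrite -ler_pdivrMr ?(control_root_gt0 hp homega hH) // -E // -lee_fin.
  apply: le_trans H; apply: ereal_sup_ubound; exists s, t; split => //.
apply: ge_ereal_sup => _ [s [t [s0 st t1 ->]]]; rewrite lee_fin E //.
by rewrite ler_pdivrMr ?(control_root_gt0 hp homega hH) // H.
Qed.

Lemma ereal_lt_pinfty (x : \bar R) : (x < +oo)%E -> exists2 A : R, 0 <= A & (x <= A%:E)%E.
Proof.
case: x => [r|//|] _; last by exists 0 => //; exact: leNye.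
by exists (Num.max 0 r); rewrite ?le_max ?lexx // lee_fin le_max lexx orbT.
Qed.

Lemma incr_dist_cvg0 (X : nat -> R -> T) (Y : R -> T) (s t : R) :
  (forall n, Gpath (X n)) -> Gpath Y ->
  (forall t, 0 <= t <= 1 -> (fun n => X n t) @ \oo --> Y t) ->
  0 <= s <= 1 -> 0 <= t <= 1 ->
  N ((incr (X n) s t)^-1 * incr Y s t) @[n --> \oo] --> 0.
Proof.
move=> GX GY XY s01 t01; apply: (hnorm_cvg0 hN).
  by move=> n; apply: dist_m_group; exact: incr_group.
have GI := incr_group GY s01 t01.
rewrite -(mulVr (free_group_unit GI)); apply: cvg_tensM; last exact: cvg_tens_cst.
apply: cvg_tensV.
- by move=> n; apply/free_group_scalar/incr_group.
- exact: free_group_scalar.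
apply: cvg_tensM; last exact: XY.
apply: cvg_tensV; last exact: XY.
- by move=> n; apply/free_group_scalar/GX.
- exact/free_group_scalar/GY.
Qed.

(** For fixed s and t, N(Y_{s,t}) exceeds the norm of the n-th increment by at most N of the
    quotient of the two, which tends to 0. *)
Lemma limit_bound (X : nat -> R -> T) (Y : R -> T) (A : R) :
  (forall n, Gpath (X n)) -> Gpath Y ->
  (forall t, 0 <= t <= 1 -> (fun n => X n t) @ \oo --> Y t) ->
  (forall n s t, 0 <= s -> s < t -> t <= 1 -> N (incr (X n) s t) <= A * W s t) ->
  forall s t, 0 <= s -> s < t -> t <= 1 -> N (incr Y s t) <= A * W s t.
Proof.
move=> GX GY XY XA s t s0 st t1.
have s01 : 0 <= s <= 1 by rewrite s0 (le_trans (ltW st)).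
have t01 : 0 <= t <= 1 by rewrite t1 (le_trans s0 (ltW st)).
apply/ler_addgt0Pr => e e0.
have /cvgr0Pnorm_le /(_ e e0) := incr_dist_cvg0 GX GY XY s01 t01.
move=> [n _ /(_ n (leqnn n)) /=]; rewrite ger0_norm; last first.
  by apply/(hnorm_ge0 hN)/dist_m_group; exact: incr_group.
move=> h; have -> : incr Y s t = incr (X n) s t * ((incr (X n) s t)^-1 * incr Y s t).
  by rewrite mulrA mulrV ?mul1r //; exact/free_group_unit/incr_group.
apply: le_trans (hnorm_mul hN _ _) _; [exact: incr_group|by apply: dist_m_group; exact: incr_group|].
by apply: lerD => //; exact: XA.
Qed.

Lemma grid_index (K : nat) (t : R) : 0 <= t -> exists i : nat, i%:R <= K.+1%:R * t < i.+1%:R.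
Proof.
move=> t0; exists (Num.truncn (K.+1%:R * t)).
by apply: truncn_itv; rewrite mulr_ge0.
Qed.

(** The end t = 1 goes to the last cell, hence the closed upper bound. *)
Lemma grid_cell (K : nat) (t : R) : 0 <= t <= 1 ->
  exists2 i : nat, (i < K.+1)%N & i%:R <= K.+1%:R * t <= i.+1%:R.
Proof.
move=> /andP[t0 t1]; have [i /andP[it ti]] := grid_index K t0.
have [iK|Ki] := ltnP i K.+1; first by exists i => //; rewrite it ltW.
exists K => //; apply/andP; split; first by apply: le_trans it; rewrite ler_nat ltnW.
by rewrite ler_piMr.
Qed.

Lemma div_grid (K i : nat) : K.+1%:R * (i%:R / K.+1%:R) = i%:R :> R.
Proof. by rewrite mulrCA mulfV ?mulr1 // pnatr_eq0. Qed.

(* Every increment is compared with one between points a <= s and b <= t of a fixed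
   finite grid, where pointwise convergence is uniform. *)
Lemma uniform_incr (X : nat -> R -> T) (Y : R -> T) (A e : R) :
  (forall n, Gpath (X n)) -> Gpath Y ->
  (forall t, 0 <= t <= 1 -> (fun n => X n t) @ \oo --> Y t) -> 0 <= A ->
  (forall n s t, 0 <= s -> s < t -> t <= 1 -> N (incr (X n) s t) <= A * W s t) ->
  0 < e ->
  \forall n \near \oo, forall s t, 0 <= s -> s <= t -> t <= 1 ->
    N ((incr (X n) s t)^-1 * incr Y s t) <= e.
Proof.
move=> GX GY XY A0 XA e0.
have YA := limit_bound GX GY XY XA.
have e40 : 0 < e / 4 by rewrite divr_gt0.
(* The error at the left end, u = X_{a,s} Y_{a,s}^-1, appears conjugated by X_{a,b}, whose norm is
   at most A W(0, 1). *)
have [del0 del00 Hconj] := hnorm_conj_small hN (A * W 0 1) e40.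
(* del0 / 2 is for each factor of u; e / 4 is for each of the two pieces over [b, t], leaving e / 4
   for the conjugate of u and e / 4 for the grid. *)
pose del1 := Num.min (del0 / 2) (e / 4).
have del10 : 0 < del1 by rewrite lt_min divr_gt0.
have A1 : 0 < A + 1 by rewrite ltr_wpDl.
have [eta eta0 Heta] := control_root_small hp homega (divr_gt0 del10 A1).
pose K := Num.truncn eta^-1.
have Keta : K.+1%:R^-1 < eta.
  by rewrite invf_plt ?posrE // truncnS_gt // invr_ge0 ltW.
have Kp : 0 < K.+1%:R :> R by [].
have bnd (Z : R -> T) (s t : R) : Gpath Z ->
    (forall s t, 0 <= s -> s < t -> t <= 1 -> N (incr Z s t) <= A * W s t) ->
    0 <= s -> s <= t -> t <= 1 -> N (incr Z s t) <= A * W s t.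
  move=> GZ ZA s0; rewrite le_eqVlt => /predU1P[<- s1|]; last exact: ZA.
  rewrite incr_norm_diag //; last by apply: GZ; rewrite s0.
  by rewrite mulr_ge0 // control_root_ge0.
have near_grid : \forall n \near \oo, forall ij : 'I_K.+2 * 'I_K.+2,
    N ((incr (X n) (ij.1%:R / K.+1%:R) (ij.2%:R / K.+1%:R))^-1 *
        incr Y (ij.1%:R / K.+1%:R) (ij.2%:R / K.+1%:R)) <= e / 4.
  apply: filter_forall => -[i j] /=.
  have g01 (l : 'I_K.+2) : 0 <= (l%:R / K.+1%:R : R) <= 1.
    by rewrite divr_ge0 //= ler_pdivrMr // mul1r ler_nat -ltnS.
  have /cvgr0Pnorm_le /(_ _ e40) := incr_dist_cvg0 GX GY XY (g01 i) (g01 j).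
  by apply: filterS => n; apply: le_trans; exact: ler_norm.
apply: filterS near_grid => n Hn s t s0 st t1.
have t0 := le_trans s0 st; have s1 := le_trans st t1.
have [i /andP[is_ si]] := grid_index K s0.
have [j /andP[jt tj]] := grid_index K t0.
have iK : (i < K.+2)%N.
  rewrite -(ltr_nat R) (le_lt_trans is_) // (@le_lt_trans _ _ K.+1%:R) ?ltr_nat //.
  by rewrite ler_piMr.
have jK : (j < K.+2)%N.
  rewrite -(ltr_nat R) (le_lt_trans jt) // (@le_lt_trans _ _ K.+1%:R) ?ltr_nat //.
  by rewrite ler_piMr.
have ij : (i <= j)%N.
  rewrite -ltnS -(ltr_nat R) (le_lt_trans is_) // (le_lt_trans _ tj) //.
  by rewrite ler_pM2l.
pose a : R := i%:R / K.+1%:R; pose b : R := j%:R / K.+1%:R.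
have a0 : 0 <= a by rewrite divr_ge0.
have b0 : 0 <= b by rewrite divr_ge0.
have as_ : a <= s by rewrite ler_pdivrMr // mulrC.
have bt : b <= t by rewrite ler_pdivrMr // mulrC.
have ab : a <= b by rewrite ler_pM2r ?invr_gt0 // ler_nat.
have sa : s - a < eta.
  apply: lt_trans Keta; rewrite -(ltr_pM2l Kp) mulfV ?gt_eqF // mulrBr div_grid.
  by rewrite ltrBlDr nat1r.
have tb : t - b < eta.
  apply: lt_trans Keta; rewrite -(ltr_pM2l Kp) mulfV ?gt_eqF // mulrBr div_grid.
  by rewrite ltrBlDr nat1r.
have b1 := le_trans bt t1; have a1 := le_trans as_ s1.
have AW x y : W x y < del1 / (A + 1) -> A * W x y <= del1.
  move=> w; apply: (@le_trans _ _ ((A + 1) * W x y)).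
    by rewrite ler_wpM2r ?control_root_ge0 // lerDl.
  by rewrite mulrC -ler_pdivlMr // ltW.
have Was := AW _ _ (Heta a s a0 as_ s1 sa).
have Wbt := AW _ _ (Heta b t b0 bt t1 tb).
have d1 : del1 <= del0 / 2 by rewrite ge_min lexx.
have d2 : del1 <= e / 4 by rewrite ge_min lexx orbT.
have a01 : 0 <= a <= 1 by rewrite a0.
have b01 : 0 <= b <= 1 by rewrite b0.
have s01 : 0 <= s <= 1 by rewrite s0.
have t01 : 0 <= t <= 1 by rewrite t0.
have Xas := le_trans (bnd _ a s (GX n) (XA n) a0 as_ s1) Was.
have Yas := le_trans (bnd _ a s GY YA a0 as_ s1) Was.
have Xbt := le_trans (bnd _ b t (GX n) (XA n) b0 bt t1) Wbt.
have Ybt := le_trans (bnd _ b t GY YA b0 bt t1) Wbt.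
have Xab : N (incr (X n) a b) <= A * W 0 1.
  apply: (le_trans (bnd _ a b (GX n) (XA n) a0 ab b1)).
  by rewrite ler_wpM2l // control_root_mono.
have Hab : N ((incr (X n) a b)^-1 * incr Y a b) <= e / 4 := Hn (Ordinal iK, Ordinal jK).
pose u := incr (X n) a s * (incr Y a s)^-1.
have GI Z x y : Gpath Z -> 0 <= x <= 1 -> 0 <= y <= 1 -> G (incr Z x y) by exact: incr_group.
have Gu : G u by apply: free_groupM; [exact: GI|exact/free_groupV/GI].
have uN : N u <= del0.
  apply: (le_trans (hnorm_mul hN _ _)); [exact: GI|exact/free_groupV/GI|].
  by rewrite (hnorm_inv hN); [lra|exact: GI].
have Hu := Hconj _ _ (GI _ _ _ (GX n) a01 b01) Gu Xab uN.
(* Y_{s,t} = Y_{a,s}^-1 Y_{a,b} Y_{b,t}, likewise for X, and X_{a,b} X_{a,b}^-1 is inserted between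
   u and Y_{a,b}. *)
have -> : (incr (X n) s t)^-1 * incr Y s t = (incr (X n) b t)^-1 *
    (((incr (X n) a b)^-1 * u * incr (X n) a b) * ((incr (X n) a b)^-1 * incr Y a b)) *
    incr Y b t.
  rewrite /u /incr.
  have ux x : 0 <= x <= 1 -> X n x \is a GRing.unit by move=> /(GX n)/free_group_unit.
  have uy x : 0 <= x <= 1 -> Y x \is a GRing.unit by move=> /GY/free_group_unit.
  have uxa := ux a a01; have uxb := ux b b01; have uxt := ux t t01; have uxs := ux s s01.
  have uya := uy a a01; have uyb := uy b b01; have uys := uy s s01.
  rewrite !invrM ?unitrV // !invrK !mulrA.
  by rewrite (mulrK uxb) (mulrK uxa) (mulrK uxb) (mulrVK uxa) (mulrK uya) (mulrK uyb).
have GXab := GI _ _ _ (GX n) a01 b01.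
have G1 : G ((incr (X n) a b)^-1 * u * incr (X n) a b).
  by apply: free_groupM => //; apply: free_groupM => //; exact: free_groupV.
have G2 : G ((incr (X n) a b)^-1 * incr Y a b) by apply: dist_m_group => //; exact: GI.
have G3 : G (incr (X n) b t)^-1 by exact/free_groupV/GI.
have H1 := hnorm_mul hN G1 G2.
have H2 := hnorm_mul hN G3 (free_groupM G1 G2).
have H3 := hnorm_mul hN (free_groupM G3 (free_groupM G1 G2)) (GI _ _ _ GY b01 t01).
rewrite (hnorm_inv hN) in H2; last exact: GI.
lra.
Qed.

End Convergence.

(** * Convergence for q > p and construction of the approximations *)

Section Approximation.
Variables (R : realType) (V : finNormedModType R) (m : nat).
Local Notation d := (\dim {:V}).
Local Notation T := (tensor_alg R d m).
Local Notation G := (@free_group R V m).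
Variable N : T -> R.
Hypothesis hN : homogeneous_norm N.
Variables (p : R) (omega : R -> R -> R).
Hypotheses (hp : 1 <= p) (homega : control omega) (hH : cond_H p omega).
Local Notation W := (control_root p omega).

Let Gpath (X : R -> T) := forall t : R, 0 <= t <= 1 -> G (X t).

Lemma dist_omega_cvg0 (X : nat -> R -> T) (Y : R -> T) (A q : R) :
  (forall n, Gpath (X n)) -> Gpath Y ->
  (forall t, 0 <= t <= 1 -> (fun n => X n t) @ \oo --> Y t) -> 0 <= A ->
  (forall n s t, 0 <= s -> s < t -> t <= 1 -> N (incr (X n) s t) <= A * W s t) ->
  p < q -> (fun n => dist_omega N omega q (X n) Y) @ \oo --> 0%E.
Proof.
move=> GX GY XY A0 XA pq.
have YA := limit_bound hN GX GY XY XA.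
have p0 : 0 < p by exact: lt_le_trans hp.
have q0 : 0 < q by exact: lt_trans pq.
have GI Z x y : Gpath Z -> 0 <= x <= 1 -> 0 <= y <= 1 -> G (incr Z x y) by exact: incr_group.
have small (e : R) : 0 < e -> \forall n \near \oo,
    (0 <= dist_omega N omega q (X n) Y <= e%:E)%E.
  move=> e0.
  pose al := p^-1 - q^-1.
  have al0 : 0 < al by rewrite subr_gt0 ltf_pV2.
  have A1 : 0 < 2 * A + 1 by rewrite ltr_wpDl // mulr_ge0.
  (* Chosen so that (2 A + 1) eta^al = e: where omega <= eta, the bound 2 A omega^(1/p) is at most e
     omega^(1/q); elsewhere the uniform bound e eta^(1/q) is enough. *)
  pose eta := (e / (2 * A + 1)) `^ al^-1.
  have eta0 : 0 < eta by apply: powR_gt0; rewrite divr_gt0.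
  have eq0 : 0 < e * eta `^ q^-1 by rewrite mulr_gt0 // powR_gt0.
  have := uniform_incr hN hp homega GX GY XY A0 XA eq0.
  apply: filterS => n Hn; apply/andP; split.
    apply: (@le_trans _ _ (dist_m N (incr (X n) 0 1) (incr Y 0 1) / omega 0 1 `^ q^-1)%:E).
      rewrite lee_fin divr_ge0 ?powR_ge0 //.
      by apply/(hnorm_ge0 hN)/dist_m_group; apply: GI; rewrite ?lexx ?ler01.
    by apply: ereal_sup_ubound; exists 0, 1; split.
  apply: ge_ereal_sup => _ [s [t [s0 st t1 ->]]]; rewrite lee_fin.
  have s01 : 0 <= s <= 1 by rewrite s0 (le_trans (ltW st)).
  have t01 : 0 <= t <= 1 by rewrite t1 (le_trans s0 (ltW st)).
  have w0 : 0 < omega s t.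
    have := control_root_gt0 hp homega hH s0 st t1; apply: gt0_powR.
      by rewrite invr_gt0.
    by rewrite (control_ge0 homega) // ltW.
  rewrite ler_pdivrMr ?powR_gt0 //.
  have [h|h] := leP (omega s t) eta; last first.
    apply: (le_trans (Hn s t s0 (ltW st) t1)); rewrite ler_pM2l //.
    by apply: ge0_ler_powR; rewrite ?nnegrE ?invr_ge0 ?(ltW q0) ?(ltW eta0) ?(ltW w0) ?(ltW h).
  have W_E : W s t = omega s t `^ al * omega s t `^ q^-1.
    rewrite -powRD; first by rewrite /al subrK.
    by rewrite (gt_eqF w0) implybT.
  have ae : omega s t `^ al <= e / (2 * A + 1).
    have -> : e / (2 * A + 1) = eta `^ al.
      by rewrite -powRrM mulVf ?gt_eqF // powRr1 // divr_ge0 ?ltW.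
    by apply: ge0_ler_powR; rewrite ?nnegrE ?(ltW al0) ?(ltW eta0) ?(ltW w0).
  apply: (le_trans (hnorm_mul hN _ _)).
  - by apply/free_groupV/GI.
  - exact: GI.
  rewrite (hnorm_inv hN); last exact: GI.
  apply: (@le_trans _ _ (2 * A * W s t)).
    have := XA n s t s0 st t1; have := YA s t s0 st t1; lra.
  rewrite W_E mulrA ler_wpM2r ?powR_ge0 //.
  move: ae; rewrite ler_pdivlMr // => ae; apply: le_trans ae.
  by rewrite mulrC ler_wpM2l ?powR_ge0 // lerDl.
apply/fine_cvgP; split.
  have := small 1 ltr01; apply: filterS => n /andP[h0 h1].
  by rewrite ge0_fin_numE // (le_lt_trans h1) // ltry.
apply/cvgr0Pnorm_le => e e0; have := small e e0; apply: filterS => n /andP[h0 h1] /=.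
rewrite ger0_norm ?fine_ge0 // -lee_fin fineK //.
by rewrite ge0_fin_numE // (le_lt_trans h1) // ltry.
Qed.

Lemma stairs_nodeD (v : nat -> V) i j :
  (stairs_node v (i + j) : T) = stairs_node v i * \prod_(l < j) expv (v (i + l)%N).
Proof. by rewrite /stairs_node big_split_ord. Qed.

(** The extra factor exp(0) = 1 makes each block of factors nonempty, even for an empty list. *)
Lemma pexp_nth (vs : seq V) :
  \prod_(l < (size vs).+1) expv (nth 0 vs l) = pexp vs :> T.
Proof.
rewrite big_ord_recr /= nth_default // expv0 mulr1 /pexp (big_nth 0).
by rewrite big_mkord.
Qed.

(* On each interval of the uniform grid of mesh 1 / n, y runs through the segments
   given by [chow] for the increment of Y; (H_p) makes its speed admissible. *)
Lemma stairs_interpolation (Y : R -> T) (A : R) : Gpath Y -> Y 0 = 1 -> 0 <= A ->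
  (forall s t, 0 <= s -> s < t -> t <= 1 -> N (incr Y s t) <= A * W s t) ->
  exists2 B : R, 0 <= B & forall n, exists y : R -> V, [/\ smooth_path y,
    forall k, (k <= n.+1)%N -> sig_path y (k%:R / n.+1%:R) = Y (k%:R / n.+1%:R) &
    forall k s t, (k < n.+1)%N -> k%:R / n.+1%:R <= s -> s < t -> t <= k.+1%:R / n.+1%:R ->
      N (incr (sig_path y) s t) <= B * W s t].
Proof.
move=> GY Y0 A0 YA.
have [r [K [K0 HK]]] := chow hN.
have [L L0 HL] := smooth_step_lipschitz R.
have [C C0 HC] := control_rootH hp homega hH.
(* With M = (n + 1)(r + 1) factors the speed on cell k is at most L M K A W(c k, c (k + 1));
   [control_rootH] on that cell gains C / (n + 1), and n cancels. *)
exists (L * r.+1%:R * K * A * C); first by rewrite !mulr_ge0 // ltW.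
move=> n; pose c (k : nat) : R := k%:R / n.+1%:R.
have n0 : 0 < n.+1%:R :> R by [].
have c01 k : (k <= n.+1)%N -> 0 <= c k <= 1.
  by move=> kn; rewrite divr_ge0 //= ler_pdivrMr // mul1r ler_nat.
have Hvs k : exists vs : seq V, (k < n.+1)%N -> [/\ size vs = r,
    {in vs, forall v, N (expv v) <= K * N (incr Y (c k) (c k.+1))} &
    pexp vs = incr Y (c k) (c k.+1)].
  have [kn|_] := ltnP k n.+1; last by exists [::].
  have [|vs Hv] := HK (incr Y (c k) (c k.+1)).
    by apply: incr_group => //; apply: c01 => //; exact: ltnW.
  by exists vs.
have {Hvs} [vs Hvs] := choice Hvs.
(* Factor k (r + 1) + l is the l-th of block k; the default 0 supplies the padding factor. *)
pose v j := nth 0 (vs (j %/ r.+1)%N) (j %% r.+1)%N.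
pose M := (n.+1 * r.+1)%N; have M0 : (0 < M)%N by rewrite muln_gt0.
have node k : (k <= n.+1)%N -> stairs_node v (k * r.+1) = Y (c k).
  elim: k => [|k IH] kn; first by rewrite mul0n /stairs_node big_ord0 /c mul0r Y0.
  rewrite mulSn addnC stairs_nodeD IH; last exact: ltnW.
  have [sv _ vE] := Hvs k kn.
  have -> : \prod_(l < r.+1) expv (v (k * r.+1 + l)%N) = incr Y (c k) (c k.+1).
    rewrite -vE -pexp_nth sv; apply: eq_bigr => l _.
    by rewrite /v divnMDl // modnMDl divn_small // modn_small // addn0.
  by rewrite /incr mulrA mulrV ?mul1r //; apply/free_group_unit/GY/c01/ltnW.
have sE t : 0 <= t <= 1 -> sig_path (stairs M v) t = stairs_exp M v t.
  exact: sig_path_stairs.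
exists (stairs M v); split.
- exact: smooth_stairs.
- move=> k kn; rewrite sE; last exact: c01.
  have -> : k%:R / n.+1%:R = (k * r.+1)%:R / M%:R :> R.
    by rewrite /M !natrM -mulf_div divff ?mulr1 // pnatr_eq0.
  rewrite stairs_exp_node //; last by rewrite leq_mul2r kn orbT.
  rewrite node // /c /M !natrM -mulf_div divff ?mulr1 // pnatr_eq0 //.
- move=> k s t kn ks st tk.
  have [/andP[ck0 _] /andP[_ ck1]] := (c01 k (ltnW kn), c01 k.+1 kn).
  have s01 : 0 <= s <= 1.
    by rewrite (le_trans ck0 ks) (le_trans (ltW st)) // (le_trans tk).
  have t01 : 0 <= t <= 1.
    by rewrite (le_trans tk ck1) (le_trans _ (ltW st)) //; case/andP: s01.
  have -> : incr (sig_path (stairs M v)) s t = incr (stairs_exp M v) s t :> T.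
    by rewrite /incr !sE.
  have ck : c k < c k.+1 by rewrite /c ltr_pM2r ?invr_gt0 // ltr_nat.
  have kap0 : 0 <= N (incr Y (c k) (c k.+1)).
    by apply/(hnorm_ge0 hN)/incr_group => //; apply: c01 => //; exact: ltnW.
  have key := @incr_stairs R V m N hN M v M0 L (K * N (incr Y (c k) (c k.+1)))
    (k * r.+1)%N (k.+1 * r.+1)%N L0 (mulr_ge0 K0 kap0) HL.
  apply: (le_trans (key _ _ s t _ (ltW st) _)).
  + by rewrite leq_mul2r kn orbT.
  + move=> i /andP[ki ik]; have ik' : (i %/ r.+1)%N = k.
      apply/eqP; rewrite eqn_leq -ltnS ltn_divLR // ik.
      by rewrite leq_divRL.
    have [sv vK _] := Hvs k kn; rewrite /v ik'.
    have [h|h] := ltnP (i %% r.+1) (size (vs k)); first by apply: vK; exact: mem_nth.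
    by rewrite nth_default // expv0 (hnorm1 hN) mulr_ge0.
  + rewrite /M !natrM mulrAC ler_pM2r ?ltr0n //.
    by rewrite mulrC -ler_pdivrMr.
  + rewrite /M !natrM mulrAC ler_pM2r ?ltr0n //.
    by rewrite mulrC -ler_pdivlMr.
  have HW := HC (c k) s t (c k.+1) ck0 ks st tk ck1.
  have YW := YA (c k) (c k.+1) ck0 ck ck1.
  have cc : c k.+1 - c k = n.+1%:R^-1 by rewrite /c -mulrBl -natr1 addrC addKr mul1r.
  rewrite cc in HW.
  have ts : 0 <= t - s by rewrite subr_ge0 ltW.
  apply: (@le_trans _ _ (L * M%:R * (K * (A * W (c k) (c k.+1))) * (t - s))).
    by rewrite ler_wpM2r // ler_wpM2l ?mulr_ge0 // ler_wpM2l.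
  rewrite (_ : _ * (t - s) = L * M%:R * K * A * ((t - s) * W (c k) (c k.+1))); last by ring.
  apply: (@le_trans _ _ (L * M%:R * K * A * (C * n.+1%:R^-1 * W s t))).
    by rewrite ler_wpM2l ?mulr_ge0.
  rewrite /M natrM le_eqVlt; apply/orP; left; apply/eqP.
  have nn : n.+1%:R != 0 :> R by [].
  rewrite (_ : L * (n.+1%:R * r.+1%:R) * K * A * (C / n.+1%:R * W s t) =
    n.+1%:R / n.+1%:R * (L * r.+1%:R * K * A * C * W s t)); last by ring.
  by rewrite mulfV ?mul1r.
Qed.

Lemma smooth_approx_exists (Y : R -> T) : group_path Y -> C_omega N omega p Y ->
  exists y, smooth_approx N omega p Y y.
Proof.
move=> hY [_ /ereal_lt_pinfty [A A0 YA]]; have [Y0 GY' _] := hY.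
have GY : Gpath Y by [].
move/(norm_omega_leP hN hp homega hH _ GY) : YA => YA.
have [B B0 HB] := stairs_interpolation GY Y0 A0 YA.
have [y Hy] := choice HB; exists y.
have sy n : smooth_path (y n) by case: (Hy n).
have GX n : Gpath (sig_path (y n)) by exact: sig_path_group.
pose c n (k : nat) : R := k%:R / n.+1%:R.
have W0 s t : 0 <= W s t by exact: control_root_ge0.
have leW (Z : R -> T) (E s t : R) : Gpath Z -> 0 <= E -> 0 <= s <= 1 -> s <= t ->
    (s < t -> N (incr Z s t) <= E * W s t) -> N (incr Z s t) <= E * W s t.
  move=> GZ E0 s01; rewrite le_eqVlt => /predU1P[<- _|]; last by move=> st; apply.
  by rewrite (incr_norm_diag hN) ?mulr_ge0 //; exact: GZ.
(* Cut at a node after s and a node before t: B for each end piece, and A for the middle, where the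
   increment between nodes is that of Y. *)
have bound n s t : 0 <= s -> s < t -> t <= 1 ->
    N (incr (sig_path (y n)) s t) <= (2 * B + A) * W s t.
  move=> s0 st t1; have [_ node cell] := Hy n.
  have n0 : 0 < n.+1%:R :> R by [].
  have s01 : 0 <= s <= 1 by rewrite s0 (le_trans (ltW st)).
  have t01 : 0 <= t <= 1 by rewrite t1 (le_trans s0 (ltW st)).
  have [k kn /andP[ks sk]] := grid_cell n s01.
  have [l ln /andP[lt tl]] := grid_cell n t01.
  have ks' : c n k <= s by rewrite ler_pdivrMr // mulrC.
  have lt' : c n l <= t by rewrite ler_pdivrMr // mulrC.
  have sk' : s <= c n k.+1 by rewrite ler_pdivlMr // mulrC.
  have tl' : t <= c n l.+1 by rewrite ler_pdivlMr // mulrC.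
  have AW := mulr_ge0 A0 (W0 s t); have BW := mulr_ge0 B0 (W0 s t).
  have [lk|kl|kl] := ltngtP l k.
  - have : t <= s.
      apply: (le_trans tl'); apply: le_trans ks'; rewrite /c ler_pM2r ?invr_gt0 //.
      by rewrite ler_nat.
    by rewrite leNgt st.
  - have kl' : c n k.+1 <= c n l by rewrite /c ler_pM2r ?invr_gt0 // ler_nat.
    have k01 : 0 <= c n k.+1 <= 1.
      by rewrite divr_ge0 //= ler_pdivrMr // mul1r ler_nat.
    have l01 : 0 <= c n l <= 1.
      by rewrite divr_ge0 //= ler_pdivrMr // mul1r ler_nat ltnW.
    have kt := le_trans kl' lt'; have sl := le_trans sk' kl'.
    have [/andP[k0 k1] /andP[l0 l1]] := (k01, l01).
    have h1 : N (incr (sig_path (y n)) s (c n k.+1)) <= B * W s t.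
      apply: (@le_trans _ _ (B * W s (c n k.+1))).
        by apply: leW => // h; apply: (cell k).
      by apply: ler_wpM2l => //; apply: (control_root_mono hp homega).
    have h2 : N (incr (sig_path (y n)) (c n k.+1) (c n l)) <= A * W s t.
      have -> : incr (sig_path (y n)) (c n k.+1) (c n l) = incr Y (c n k.+1) (c n l).
        by rewrite /incr !node // ltnW.
      apply: (@le_trans _ _ (A * W (c n k.+1) (c n l))).
        by apply: leW => // h; apply: YA.
      by apply: ler_wpM2l => //; apply: (control_root_mono hp homega).
    have h3 : N (incr (sig_path (y n)) (c n l) t) <= B * W s t.
      apply: (@le_trans _ _ (B * W (c n l) t)).
        by apply: leW => // h; apply: (cell l).
      by apply: ler_wpM2l => //; apply: (control_root_mono hp homega).
    have h4 := incr_norm_triangle hN (GX n s s01) (GX n _ k01) (GX n t t01).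
    have h5 := incr_norm_triangle hN (GX n _ k01) (GX n _ l01) (GX n t t01).
    lra.
  - rewrite kl in tl'; have := cell k s t kn ks' st tl'; lra.
split => //.
  apply: le_lt_trans (ltry (2 * B + A)).
  apply: ge_ereal_sup => _ [n _ <-].
  by apply/(norm_omega_leP hN hp homega hH _ (GX n)); exact: bound.
move=> t t01; have [/andP[t0 t1]] := t01.
(* At the node c n k <= t the signature equals Y, and from there to t both move by at most a
   constant times W(c n k, t), which is small on a fine grid. *)
have NX : N ((Y t)^-1 * sig_path (y n) t) @[n --> \oo] --> 0.
  apply/cvgr0Pnorm_le => e e0.
  have D0 : 0 < 2 * B + 2 * A + 1 by rewrite ltr_wpDl // addr_ge0 ?mulr_ge0.
  have [eta eta0 Heta] := control_root_small hp homega (divr_gt0 e0 D0).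
  near=> n.
  have GYn : G ((Y t)^-1 * sig_path (y n) t).
    by apply: free_groupM; [exact/free_groupV/GY|exact: GX].
  rewrite ger0_norm; last exact: (hnorm_ge0 hN).
  have n0 : 0 < n.+1%:R :> R by [].
  have [k kn /andP[kt tk]] := grid_cell n t01.
  have kt' : c n k <= t by rewrite ler_pdivrMr // mulrC.
  have k0 : 0 <= c n k by rewrite divr_ge0.
  have k01 : 0 <= c n k <= 1 by rewrite k0 (le_trans kt').
  have tk' : t - c n k < eta.
    apply: (@le_lt_trans _ _ n.+1%:R^-1).
      by rewrite -(ler_pM2l n0) mulrBr div_grid mulfV ?gt_eqF // lerBlDr nat1r.
    near: n; have := @cvg_harmonic R => /cvgr0Pnorm_lt /(_ _ eta0).
    by apply: filterS => n /=; rewrite ger0_norm // invr_ge0.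
  have w := Heta _ _ k0 kt' t1 tk'.
  have h1 : N (incr Y (c n k) t) <= A * W (c n k) t by apply: leW => // h; exact: YA.
  have h2 : N (incr (sig_path (y n)) (c n k) t) <= (2 * B + A) * W (c n k) t.
    by apply: leW => //; [rewrite addr_ge0 ?mulr_ge0|move=> h; exact: bound].
  have -> : (Y t)^-1 * sig_path (y n) t = (incr Y (c n k) t)^-1 * incr (sig_path (y n)) (c n k) t.
    have [_ node _] := Hy n.
    rewrite /incr node; last exact: ltnW.
    have uY := free_group_unit (GY _ k01); have uYt := free_group_unit (GY _ t01).
    by rewrite invrM ?unitrV // invrK !mulrA mulrK.
  have GI (Z : R -> T) : Gpath Z -> G (incr Z (c n k) t) by move=> GZ; exact: incr_group.
  apply: (le_trans (hnorm_mul hN (free_groupV (GI _ GY)) (GI _ (GX n)))).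
  rewrite (hnorm_inv hN); last exact: GI.
  move: w; rewrite ltr_pdivlMr // => w.
  have := W0 (c n k) t; have := h1; have := h2; nra.
have GYn n : G ((Y t)^-1 * sig_path (y n) t).
  by apply: free_groupM; [exact/free_groupV/GY|exact: GX].
have lim1 : (fun n => (Y t)^-1 * sig_path (y n) t) @ \oo --> (1 : T).
  exact: (hnorm_cvg1 hN GYn NX).
have : (fun n => Y t * ((Y t)^-1 * sig_path (y n) t)) @ \oo --> Y t * 1.
  by apply: cvg_tensM => //; exact: cvg_tens_cst.
rewrite mulr1.
have -> // : (fun n => Y t * ((Y t)^-1 * sig_path (y n) t)) = (fun n => sig_path (y n) t).
by apply/funext => n; rewrite mulrA mulrV ?mul1r //; exact/free_group_unit/GY.
Unshelve. all: by end_near. Qed.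

Lemma smooth_approx_bound (Y : R -> T) (y : nat -> R -> V) :
  group_path Y -> smooth_approx N omega p Y y ->
  exists2 A : R, 0 <= A & forall n s t, 0 <= s -> s < t -> t <= 1 ->
    N (incr (sig_path (y n)) s t) <= A * W s t.
Proof.
move=> hY [sy /ereal_lt_pinfty [A A0 HA] _]; exists A => // n.
have GX : Gpath (sig_path (y n)) by exact: sig_path_group.
apply/(norm_omega_leP hN hp homega hH _ GX); apply: le_trans HA.
by apply: ereal_sup_ubound; exists n.
Qed.

End Approximation.

Theorem theorem15 (R : realType) (V : finNormedModType R) (m : nat)
    (hm : (1 <= m)%N) (p : R) (hp : 1 <= p)
    (N : tensor_alg R (\dim {:V}) m -> R) (hN : homogeneous_norm N)
    (omega : R -> R -> R) (homega : control omega) (hH : cond_H p omega)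
    (Y : R -> tensor_alg R (\dim {:V}) m) (hY : group_path Y) :
  (C_omega N omega p Y <->
     exists y : nat -> R -> V, smooth_approx N omega p Y y) /\
  (forall y : nat -> R -> V, smooth_approx N omega p Y y ->
     forall q : R, p < q ->
       (fun n => dist_omega N omega q (sig_path (y n)) Y) @ \oo --> 0%E).
Proof.
have [_ GY _] := hY; split; last first.
  move=> y ay q pq; have [A A0 HA] := smooth_approx_bound hN hp homega hH hY ay.
  have [sy _ XY] := ay.
  apply: (dist_omega_cvg0 hN hp homega hH) HA pq => // n.
  exact: sig_path_group.
split=> [|[y ay]]; first exact: smooth_approx_exists.
split=> //; have [A A0 HA] := smooth_approx_bound hN hp homega hH hY ay.
have [sy _ XY] := ay.
apply: (@le_lt_trans _ _ A%:E _ _ _ (ltry A)).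
apply/(norm_omega_leP hN hp homega hH _ GY).
apply: limit_bound HA => // n.
exact: sig_path_group.
Qed.
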